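(* Let $\nu>0$, $f\in H$, and let $u$ be a strong solution of the periodic two-dimensional Navier--Stokes equations $u_t+\nu Au+B(u,u)=f$, $u(0)=u_0\in V$. Fix $t_0\ge 0$ and assume $$U_0:=\operatorname*{ess\,sup}_{t\ge t_0}|u(t)|<\infty,\qquad U_1:=\operatorname*{ess\,sup}_{t\ge t_0}\|\nabla u(t)\|_{L^2}<\infty .$$ Let $m\in W^{2,\infty}(\mathbb T^2;\mathbb R^2)$ be a time-independent unit vector field admitting a controlled adapted covering, and assume that its shear defect satisfies $$K_m\lambda_1^{-1/2}U_0\|\mathcal A_m\|_{L^\infty}\le \frac{\nu}{4}.$$ Define $$A_*:=\frac{2K_m}{\nu}U_1^2,\qquad B_*:=A_*\Bigl[1+\log\Bigl(1+\frac{2C_{\rm fr}A_*}{\nu}\Bigr)\Bigr].$$ If $\mu>0$ and $\mu\ge B_*/2$, then every strong solution $v$ of the nudged system $$v_t+\nu Av+B(v,v)=f-\mu P_\sigma\bigl(((v-u)\cdot m)\,m\bigr),\qquad v(0)=v_0\in V,$$ satisfies $$|v(t)-u(t)|^2\le \exp\Bigl(-\frac{\nu\lambda_1}{2}(t-t_0)\Bigr)|v(t_0)-u(t_0)|^2,\qquad t\ge t_0 .$$ In particular, $v$ synchronizes exponentially with $u$ in $H$.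
   Context: Functional setting. $\mathbb T^2=(\mathbb R/2\pi\mathbb Z)^2$. $H$ is the space of divergence-free, mean-zero fields in $L^2(\mathbb T^2)^2$, and $V=H^1(\mathbb T^2)^2\cap H$. $(\cdot,\cdot)$ and $|\cdot|$ are the $L^2$ inner product and norm; $\|u\|=\|\nabla u\|_{L^2}$ for $u\in V$. $\lambda_1>0$ is a fixed Poincaré constant: $\lambda_1|u|^2\le\|u\|^2$ for $u\in V$ (one may take $\lambda_1=1$). $P_\sigma:L^2(\mathbb T^2)^2\to H$ is the orthogonal projection, $A=-P_\sigma\Delta$ with $D(A)=H^2(\mathbb T^2)^2\cap H$, $B(u,v)=P_\sigma((u\cdot\nabla)v)$, $b(u,v,w)=\int_{\mathbb T^2}(u\cdot\nabla v)\cdot w\,dx$. A strong solution (of either system) is one that for every $T>0$ lies in $C([0,T];V)\cap L^2(0,T;D(A))$ with time derivative in $L^2(0,T;H)$. Frame and shear defect. For a unit field $m$ ($|m|=1$ a.e.), $n:=m^\perp=(-m_2,m_1)$, $D_nF:=n\cdot\nabla F$ (componentwise on vectors), and $\mathcal A_m:=D_nn-(\nabla\cdot n)n$. Controlled adapted covering. A unit field $m\in W^{2,\infty}(\mathbb T^2;\mathbb R^2)$ admits a controlled adapted covering if there exist $L_y,L_s>0$, the torus $\widehat{\mathbb T}^2=(\mathbb R/L_y\mathbb Z)\times(\mathbb R/L_s\mathbb Z)$ with periodic coordinates $Y=(y,s)$, a smooth finite covering map $\Phi:\widehat{\mathbb T}^2\to\mathbb T^2$, and a positive function $q\in W^{2,\infty}(\widehat{\mathbb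 T}^2)$ such that $\partial_s\Phi=q\,(n\circ\Phi)$ and, with $\Gamma(Y):=(D\Phi(Y))^{-1}$, $$\mathfrak C_\Phi:=\|D\Phi\|_{W^{2,\infty}}+\|\Gamma\|_{W^{2,\infty}}+\|q\|_{W^{2,\infty}}+\|q^{-1}\|_{W^{2,\infty}}<\infty .$$ One such covering is fixed. Constants. For $r\in H^1(\mathbb T^2)$ let $\mathcal L_m(r)=1+\log\bigl(1+\|r\|_{H^1(\mathbb T^2)}^2/|r|_{L^2}^2\bigr)$ if $r\not\equiv0$ and $\mathcal L_m(r)=1$ if $r\equiv0$. $K_m>0$ is a fixed constant, depending only on the chosen covering and $\|m\|_{W^{2,\infty}}$, with the following property (such a constant exists): for all $\nu>0$ and all $u,e\in V$ with $K_m\lambda_1^{-1/2}\|u\|_{L^2}\|\mathcal A_m\|_{L^\infty}\le\nu/4$, putting $r=e\cdot m$, one has $|b(e,u,e)|\le\frac{\nu}{2}\|\nabla e\|_{L^2}^2+\frac{K_m}{\nu}\|\nabla u\|_{L^2}^2\mathcal L_m(r)|r|_{L^2}^2$. $C_{\rm fr}$ is a fixed constant, depending only on $\|m\|_{W^{1,\infty}}$ and the Poincaré constant, such that $\|e\cdot m\|_{H^1(\mathbb T^2)}^2\le C_{\rm fr}\|\nabla e\|_{L^2}^2$ for all $e\in V$. *)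

(* Defs.v *)
From HB Require Import structures.
From mathcomp Require Import all_boot all_order all_algebra.
From mathcomp Require Import all_classical all_reals all_analysis.
From mathcomp Require Import ess_sup_inf.

Set Implicit Arguments.
Unset Strict Implicit.
Unset Printing Implicit Defensive.
Import Order.TTheory GRing.Theory Num.Theory.
Import numFieldNormedType.Exports.

Local Open Scope classical_set_scope.
Local Open Scope ring_scope.

(* Functions on the flat torus (R / P.1 Z) x (R / P.2 Z) are represented by
   P-periodic functions on R * R; integrals, norms and "almost everywhere" refer
   to Lebesgue measure on one period cell.  Elements of Lebesgue and Sobolev
   spaces are representatives, compared up to null sets. *)

Section Torus.
Context {R : realType}.
Implicit Types (P : R * R) (i j k : 'I_2) (x y : R * R) (f g : R * R -> R).

(* R * R with the measurable structure on which Lebesgue measure is defined. *)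
Local Notation plane := (measurableTypeR R * measurableTypeR R)%type.

Definition cell P : set plane := `[0, P.1[ `*` `[0, P.2[.

Lemma measurable_cell P : measurable (cell P).
Proof. by apply: measurableX; exact: measurable_itv. Qed.

Definition torus_measure P : {measure set plane -> \bar R} :=
  mrestr (lebesgue_measure \x lebesgue_measure)%E (measurable_cell P).

Definition torus_fun P f := periodic f (P.1, 0) /\ periodic f (0, P.2).

Definition e_ i : R * R := if i == 0 then (1, 0) else (0, 1).

Definition partial i f : R * R -> R := fun x => 'D_(e_ i) f x.

Definition smooth f := forall (s : seq 'I_2) i,
  continuous (foldr partial f s) /\
  forall x, derivable (foldr partial f s) x (e_ i).

Definition Leb P (p : \bar R) f :=
  [/\ measurable_fun [set: plane] f, torus_fun P f
    & finite_norm (torus_measure P) p f].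

Definition is_wderiv P i f g := forall phi, smooth phi -> torus_fun P phi ->
  \int[torus_measure P]_x (f x * partial i phi x) =
  - \int[torus_measure P]_x (g x * phi x).

(* The weak derivative in L^1 (unique up to null sets); it is 0 when there is
   none. *)
Definition wderiv P i f : R * R -> R :=
  xget (cst 0) [set g | Leb P 1%E g /\ is_wderiv P i f g].

Fixpoint Sobolev P (l : nat) (p : \bar R) f : Prop :=
  if l is l'.+1 then
    Leb P p f /\ forall i, exists2 g, is_wderiv P i f g & Sobolev P l' p g
  else Leb P p f.

Definition W2inf_norm P f : \bar R :=
  let N g := Lnorm (torus_measure P) +oo%E (EFin \o g) in
  if `[< Sobolev P 2 +oo%E f >] then
    (N f + \sum_i N (wderiv P i f)
     + \sum_i \sum_k N (wderiv P k (wderiv P i f)))%E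
  else +oo%E.

End Torus.

(* Vector fields are given by their components. *)
Notation vfield R := ('I_2 -> R * R -> R).

Section Fields.
Context {R : realType}.
Implicit Types (u v w e m : vfield R) (r : R * R -> R) (x : R * R).

Definition T2 : R * R := (2 * pi, 2 * pi).
Notation mu := (torus_measure T2).

Definition ip u v : R := \sum_i \int[mu]_x (u i x * v i x).
Definition normH u : R := Num.sqrt (ip u u).

Definition sqL2 r : R := \int[mu]_x (r x ^+ 2).
Definition sqH1 r : R := sqL2 r + \sum_i sqL2 (wderiv T2 i r).

Definition normV u : R :=
  Num.sqrt (\sum_j \sum_i sqL2 (wderiv T2 i (u j))).

Definition normH2 u : R := Num.sqrt (\sum_j (sqH1 (u j) +
  \sum_i \sum_k sqL2 (wderiv T2 k (wderiv T2 i (u j))))).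

Definition spaceH u :=
  [/\ forall i, Leb T2 2%:E (u i),
      forall i, \int[mu]_x u i x = 0
    & forall phi, smooth phi -> torus_fun T2 phi ->
        \sum_i \int[mu]_x (u i x * partial i phi x) = 0].

Definition spaceV u := spaceH u /\ forall i, Sobolev T2 1 2%:E (u i).
Definition domA u := spaceH u /\ forall i, Sobolev T2 2 2%:E (u i).

Definition field_eq u v := forall i, {ae mu, forall x, u i x = v i x}.

(* G = P_sigma F *)
Definition leray (F G : vfield R) :=
  [/\ forall i, Leb T2 2%:E (F i), spaceH G
    & forall w, spaceH w -> ip (F - G) w = 0].

Definition laplacian u : vfield R := fun j x =>
  \sum_i wderiv T2 i (wderiv T2 i (u j)) x.

(* G = A u *)
Definition stokes u (G : vfield R) := domA u /\ leray (- laplacian u) G.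

Definition advection u v : vfield R := fun j x =>
  \sum_i u i x * wderiv T2 i (v j) x.

(* G = B(u, v) *)
Definition bilinearB u v (G : vfield R) := leray (advection u v) G.

Definition trilinear u v w : R :=
  \int[mu]_x \sum_j (advection u v j x * w j x).

Definition dot u m : R * R -> R := fun x => \sum_i u i x * m i x.

(* Spaces of functions of time with values in a space X of fields normed by N. *)

Definition simple_path (X : set (vfield R)) (s : R -> vfield R) :=
  exists (l : nat) (E : 'I_l -> set R) (c : 'I_l -> vfield R),
    (forall a, measurable (E a) /\ X (c a)) /\
    s = fun t i x => \sum_a \1_(E a) t * c a i x.

Definition bochner_L2 (X : set (vfield R)) (N : vfield R -> R) (T : R)
    (g : R -> vfield R) :=
  [/\ {ae lebesgue_measure, forall t : R, 0 < t < T -> X (g t)},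
      exists s : nat -> R -> vfield R, (forall l, simple_path X (s l)) /\
        {ae lebesgue_measure, forall t : R, 0 < t < T ->
           N (g t - s l t) @[l --> \oo] --> (0 : R)}
    & (\int[lebesgue_measure]_(t in `]0%R, T[) ((N (g t)) ^+ 2)%:E < +oo)%E].

Definition continuous_path (X : set (vfield R)) (N : vfield R -> R) (T : R)
    (g : R -> vfield R) :=
  forall t, 0 <= t <= T ->
    X (g t) /\ N (g s - g t) @[s --> within `[0, T] (nbhs t)] --> (0 : R).

Definition time_test (T : R) (phi : R -> R) :=
  (forall l t, derivable (derive1n l phi) t 1) /\
  exists a b, [/\ 0 < a, b < T & forall t, t < a \/ b < t -> phi t = 0].

(* g is the derivative of u in the sense of H-valued distributions on ]0, T[. *)
Definition time_derivative (T : R) (u g : R -> vfield R) :=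
  forall h, spaceH h -> forall phi, time_test T phi ->
    \int[lebesgue_measure]_(t in `]0, T[) (derive1 phi t * ip (u t) h) =
    - \int[lebesgue_measure]_(t in `]0, T[) (phi t * ip (g t) h).

(* u is a strong solution of u_t + nu A u + B(u,u) = rhs, u(0) = u0; the
   right-hand side at time t is any field in rhs t. *)
Definition strong_solution (nu : R) (rhs : R -> set (vfield R)) (u0 : vfield R)
    (u : R -> vfield R) :=
  exists ut : R -> vfield R,
  [/\ forall T, 0 < T ->
        [/\ continuous_path spaceV normV T u, bochner_L2 domA normH2 T u,
            bochner_L2 spaceH normH T ut & time_derivative T u ut],
      {ae lebesgue_measure, forall t : R, 0 < t ->
         exists a b g, [/\ stokes (u t) a, bilinearB (u t) (u t) b, rhs t g
           & field_eq (fun j x => ut t j x + nu * a j x + b j x) g]}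
    & field_eq (u 0) u0].

Definition NS_solution (nu : R) f u0 (u : R -> vfield R) :=
  strong_solution nu (fun=> [set f]) u0 u.

Definition nudged_solution (nu lam : R) f m (u : R -> vfield R) v0
    (v : R -> vfield R) :=
  strong_solution nu (fun t => [set g | exists2 p,
      leray (fun j x => dot (v t - u t) m x * m j x) p
      & g = fun j x => f j x - lam * p j x]) v0 v.

Definition ess_sup_from (t0 : R) (h : R -> R) : \bar R :=
  ess_sup (mrestr lebesgue_measure (measurable_itv `[t0, +oo[)) (EFin \o h).

Definition perp m : vfield R := fun i => if i == 0 then - m 1 else m 0.

Definition divergence v : R * R -> R := fun x => \sum_i wderiv T2 i (v i) x.

Definition shear_defect m : vfield R := fun j x =>
  advection (perp m) (perp m) j x - divergence (perp m) x * perp m j x.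

Definition normLinf v : R :=
  fine (Lnorm mu +oo%E (fun x => (Num.sqrt (\sum_j v j x ^+ 2))%:E)).

Definition unit_field_W2inf m :=
  (forall i, Sobolev T2 2 +oo%E (m i)) /\
  {ae mu, forall x, \sum_i m i x ^+ 2 = 1}.

End Fields.

Section Covering.
Context {R : realType}.
Implicit Types (P : R * R) (Phi m : vfield R) (x y Y : R * R).

Definition lattice P : set (R * R) :=
  [set z | exists a b : int, z = (a%:~R * P.1, b%:~R * P.2)].

(* Preimages in R * R of subsets of the torus. *)
Definition saturated P (U : set (R * R)) :=
  forall x y, lattice P (x - y) -> U x -> U y.

Definition point_map Phi Y : R * R := (Phi 0 Y, Phi 1 Y).

Definition jacobian Phi Y : 'M[R]_2 := \matrix_(j, i) partial i (Phi j) Y.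

(* V -> U is, modulo the lattices, a homeomorphism. *)
Definition homeo_mod P P' Phi (V U : set (R * R)) :=
  [/\ forall Y Z, V Y -> V Z ->
        lattice P' (point_map Phi Y - point_map Phi Z) -> lattice P (Y - Z),
      forall x, U x -> exists2 Y, V Y & lattice P' (point_map Phi Y - x)
    & forall W, open W -> W `<=` V ->
        open [set x | exists2 Y, W Y & lattice P' (point_map Phi Y - x)]].

(* Phi is a lift to R * R of a smooth finite covering map from the torus with
   periods P to the torus with periods P'.  With the invertibility of the
   Jacobian, every evenly covered sheet is mapped diffeomorphically. *)
Definition smooth_finite_covering P P' Phi :=
  [/\ forall j, smooth (Phi j),
      forall Y Z, lattice P (Y - Z) ->
        lattice P' (point_map Phi Y - point_map Phi Z),
      forall Y, jacobian Phi Y \in unitmx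
    & forall x, exists (U : set (R * R)) (l : nat) (V : 'I_l -> set (R * R)),
        [/\ [/\ U x, open U, saturated P' U & (0 < l)%N],
            forall a, [/\ open (V a), saturated P (V a)
                        & homeo_mod P P' Phi (V a) U],
            trivIset [set: 'I_l] V
          & point_map Phi @^-1` U = \bigcup_a V a]].

Definition covering_norm P Phi (q : R * R -> R) : \bar R :=
  (\sum_j \sum_i W2inf_norm P (fun Y => jacobian Phi Y j i)
   + \sum_i \sum_j W2inf_norm P (fun Y => invmx (jacobian Phi Y) i j)
   + W2inf_norm P q + W2inf_norm P (fun Y => ((q Y)^-1)%R))%E.

Definition controlled_adapted_covering m :=
  exists (P : R * R) (Phi : vfield R) (q : R * R -> R),
    [/\ 0 < P.1 /\ 0 < P.2,
        smooth_finite_covering P T2 Phi,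
        Sobolev P 2 +oo%E q /\ (forall Y, 0 < q Y),
        {ae torus_measure P, forall Y j,
           partial 1 (Phi j) Y = q Y * perp m j (point_map Phi Y)}
      & (covering_norm P Phi q < +oo)%E].

End Covering.

Section Constants.
Context {R : realType}.
Implicit Types (u e m : vfield R) (r : R * R -> R).

Definition poincare_constant (lam1 : R) :=
  0 < lam1 /\ forall u, spaceV u -> lam1 * normH u ^+ 2 <= normV u ^+ 2.

Definition logfactor r : R :=
  if `[< {ae torus_measure T2, forall x, r x = 0} >] then 1
  else 1 + ln (1 + sqH1 r / sqL2 r).

(* K is admissible as the constant K_m of the log-corrected trilinear estimate. *)
Definition trilinear_constant (lam1 : R) m (K : R) :=
  0 < K /\
  forall nu u e, 0 < nu -> spaceV u -> spaceV e ->
    K * (Num.sqrt lam1)^-1 * normH u * normLinf (shear_defect m) <= nu / 4 ->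
    `|trilinear e u e| <=
      nu / 2 * normV e ^+ 2 +
      K / nu * normV u ^+ 2 * logfactor (dot e m) * sqL2 (dot e m).

(* C is admissible as the constant C_fr of the frame estimate. *)
Definition frame_constant m (C : R) :=
  forall e, spaceV e -> sqH1 (dot e m) <= C * normV e ^+ 2.

Definition exponential_synchronization (t0 : R) (u v : R -> vfield R) :=
  exists C kappa : R, 0 < kappa /\
    forall t, t0 <= t -> normH (v t - u t) <= C * expR (- kappa * (t - t0)).

End Constants.

(* Main.v *)
Require Import Defs.
From mathcomp Require Import all_boot all_order all_algebra.
From mathcomp Require Import all_classical all_reals all_analysis.
From mathcomp Require Import ess_sup_inf measurable_realfun.
From mathcomp Require Import ring lra zify.
Import Order.TTheory GRing.Theory Num.Theory.
Import numFieldNormedType.Exports.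
Set Implicit Arguments.
Unset Strict Implicit.
Unset Printing Implicit Defensive.
Local Open Scope classical_set_scope.
Local Open Scope ring_scope.

(** Let e = v - u.  Testing the difference of the two equations with e, the
    convective terms leave only b(e, u, e) because b(v, e, e) = 0, and the
    feedback gives - mu |r|^2 with r = e . m:
      1/2 d/dt |e|^2 = - nu ||e||^2 - b(e, u, e) - mu |r|^2.
    The trilinear estimate bounds |b(e, u, e)| by
    nu/2 ||e||^2 + A/2 L(r) |r|^2.  The factor L(r) is unbounded, but by the
    frame estimate it grows at most like the logarithm of the quotient of
    ||e||^2 by |r|^2: a tangent line of the logarithm gives
    A L(r) |r|^2 <= nu/2 ||e||^2 + B |r|^2 (ln_tangent_bound,
    logfactor_bound).  As mu >= B/2, the right-hand side of the balance is at
    most - nu/4 ||e||^2, which by Poincare's inequality is at most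
    - nu lam1/4 |e|^2 (nudged_dissipation), and Gronwall's inequality
    concludes.

    Two points need an analytic development.

    In space, the identities of energy_identity rest on integration by parts
    for weak derivatives (weak_parts), on b(v, e, e) = 0 (convect_antisym) and
    on the square integrability of the convective terms, which holds because
    functions of H^2 are bounded (H2_bounded).  All three come from real
    Fourier sums: truncation commutes with weak differentiation
    (partial_fourier_sum), and trigonometric polynomials are dense in L^2
    (trigpoly_dense).  Density is obtained by a pi-lambda argument, starting
    from an explicit approximation of indicators of coordinate half-planes.
    With a weight, the same argument shows that an integrable function orthogonal to all
    trigonometric polynomials is zero (trigpoly_separates), hence that weak
    derivatives are unique.

    In time, the derivative of e is only given in the sense of distributions,
    against fixed fields h.  Smooth plateaus as test functions give
    (e(r) - e(s), h) as the integral of (e_t, h) over ]s, r] (weak_FTC).  The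
    choice h = e(r) + e(s) and the uniform continuity of e in H yield the
    energy inequality (energy_inequality), and energy_decay integrates it.
    Measurability of (e_t, h) is available only after a change of e_t on a
    null set (bochner_representative), and integrals of functions that are not
    measurable have to be compared
    (ae_eq_Rintegral_nonmeasurable). *)

(** * Square-integrable functions *)

Section SquareIntegrable.
Context d (T : measurableType d) (R : realType).
Variable mu : {measure set T -> \bar R}.
Implicit Types f g h : T -> R.

(** Membership in L^2 of the measure, phrased through the integral of f^2 so
    that linear combinations and products reduce to integrability. *)
Definition sqint f :=
  measurable_fun setT f /\ mu.-integrable setT (EFin \o (fun x => f x ^+ 2)).

Local Notation inner f g := (\int[mu]_x (f x * g x)).

Lemma sqint_Lfun f : sqint f <-> f \in Lfun mu 2%:E.
Proof.
split=> [[mf sf]|lf]; last first.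
  split; last exact: Lfun2_integrable_sqr.
  by move: lf; rewrite inE => /andP[]; rewrite inE.
rewrite inE; apply/andP; split; rewrite inE //=.
rewrite /finite_norm unlock poweR_lty//.
move/integrableP: sf => [_]; apply: le_lt_trans.
apply: ge0_le_integral => //.
- by move=> x _; exact: poweR_ge0.
- apply/measurable_EFinP.
  apply/(@measurableT_comp _ _ _ _ _ _ (fun x : R => x `^ 2)%R) => //.
  exact/measurableT_comp.
- by apply: measurableT_comp => //; apply/measurable_EFinP; exact: measurable_funX.
by move=> x _ /=; rewrite lee_fin normrX powR_mulrn.
Qed.

Lemma integrable_mulr_sqint f g : sqint f -> sqint g ->
  mu.-integrable setT (EFin \o (fun x => f x * g x)).
Proof.
by move=> /sqint_Lfun lf /sqint_Lfun lg; apply/Lfun1_integrable/Lfun2_mul_Lfun1.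
Qed.

Lemma sqintD f g : sqint f -> sqint g -> sqint (fun x => f x + g x).
Proof.
move=> /sqint_Lfun lf /sqint_Lfun lg; apply/sqint_Lfun.
by have [_] := @Lfun_addr_closed _ _ _ mu 2%:E (lee1n 2); exact.
Qed.

Lemma sqintZ a f : sqint f -> sqint (fun x => a * f x).
Proof.
move=> [mf sf]; split; first exact: measurable_funM.
rewrite (_ : _ \o _ = (fun x => (a ^+ 2)%:E * (EFin \o (fun x => f x ^+ 2)%R) x)%E).
  exact: integrableZl.
by apply/funext => x /=; rewrite exprMn EFinM.
Qed.

Lemma sqintN f : sqint f -> sqint (fun x => - f x).
Proof.
move=> /(sqintZ (-1)); congr sqint.
by apply/funext => x; rewrite mulN1r.
Qed.

Lemma sqintB f g : sqint f -> sqint g -> sqint (fun x => f x - g x).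
Proof. by move=> sf sg; apply: sqintD => //; exact: sqintN. Qed.

Lemma sqint0 : sqint (fun=> 0).
Proof.
split; first exact: measurable_cst.
rewrite (_ : _ \o _ = cst 0%E); first exact: integrable0.
by apply/funext => x /=; rewrite expr0n.
Qed.

Lemma sqint_sum (I : Type) (r : seq I) (P : pred I) (F : I -> T -> R) :
  (forall i, sqint (F i)) -> sqint (fun x => \sum_(i <- r | P i) F i x).
Proof.
move=> sF; elim: r => [|i r IH].
  by under eq_fun do rewrite big_nil; exact: sqint0.
under eq_fun do rewrite big_cons.
by case: (P i) => //; apply: sqintD.
Qed.

Lemma sqint_bounded_mul (M : R) f g : measurable_fun setT f ->
  (forall x, `|f x| <= M) -> sqint g -> sqint (fun x => f x * g x).
Proof.
move=> mf fM [mg sg]; split; first exact: measurable_funM.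
apply: (@le_integrable _ _ _ mu setT measurableT _ (EFin \o (fun x => M ^+ 2 * g x ^+ 2))) => //.
- by apply/measurable_EFinP; apply: measurable_funX; exact: measurable_funM.
- move=> x _ /=; rewrite lee_fin exprMn [X in X <= _]normrM [X in _ <= X]normrM !normrX.
  apply: ler_wpM2r; first by rewrite exprn_ge0.
  rewrite lerXn2r// ?nnegrE//.
  by apply: le_trans (fM x) (ler_norm _).
rewrite (_ : _ \o _ = (fun x => (M ^+ 2)%:E * (EFin \o (fun x => g x ^+ 2)%R) x)%E).
  exact: integrableZl.
by apply/funext => x /=; rewrite EFinM.
Qed.

Lemma innerC f g : inner f g = inner g f.
Proof. by apply: eq_Rintegral => x _; rewrite mulrC. Qed.

Lemma innerDl f g h : sqint f -> sqint g -> sqint h ->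
  inner (fun x => f x + g x) h = inner f h + inner g h.
Proof.
move=> sf sg sh; rewrite -RintegralD//; try exact: integrable_mulr_sqint.
by apply: eq_Rintegral => x _; rewrite mulrDl.
Qed.

Lemma innerZl a f h : sqint f -> sqint h ->
  inner (fun x => a * f x) h = a * inner f h.
Proof.
move=> sf sh; rewrite -RintegralZl//; last exact: integrable_mulr_sqint.
by apply: eq_Rintegral => x _; rewrite mulrA.
Qed.

Lemma innerNl f h : sqint f -> sqint h ->
  inner (fun x => - f x) h = - inner f h.
Proof.
move=> sf sh; rewrite -mulN1r -innerZl//.
by apply: eq_Rintegral => x _; rewrite mulN1r.
Qed.

Lemma innerBl f g h : sqint f -> sqint g -> sqint h ->
  inner (fun x => f x - g x) h = inner f h - inner g h.
Proof.
move=> sf sg sh; rewrite innerDl ?innerNl//; exact: sqintN.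
Qed.

Lemma innerBr f g h : sqint f -> sqint g -> sqint h ->
  inner h (fun x => f x - g x) = inner h f - inner h g.
Proof. by move=> sf sg sh; rewrite innerC innerBl// ![inner h _]innerC. Qed.

Lemma innerDr f g h : sqint f -> sqint g -> sqint h ->
  inner h (fun x => f x + g x) = inner h f + inner h g.
Proof. by move=> sf sg sh; rewrite innerC innerDl// ![inner h _]innerC. Qed.

Lemma innerZr a f h : sqint f -> sqint h ->
  inner h (fun x => a * f x) = a * inner h f.
Proof. by move=> sf sh; rewrite innerC innerZl// innerC. Qed.

Lemma inner_suml (I : Type) (r : seq I) (P : pred I) (F : I -> T -> R) h :
  (forall i, sqint (F i)) -> sqint h ->
  inner (fun x => \sum_(i <- r | P i) F i x) h = \sum_(i <- r | P i) inner (F i) h.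
Proof.
move=> sF sh; elim: r => [|i r IH].
  rewrite big_nil; under eq_Rintegral do rewrite big_nil mul0r.
  by rewrite Rintegral_cst ?mul0r.
rewrite big_cons -IH; under eq_Rintegral do rewrite big_cons.
by case: (P i) => //; rewrite innerDl//; exact: sqint_sum.
Qed.

Lemma inner_ge0 f : 0 <= inner f f.
Proof. by apply: Rintegral_ge0 => x _; rewrite -expr2 sqr_ge0. Qed.

Lemma ae_imply (P Q : T -> Prop) : (forall x, P x -> Q x) ->
  {ae mu, forall x, P x} -> {ae mu, forall x, Q x}.
Proof. by move=> PQ; apply: filterS. Qed.

Lemma ae_and (P Q : T -> Prop) :
  {ae mu, forall x, P x} -> {ae mu, forall x, Q x} -> {ae mu, forall x, P x /\ Q x}.
Proof. by move=> p q; exact: filterI. Qed.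

Lemma ae_eq_Rintegral f g : measurable_fun setT f -> measurable_fun setT g ->
  {ae mu, forall x, f x = g x} -> \int[mu]_x f x = \int[mu]_x g x.
Proof.
move=> mf mg fg; congr fine; apply: ae_eq_integral => //.
- exact/measurable_EFinP.
- exact/measurable_EFinP.
- by apply: filterS fg => x /= ->.
Qed.

Lemma Rintegral_sum (I : Type) (r : seq I) (F : I -> T -> R) :
  (forall i, mu.-integrable setT (EFin \o F i)) ->
  \int[mu]_x (\sum_(i <- r) F i x) = \sum_(i <- r) \int[mu]_x F i x.
Proof.
move=> iF; suff [] : mu.-integrable setT (EFin \o (fun x => \sum_(i <- r) F i x)) /\
  \int[mu]_x (\sum_(i <- r) F i x) = \sum_(i <- r) \int[mu]_x F i x by [].
elim: r => [|i r [IH1 IH2]].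
  under eq_fun do rewrite big_nil; rewrite big_nil Rintegral_cst// mul0r.
  by split => //; have := integrable0 mu setT.
under eq_fun do rewrite big_cons; rewrite big_cons -IH2 RintegralD//; split => //.
exact: (integrableD measurableT (iF i) IH1).
Qed.

End SquareIntegrable.

(** The quadratic polynomial in t is nonnegative at its minimum t = -b/c; if c
    = 0 it is affine, hence constant. *)
Lemma discriminant_le (R : realFieldType) (a b c : R) : 0 <= c ->
  (forall t, 0 <= a + 2 * t * b + t ^+ 2 * c) -> b ^+ 2 <= a * c.
Proof.
move=> c0 H; have [c1|c1] := eqVneq c 0.
  have [->|b0] := eqVneq b 0; first by rewrite c1 expr0n/= mulr0.
  have := H (- (a + 1) / (2 * b)).
  rewrite c1 mulr0 addr0 => h.
  have e : 2 * (- (a + 1) / (2 * b)) * b = - (a + 1) by field.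
  by lra.
have cp : 0 < c by rewrite lt_neqAle eq_sym c1.
have := H (- b / c); rewrite (_ : _ + _ = (a * c - b ^+ 2) / c); last by field.
by rewrite pmulr_lge0 ?invr_gt0// subr_ge0.
Qed.

(** The squared norm of f + t g is a nonnegative quadratic polynomial in t. *)
Lemma inner_CS d (T : measurableType d) (R : realType)
    (mu : {measure set T -> \bar R}) (f g : T -> R) :
  sqint mu f -> sqint mu g ->
  (\int[mu]_x (f x * g x)) ^+ 2 <= \int[mu]_x (f x * f x) * \int[mu]_x (g x * g x).
Proof.
move=> sf sg; apply: discriminant_le => [|t]; first exact: inner_ge0.
have := inner_ge0 mu (fun x => f x + t * g x).
have st := sqintZ t sg.
rewrite innerDl// ?innerDr// ?innerZl ?innerZr//; try exact: sqintD.
rewrite (innerC mu g f) => h; apply: le_trans h _; rewrite le_eqVlt; apply/orP.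
by left; apply/eqP; ring.
Qed.

(** * Real trigonometric polynomials *)

Section Hartley.
Context {R : realType}.
Implicit Types (k l : int) (t : R) (x : R * R) (f g : R * R -> R) (i : 'I_2).

(** The Hartley kernel. The products cas(k x) cas(l y) are a real orthogonal
    system in which, up to a factor, differentiation only flips the sign of a
    frequency; one family replaces the sines and cosines of both variables. *)
Definition cas k t : R := cos (k%:~R * t) + sin (k%:~R * t).

Lemma is_derive_cas k t : is_derive t 1 (cas k) (k%:~R * cas (- k) t).
Proof.
have h : is_derive t 1 (fun s : R => k%:~R * s) k%:~R.
  have := is_deriveZ (k%:~R : R) (is_derive_id t (1 : R)).
  by rewrite scaler1.
have hc := is_derive1_comp (is_derive_cos _) h.
have hs := is_derive1_comp (is_derive_sin _) h.
have := is_deriveD hc hs.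
rewrite /cas (_ : _ + _ = k%:~R * (cos ((- k)%:~R * t) + sin ((- k)%:~R * t))) //.
have -> : (- k)%:~R * t = - (k%:~R * t) by rewrite mulrNz mulNr.
by rewrite cosN sinN; ring.
Qed.

Lemma continuous_cas k : continuous (cas k).
Proof.
move=> t; apply/differentiable_continuous/derivable1_diffP.
by apply: ex_derive; exact: is_derive_cas.
Qed.

Lemma cas0 : cas 0 = fun=> 1.
Proof. by apply/funext => t; rewrite /cas mulr0z mul0r cos0 sin0 addr0. Qed.

(** A product of two kernels is a combination of kernels with constant
    coefficients, so that trigonometric polynomials form an algebra. *)
Lemma casM k l t : cas k t * cas l t =
  2^-1 * cas (k - l) t + 2^-1 * cas (l - k) t
  + 2^-1 * cas (k + l) t - 2^-1 * cas (- (k + l)) t.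
Proof.
rewrite /cas; set u := k%:~R * t; set v := l%:~R * t.
have -> : (k - l)%:~R * t = u - v by rewrite mulrzBr mulrBl.
have -> : (l - k)%:~R * t = - (u - v) by rewrite mulrzBr mulrBl opprB.
have -> : (- (k + l))%:~R * t = - (u + v) by rewrite mulrNz mulrzDr mulNr mulrDl.
have -> : (k + l)%:~R * t = u + v by rewrite mulrzDr mulrDl.
by rewrite cosN sinN cosN sinN !cosD !sinD cosN sinN; field.
Qed.

Lemma periodic_cas k : periodic (cas k) (2 * pi).
Proof.
have pn (n : nat) t : cas n (t + 2 * pi) = cas n t.
  rewrite /cas (_ : n%:~R * (t + 2 * pi) = n%:~R * t + (pi *+ 2) *+ n).
    by rewrite (periodicn (@sinD2pi R)) (periodicn (@cosD2pi R)).
  by rewrite mulrDr -pmulrn !mulr_natl.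
have cE (n : nat) t : cas (- n%:Z) t = cas n (- t).
  by rewrite /cas mulrNz mulrN mulNr.
move=> t; case: k => n; first exact: pn.
by rewrite NegzE !cE opprD -[LHS]pn subrK.
Qed.

Lemma cas_le2 k t : `|cas k t| <= 2.
Proof.
apply: (le_trans (ler_normD _ _)).
by have := cos_max (k%:~R * t); have := sin_max (k%:~R * t); lra.
Qed.

Definition hartley k l : R * R -> R := fun x => cas k x.1 * cas l x.2.

(** The linear span of the Hartley functions, as an inductive predicate: linear
    statements are proved by induction on it. *)
Inductive trigpoly : (R * R -> R) -> Prop :=
| trigpoly_hartley a k l : trigpoly (fun x => a * hartley k l x)
| trigpolyD f g : trigpoly f -> trigpoly g -> trigpoly (fun x => f x + g x).

Lemma trigpoly_cst (a : R) : trigpoly (fun=> a).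
Proof.
rewrite (_ : (fun=> a) = (fun x => a * hartley 0 0 x)).
  exact: trigpoly_hartley.
by apply/funext => x; rewrite /hartley cas0 !mulr1.
Qed.

Lemma trigpolyZ (a : R) f : trigpoly f -> trigpoly (fun x => a * f x).
Proof.
elim=> [b k l|g h _ IHg _ IHh].
  under eq_fun do rewrite mulrA; exact: trigpoly_hartley.
by under eq_fun do rewrite mulrDr; exact: trigpolyD.
Qed.

Lemma trigpolyN f : trigpoly f -> trigpoly (fun x => - f x).
Proof. by move=> /(trigpolyZ (-1)); under eq_fun do rewrite mulN1r. Qed.

Lemma trigpolyB f g : trigpoly f -> trigpoly g -> trigpoly (fun x => f x - g x).
Proof. by move=> tf tg; apply: trigpolyD => //; exact: trigpolyN. Qed.

Lemma trigpoly_sum (I : Type) (r : seq I) (F : I -> R * R -> R) :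
  (forall j, trigpoly (F j)) -> trigpoly (fun x => \sum_(j <- r) F j x).
Proof.
move=> tF; elim: r => [|j r IH].
  by under eq_fun do rewrite big_nil; exact: trigpoly_cst.
by under eq_fun do rewrite big_cons; exact: trigpolyD.
Qed.

Lemma trigpoly_mul_cas1 k f : trigpoly f -> trigpoly (fun x => cas k x.1 * f x).
Proof.
elim=> [a k' l|g h _ IHg _ IHh]; last first.
  by under eq_fun do rewrite mulrDr; exact: trigpolyD.
rewrite (_ : (fun _ => _) = (fun x => (2^-1 * a) * hartley (k - k') l x
   + (2^-1 * a) * hartley (k' - k) l x + (2^-1 * a) * hartley (k + k') l x
   - (2^-1 * a) * hartley (- (k + k')) l x)).
  apply: trigpolyB; last exact: trigpoly_hartley.
  by do 2![apply: trigpolyD; last exact: trigpoly_hartley]; exact: trigpoly_hartley.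
apply/funext => x; rewrite /hartley mulrCA mulrA -mulrA [cas k _ * _]mulrA casM.
by ring.
Qed.

Lemma trigpoly_mul_cas2 k f : trigpoly f -> trigpoly (fun x => cas k x.2 * f x).
Proof.
elim=> [a l k'|g h _ IHg _ IHh]; last first.
  by under eq_fun do rewrite mulrDr; exact: trigpolyD.
rewrite (_ : (fun _ => _) = (fun x => (2^-1 * a) * hartley l (k - k') x
   + (2^-1 * a) * hartley l (k' - k) x + (2^-1 * a) * hartley l (k + k') x
   - (2^-1 * a) * hartley l (- (k + k')) x)).
  apply: trigpolyB; last exact: trigpoly_hartley.
  by do 2![apply: trigpolyD; last exact: trigpoly_hartley]; exact: trigpoly_hartley.
apply/funext => x; rewrite /hartley.
have := casM k k' x.2; set u := cas k x.2; set v := cas k' x.2 => e.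
by transitivity (a * cas l x.1 * (u * v)); [ring|rewrite e; ring].
Qed.

Lemma trigpolyM f g : trigpoly f -> trigpoly g -> trigpoly (fun x => f x * g x).
Proof.
move=> + tg; elim=> [a k l|f1 f2 _ IH1 _ IH2].
  rewrite (_ : (fun _ => _) = (fun x => cas k x.1 * (cas l x.2 * (a * g x)))).
    by apply: trigpoly_mul_cas1; apply: trigpoly_mul_cas2; exact: trigpolyZ.
  by apply/funext => x; rewrite /hartley; ring.
by under eq_fun do rewrite mulrDl; exact: trigpolyD.
Qed.

Lemma trigpolyX n f : trigpoly f -> trigpoly (fun x => f x ^+ n).
Proof.
move=> tf; elim: n => [|n IH]; first by under eq_fun do rewrite expr0; exact: trigpoly_cst.
by under eq_fun do rewrite exprS; exact: trigpolyM.
Qed.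

Lemma trigpoly_periodic f : trigpoly f -> torus_fun T2 f.
Proof.
elim=> [a k l|g h _ [g1 g2] _ [h1 h2]].
  by split=> -[x1 x2]; rewrite /hartley /= ?addr0 periodic_cas.
by split=> x; rewrite ?g1 ?g2 ?h1 ?h2.
Qed.

Lemma trigpoly_bounded f : trigpoly f -> exists M : R, forall x, `|f x| <= M.
Proof.
elim=> [a k l|g h _ [M gM] _ [N hN]].
  exists (`|a| * (2 * 2)) => x; rewrite !normrM ler_wpM2l//.
  by rewrite ler_pM// cas_le2.
by exists (M + N) => x; apply: (le_trans (ler_normD _ _)); rewrite lerD.
Qed.

Lemma trigpoly_continuous f : trigpoly f -> continuous f.
Proof.
move=> + x; elim=> [a k l|g h _ IHg _ IHh]; last exact: cvgD.
apply: cvgM; first exact: cvg_cst.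
apply: cvgM.
- by apply: (@continuous_comp _ _ _ fst (cas k) x); [exact: cvg_fst|exact: continuous_cas].
- by apply: (@continuous_comp _ _ _ snd (cas l) x); [exact: cvg_snd|exact: continuous_cas].
Qed.

Lemma trigpoly_measurable f : trigpoly f ->
  measurable_fun [set: measurableTypeR R * measurableTypeR R] f.
Proof.
elim=> [a k l|g h _ IHg _ IHh]; last exact: measurable_funD.
apply: measurable_funM => //; apply: measurable_funM.
- apply: measurableT_comp => //.
  by apply: continuous_measurable_fun; exact: continuous_cas.
- apply: measurableT_comp => //.
  by apply: continuous_measurable_fun; exact: continuous_cas.
Qed.

Definition freq i k l : int := if i == 0 then k else l.
(** The partial derivative of hartley k l in direction i is freq i k l times
    the Hartley function with frequencies flip i k l. *)
Definition flip i (k l : int) : int * int := if i == 0 then (- k, l) else (k, - l).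

Lemma is_derive_hartley i k l x :
  is_derive x (e_ i) (hartley k l)
    ((freq i k l)%:~R * hartley (flip i k l).1 (flip i k l).2 x).
Proof.
have h1 := is_derive_cas k x.1.
have h2 := is_derive_cas l x.2.
rewrite /freq /flip /e_; case: ifP => _ /=.
- have e : (fun h : R => h^-1 *: ((hartley k l \o shift x) (h *: ((1, 0) : R * R)) - hartley k l x)) =
      (fun h : R => (h^-1 *: ((cas k \o shift x.1) (h *: (1 : R)) - cas k x.1)) * cas l x.2).
    apply/funext => h; rewrite /hartley /= scaler0 add0r -!scalerAl.
    by rewrite /GRing.scale /= mulrBl.
  have c : (fun h : R => h^-1 *: ((hartley k l \o shift x) (h *: ((1, 0) : R * R)) - hartley k l x)) @ 0^' --> k%:~R * hartley (- k) l x.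
    rewrite e /hartley mulrA; apply: cvgM; last exact: cvg_cst.
    have := @ex_derive _ _ _ _ _ _ _ h1.
    by rewrite /derivable => /cvgP; have := @derive_val _ _ _ _ _ _ _ h1; rewrite /derive => <- /cvg_ex [? /[dup] /cvg_lim ->].
  by split; [apply: cvgP c|rewrite /derive; apply: cvg_lim c].
- have e : (fun h : R => h^-1 *: ((hartley k l \o shift x) (h *: ((0, 1) : R * R)) - hartley k l x)) =
      (fun h : R => cas k x.1 * (h^-1 *: ((cas l \o shift x.2) (h *: (1 : R)) - cas l x.2))).
    apply/funext => h; rewrite /hartley /= scaler0 add0r.
    by rewrite /GRing.scale /= -mulrBr mulrCA.
  have c : (fun h : R => h^-1 *: ((hartley k l \o shift x) (h *: ((0, 1) : R * R)) - hartley k l x)) @ 0^' --> l%:~R * hartley k (- l) x.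
    rewrite e /hartley mulrCA; apply: cvgM; first exact: cvg_cst.
    have := @ex_derive _ _ _ _ _ _ _ h2.
    by rewrite /derivable => /cvgP; have := @derive_val _ _ _ _ _ _ _ h2; rewrite /derive => <- /cvg_ex [? /[dup] /cvg_lim ->].
  by split; [apply: cvgP c|rewrite /derive; apply: cvg_lim c].
Qed.

Lemma partial_hartley i k l : partial i (hartley k l) =
  fun x => (freq i k l)%:~R * hartley (flip i k l).1 (flip i k l).2 x.
Proof.
by apply/funext => x; rewrite /partial (@derive_val _ _ _ _ _ _ _ (is_derive_hartley i k l x)).
Qed.

Lemma trigpoly_derivable i f x : trigpoly f -> derivable f x (e_ i).
Proof.
elim=> [a k l|g h _ IHg _ IHh]; last exact: derivableD.
by apply: derivableZ; apply: ex_derive; exact: is_derive_hartley.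
Qed.

Lemma partialZ_hartley i a k l : partial i (fun x => a * hartley k l x) =
  fun x => (a * (freq i k l)%:~R) * hartley (flip i k l).1 (flip i k l).2 x.
Proof.
apply/funext => x; rewrite /partial.
have h := is_derive_hartley i k l x.
have := @derive_val _ _ _ _ _ _ _ (is_deriveZ a h); rewrite /GRing.scale /= => ->.
by rewrite mulrA.
Qed.

Lemma partialD i f g : trigpoly f -> trigpoly g ->
  partial i (fun x => f x + g x) = fun x => partial i f x + partial i g x.
Proof.
move=> tf tg; apply/funext => x; rewrite /partial.
by rewrite deriveD//; exact: trigpoly_derivable.
Qed.

Lemma trigpoly_partial i f : trigpoly f -> trigpoly (partial i f).
Proof.
elim=> [a k l|g h tg IHg th IHh].
  by rewrite partialZ_hartley; exact: trigpoly_hartley.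
by rewrite partialD//; exact: trigpolyD.
Qed.

Lemma trigpoly_smooth f : trigpoly f -> smooth f.
Proof.
move=> tf s i; have ts : trigpoly (foldr partial f s).
  by elim: s => //= j s; exact: trigpoly_partial.
by split=> [|x]; [exact: trigpoly_continuous|exact: trigpoly_derivable].
Qed.

Lemma partialM i f g : trigpoly f -> trigpoly g ->
  partial i (fun x => f x * g x) = fun x => f x * partial i g x + g x * partial i f x.
Proof.
move=> tf tg; apply/funext => x; rewrite /partial.
by rewrite deriveM//; exact: trigpoly_derivable.
Qed.

End Hartley.

(** The torus measure is a restriction of the measure of the plane; this passes
    from it to integrals over the cell. *)
(** * Integration over the torus *)

Lemma integral_mrestr d (T : measurableType d) (R : realType)
    (m : {measure set T -> \bar R}) (D : set T) (mD : measurable D)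
    (f : T -> \bar R) : measurable_fun setT f ->
  (\int[mrestr m mD]_x f x = \int[m]_(x in D) f x)%E.
Proof.
move=> mf; rewrite -(@eq_measure_integral _ _ _ D m (mrestr m mD) f); last first.
  by move=> A mA AD; rewrite /= /mrestr setIidl.
rewrite [RHS]integral_mkcond; apply: ae_eq_integral => //.
  by apply/(measurable_restrictT _ mD); exact: measurable_funS mf.
exists (~` D); split; first exact: measurableC.
  by rewrite /= /mrestr setICl measure0.
move=> x /= h Dx; apply: h => _.
by rewrite patchE mem_set.
Qed.

Section TorusIntegral.
Context {R : realType}.
Notation mu := (torus_measure (@T2 R)).
Implicit Types (k l : int) (f g : R * R -> R) (i : 'I_2).

Lemma two_pi_gt0 : 0 < 2 * pi :> R.
Proof. by rewrite mulr_gt0// pi_gt0. Qed.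

Lemma lebesgue_cell :
  ((lebesgue_measure \x lebesgue_measure) (cell (@T2 R)) = ((2 * pi) * (2 * pi))%:E)%E.
Proof.
rewrite /cell product_measure1E//=.
by rewrite !lebesgue_measure_itv/= lte_fin two_pi_gt0 sube0 EFinM.
Qed.

Lemma torus_measureT : mu setT = ((2 * pi) * (2 * pi))%:E.
Proof. by rewrite /= /torus_measure /= /mrestr setTI -lebesgue_cell. Qed.

Lemma torus_measure_lty : (mu setT < +oo)%E.
Proof. by rewrite torus_measureT ltry. Qed.

Lemma bounded_integrable f (M : R) :
  measurable_fun [set: measurableTypeR R * measurableTypeR R] f ->
  (forall x, `|f x| <= M) -> mu.-integrable setT (EFin \o f).
Proof.
move=> mf fM; apply: measurable_bounded_integrable => //.
  exact: torus_measure_lty.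
by exists M; split; [exact: num_real|move=> y My x _ /=; exact: le_trans (fM x) (ltW My)].
Qed.

Lemma sqint_bounded f (M : R) :
  measurable_fun [set: measurableTypeR R * measurableTypeR R] f ->
  (forall x, `|f x| <= M) -> sqint mu f.
Proof.
move=> mf fM; split => //; apply: (@bounded_integrable _ (M ^+ 2)).
  exact: measurable_funX.
by move=> x; rewrite normrX lerXn2r// ?nnegrE// (le_trans _ (fM x)).
Qed.

(** Fubini on the cell; boundedness provides the integrability. *)
Lemma Rintegral_torus_prod (g h : R -> R) (M N : R) :
  measurable_fun setT g -> measurable_fun setT h ->
  (forall t, `|g t| <= M) -> (forall t, `|h t| <= N) ->
  \int[mu]_x (g x.1 * h x.2) =
  (\int[lebesgue_measure]_(t in `[0%R, (2 * pi)%R[) g t) *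
  (\int[lebesgue_measure]_(t in `[0%R, (2 * pi)%R[) h t).
Proof.
move=> mg mh gM hN.
have intI (q : R -> R) (Q : R) : measurable_fun setT q -> (forall t, `|q t| <= Q) ->
    lebesgue_measure.-integrable `[0, 2 * pi[ (EFin \o q).
  move=> mq qQ; apply: measurable_bounded_integrable => //.
  - by rewrite /= lebesgue_measure_itv/= lte_fin two_pi_gt0 sube0 ltry.
  - exact: measurable_funS mq.
  - by exists Q; split; [exact: num_real|move=> y Qy x _ /=; exact: le_trans (qQ x) (ltW Qy)].
have mF : measurable_fun [set: measurableTypeR R * measurableTypeR R] (fun x : R * R => g x.1 * h x.2).
  by apply: measurable_funM; apply: measurableT_comp.
have ig := intI _ _ mg gM; have ih := intI _ _ mh hN.
rewrite /Rintegral integral_mrestr; last exact/measurable_EFinP.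
have iF : ((lebesgue_measure \x lebesgue_measure)%E).-integrable
    [set: measurableTypeR R * measurableTypeR R]
    ((fun x : R * R => (g x.1 * h x.2)%:E) \_ (cell (@T2 R))).
  rewrite -integrable_mkcond; last exact: measurable_cell.
  apply: (@measurable_bounded_integrable _ _ _ _ (fun x : measurableTypeR R * measurableTypeR R => g x.1 * h x.2)).
  - exact: measurable_cell.
  - by rewrite -[X in (X < _)%E]/((lebesgue_measure \x lebesgue_measure)%E (cell (@T2 R))) lebesgue_cell ltry.
  - exact: measurable_funS mF.
  - exists (M * N); split; [exact: num_real|move=> y Qy x _ /=].
    apply: le_trans (ltW Qy); rewrite normrM ler_pM//.
rewrite integral_mkcond -integral12_prod_meas1//.
have mI : measurable (`[0, 2 * pi[%classic : set (measurableTypeR R)).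
  exact: measurable_itv.
have fin1 := integrable_fin_num mI ig.
have fin2 := integrable_fin_num mI ih.
rewrite -fineM//; congr fine.
rewrite -(fineK fin2) [X in (_ = X * _)%E]integral_mkcond -integralZr//; last first.
  by rewrite -integrable_mkcond.
apply: eq_integral => s _; rewrite fineK// integral_mkcond /fubini_F.
transitivity (\int[lebesgue_measure]_y ((((g \_ `[0, 2 * pi[) s)%R)%:E * (((EFin \o h) \_ `[0%R, (2 * pi)%R[) y)))%E.
  apply: eq_integral => y _; rewrite !patchE.
  rewrite in_setX; case: (s \in _) => /=; last by rewrite mul0e.
  by case: (y \in _) => /=; rewrite ?mule0// EFinM.
rewrite integralZl//; last by rewrite -integrable_mkcond.
by rewrite !patchE; case: ifP.
Qed.

(** For k <> 0 the kernel has the periodic primitive - cas(- k) / k. *)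
Lemma Rintegral_cas k :
  \int[lebesgue_measure]_(t in `[0%R, (2 * pi)%R[) @cas R k t = (k == 0)%:R * (2 * pi).
Proof.
have mI : measurable (`[0, 2 * pi[%classic : set (measurableTypeR R)).
  exact: measurable_itv.
have [->|k0] := eqVneq k 0.
  rewrite cas0 Rintegral_cst// mul1r /= lebesgue_measure_itv/= lte_fin two_pi_gt0 sube0.
  by rewrite mul1r.
have mcas l : measurable_fun setT (@cas R l).
  by apply: continuous_measurable_fun; exact: continuous_cas.
have kR : (k%:~R : R) != 0 by rewrite intr_eq0.
rewrite mul0r /Rintegral integral_itv_bndo_bndc; last first.
  by apply/measurable_EFinP; exact: measurable_funS (mcas k).
pose F t : R := - (k%:~R)^-1 * cas (- k) t.
have dF (t : R) : is_derive t (1 : R) F (cas k t).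
  have := is_deriveZ (- (k%:~R : R)^-1) (is_derive_cas (- k) t).
  suff -> : - (k%:~R : R)^-1 *: ((- k)%:~R * cas (- - k) t) = cas k t by [].
  by rewrite opprK mulrNz /GRing.scale /=; field.
have cF : continuous F.
  move=> t; apply/differentiable_continuous/derivable1_diffP.
  by apply: ex_derive; exact: dF.
rewrite (@continuous_FTC2 _ (cas k) F).
- by rewrite -EFinB /F -[2 * pi]add0r periodic_cas subrr.
- exact: two_pi_gt0.
- by apply: continuous_subspaceT; exact: continuous_cas.
- split.
  + by move=> t _; apply: ex_derive; exact: dF.
  + by apply: cvg_at_right_filter; exact: cF.
  + by apply: cvg_at_left_filter; exact: cF.
- by move=> t _; rewrite derive1E (@derive_val _ _ _ _ _ _ _ (dF t)).
Qed.

Lemma Rintegral_casM k l :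
  \int[lebesgue_measure]_(t in `[0%R, (2 * pi)%R[) (@cas R k t * cas l t) =
  (k == l)%:R * (2 * pi).
Proof.
have mI : measurable (`[0, 2 * pi[%classic : set (measurableTypeR R)).
  exact: measurable_itv.
have ic j : lebesgue_measure.-integrable `[0, 2 * pi[ (EFin \o @cas R j).
  apply: (@integrableS _ _ _ lebesgue_measure `[0, 2 * pi]) => //.
    by move=> t /=; rewrite !in_itv /= => /andP[-> /ltW].
  apply: continuous_compact_integrable; first exact: segment_compact.
  by apply: continuous_subspaceT; exact: continuous_cas.
have i1 j : lebesgue_measure.-integrable `[0, 2 * pi[ (EFin \o (fun t => 2^-1 * @cas R j t)).
  exact: (integrableZl mI 2^-1 (ic j)).
have i2 := integrableD mI (i1 (k - l)) (i1 (l - k)).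
have i3 := integrableD mI i2 (i1 (k + l)).
under eq_Rintegral do rewrite casM.
rewrite RintegralB// RintegralD// RintegralD// !RintegralZl// !Rintegral_cas.
rewrite oppr_eq0 !subr_eq0 (eq_sym l k).
by case: (k == l); case: (k + l == 0) => /=; field.
Qed.

Lemma sqint_trigpoly f : trigpoly f -> sqint mu f.
Proof.
move=> tf; have [M fM] := trigpoly_bounded tf.
by apply: sqint_bounded fM; exact: trigpoly_measurable.
Qed.

End TorusIntegral.

Lemma Rintegral_dominated_cvg d (T : measurableType d) (R : realType)
    (mu : {measure set T -> \bar R}) (f_ : nat -> T -> R) (f g : T -> R) :
  (forall n, measurable_fun setT (f_ n)) -> measurable_fun setT f ->
  {ae mu, forall x, f_ n x @[n --> \oo] --> f x} ->
  mu.-integrable setT (EFin \o g) -> (forall n x, `|f_ n x| <= g x) ->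
  \int[mu]_x f_ n x @[n --> \oo] --> \int[mu]_x f x.
Proof.
move=> mf_ mf cv ig fg.
have [] := @dominated_convergence _ _ _ mu setT measurableT
  (fun n => EFin \o f_ n) (EFin \o f) (EFin \o g).
- by move=> n; exact/measurable_EFinP.
- exact/measurable_EFinP.
- by apply: filterS cv => x h _; apply: cvg_EFin => //; apply: nearW.
- exact: ig.
- by apply: nearW => x n _ /=; rewrite lee_fin.
move=> fi _ h; apply: fine_cvg; rewrite fineK//.
exact: integrable_fin_num fi.
Qed.

(** * Polynomial approximation of a threshold *)

Section Threshold.
Context {R : realType}.
Implicit Types (x y s : R).

Lemma bernoulli_le1 y n : 0 <= y <= 1 -> 1 - y *+ n <= (1 - y) ^+ n.
Proof.
move=> /andP[y0 y1]; elim: n => [|n IH]; first by rewrite mulr0n subr0 expr0.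
rewrite exprS mulrS; have a0 : 0 <= 1 - y by rewrite subr_ge0.
have yn : 0 <= y * y *+ n by rewrite mulrn_wge0// mulr_ge0.
have := ler_wpM2l a0 IH; apply: le_trans.
rewrite mulrBl !mul1r mulrBr mulr1 mulrnAr; lra.
Qed.

Lemma bernoulli_ge1 y n : 0 <= y -> 1 + y *+ n <= (1 + y) ^+ n.
Proof.
move=> y0; elim: n => [|n IH]; first by rewrite mulr0n addr0 expr0.
rewrite exprS mulrS; have a0 : 0 <= 1 + y by rewrite addr_ge0.
have yn : 0 <= y * y *+ n by rewrite mulrn_wge0// mulr_ge0.
have := ler_wpM2l a0 IH; apply: le_trans.
rewrite mulrDl !mul1r mulrDr mulr1 mulrnAr; lra.
Qed.

(** On [0, 1], these polynomials in x tend to 1 for x < 1/2 and to 0 for x >=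
    1/2. With N = n 2^n, Bernoulli's inequality gives (1 - x^n)^N >= 1 - n (2
    x)^n on the one hand, and (1 - x^n)^N <= (1 + x^n)^(-N) <= 1 / (1 + n (2
    x)^n) on the other. *)
Definition threshold n x : R := (1 - x ^+ n) ^+ (n * 2 ^ n).

Lemma threshold_ge0_le1 n x : 0 <= x <= 1 -> 0 <= threshold n x <= 1.
Proof.
move=> /andP[x0 x1]; have h : 0 <= 1 - x ^+ n <= 1.
  by rewrite subr_ge0 exprn_ile1//= gerBl exprn_ge0.
have /andP[h0 h1] := h.
by rewrite exprn_ge0// exprn_ile1.
Qed.

Lemma cvg_natmul_expr s : 0 <= s < 1 -> s ^+ n *+ n @[n --> \oo] --> (0 : R).
Proof.
move=> /andP[]; rewrite le_eqVlt => /predU1P[<- _|s0 s1].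
  rewrite (_ : (fun n : nat => _) = cst 0); first exact: cvg_cst.
  by apply/funext => -[|n]/=; rewrite ?mulr0n// expr0n mul0rn.
(* Write s = t^2; then n s^n = (n t^n) t^n, and n t^n is bounded by Bernoulli's
   inequality for 1/t = 1 + a. *)
have t0 : 0 < Num.sqrt s by rewrite sqrtr_gt0.
have t1 : Num.sqrt s < 1 by rewrite -sqrtr1 ltr_sqrt.
set t := Num.sqrt s in t0 t1; pose a := t^-1 - 1.
have a0 : 0 < a by rewrite subr_gt0 invf_gt1.
apply: (@squeeze_cvgr _ _ _ _ (cst 0) (fun n => a^-1 * t ^+ n)); last 2 first.
- exact: cvg_cst.
- rewrite -[X in _ --> X](mulr0 a^-1); apply: cvgM; first exact: cvg_cst.
  by apply: cvg_expr; rewrite ger0_norm// ltW.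
apply: nearW => n; apply/andP; split; first by rewrite mulrn_wge0// exprn_ge0// ltW.
rewrite -[s](sqr_sqrtr (ltW s0)) -/t -exprM mulnC exprM expr2 -mulrnAl.
apply: ler_wpM2r; first by rewrite exprn_ge0// ltW.
have e : 1 + a = t^-1 by rewrite /a addrC subrK.
have := bernoulli_ge1 n (ltW a0); rewrite e exprVn => h.
have {}h : a *+ n <= (t ^+ n)^-1 by lra.
rewrite -[leRHS]mul1r ler_pdivlMr// mulrnAl -mulrnAr mulrC -ler_pdivlMr//; last exact: exprn_gt0.
by rewrite mul1r.
Qed.

Lemma threshold_cvg1 x : 0 <= x < 2^-1 -> threshold n x @[n --> \oo] --> (1 : R).
Proof.
move=> /andP[x0 x1].
apply: (@squeeze_cvgr _ _ _ _ (fun n => 1 - (2 * x) ^+ n *+ n) (cst 1)); last 2 first.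
- rewrite -[X in _ --> X]subr0; apply: cvgB; first exact: cvg_cst.
  by apply: cvg_natmul_expr; apply/andP; split; lra.
- exact: cvg_cst.
apply: nearW => n; have xn : 0 <= x ^+ n <= 1.
  by rewrite exprn_ge0// exprn_ile1//; lra.
have x01 : 0 <= x <= 1 by apply/andP; split; lra.
have /andP[_ ->] := threshold_ge0_le1 n x01; rewrite andbT.
apply: le_trans (bernoulli_le1 _ xn).
by rewrite lerB// exprMn mulnC mulrnA -natrX mulr_natl.
Qed.

Lemma threshold_cvg0 x : 2^-1 <= x <= 1 -> threshold n x @[n --> \oo] --> (0 : R).
Proof.
move=> /andP[x0 x1].
apply: (@squeeze_cvgr _ _ _ _ (cst 0) (fun n => (n.+1%:R)^-1)); last 2 first.
- exact: cvg_cst.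
- exact: cvg_harmonic.
apply: nearW => n; have x01 : 0 <= x <= 1 by apply/andP; split; lra.
have /andP[-> _] := threshold_ge0_le1 n x01; rewrite andTb.
have xn0 : 0 <= x ^+ n by rewrite exprn_ge0//; lra.
have xn1 : x ^+ n <= 1 by rewrite exprn_ile1//; lra.
set N := (n * 2 ^ n)%N.
have h1 : (1 - x ^+ n) ^+ N * (1 + x ^+ n) ^+ N <= 1.
  by rewrite -exprMn exprn_ile1//; nra.
have h2 : n.+1%:R <= (1 + x ^+ n) ^+ N.
  apply: le_trans (bernoulli_ge1 N xn0).
  rewrite -natr1 addrC lerD2l /N mulnC mulrnA; apply: ler_wMn2r.
  have h : 2^-1 ^+ n <= x ^+ n by apply: lerXn2r; rewrite ?nnegrE; lra.
  move: h; rewrite exprVn => h; rewrite -[_ *+ (2 ^ n)]mulr_natr natrX.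
  by rewrite -ler_pdivrMr ?exprn_gt0// mul1r.
have h3 : 0 <= (1 - x ^+ n) ^+ N by rewrite exprn_ge0// subr_ge0.
rewrite /threshold -/N -[leRHS]mul1r ler_pdivlMr//.
apply: le_trans h1; exact: ler_wpM2l.
Qed.

End Threshold.

(** * Measurable sets generated by trigonometric limits *)

Section Density.
Context {R : realType}.
Notation plane := (measurableTypeR R * measurableTypeR R)%type.
Notation mu := (torus_measure (@T2 R)).
Implicit Types (U V : set plane) (f g w p : R * R -> R).

Definition open_cell : set plane := [set x | 0 < x.1 < 2 * pi /\ 0 < x.2 < 2 * pi].

(** The cell and its interior differ by parts of two lines. *)
Lemma ae_open_cell : {ae mu, forall x, open_cell x}.
Proof.
have m0 : measurable ([set 0] : set (measurableTypeR R)) by exact: measurable_set1.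
exists ((~` (cell (@T2 R))) `|` (([set 0] `*` setT) `|` (setT `*` [set 0]))).
have mA : measurable (([set 0] `*` setT) `|` (setT `*` [set 0]) : set plane).
  by apply: measurableU; exact: measurableX.
split.
- by apply: measurableU => //; apply: measurableC; exact: measurable_cell.
- rewrite /= /torus_measure /= /mrestr setIUl setICl set0U.
  apply/eqP; rewrite -measure_le0.
  apply: (@le_trans _ _ ((lebesgue_measure \x lebesgue_measure)%E
      (([set 0] `*` setT) `|` (setT `*` [set 0]) : set plane))).
    apply: le_measure; [|by rewrite inE|exact: subIsetl].
    by rewrite inE; apply: measurableI => //; exact: measurable_cell.
  apply: (le_trans (measureU2 _ _ _)); [exact: measurableX|exact: measurableX|].
  have e1 : ((lebesgue_measure \x lebesgue_measure) ([set 0%R] `*` setT : set plane) = 0)%E.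
    by rewrite product_measure1E//= lebesgue_measure_set1 mul0e.
  have e2 : ((lebesgue_measure \x lebesgue_measure) (setT `*` [set 0%R] : set plane) = 0)%E.
    by rewrite product_measure1E//= lebesgue_measure_set1 mule0.
  by rewrite -[leLHS]/((lebesgue_measure \x lebesgue_measure) ([set 0%R] `*` setT : set plane)
    + (lebesgue_measure \x lebesgue_measure) (setT `*` [set 0%R] : set plane))%E e1 e2 adde0.
- move=> [x1 x2] /= nO.
  have [[]|nc] := pselect (cell (@T2 R) (x1, x2)); last by left.
  rewrite /= !in_itv/= => /andP[x10 x1p] /andP[x20 x2p]; right.
  move: x10 x20; rewrite !le_eqVlt => /predU1P[<- _|x10]; first by left.
  move=> /predU1P[<-|x20]; first by right.
  by exfalso; apply: nO; rewrite /open_cell /= x10 x20 x1p x2p.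
Qed.

(** These sets form a pi-system, since trigonometric polynomials with values in
    [0, 1] are stable under products. Convergence is only required inside the
    open cell, because periodicity can rule it out at the left ends of the
    cell. *)
Definition trig_limit U := measurable U /\
  exists p_ : nat -> R * R -> R, [/\ forall n, trigpoly (p_ n),
    forall n x, 0 <= p_ n x <= 1 &
    forall x, open_cell x -> p_ n x @[n --> \oo] --> (\1_U x : R)].

Lemma trig_limitI : setI_closed trig_limit.
Proof.
move=> U V [mU [p [tp p01 cp]]] [mV [q [tq q01 cq]]]; split.
  exact: measurableI.
exists (fun n x => p n x * q n x); split.
- by move=> n; exact: trigpolyM.
- move=> n x; have /andP[p0 p1] := p01 n x; have /andP[q0 q1] := q01 n x.
  by rewrite mulr_ge0// mulr_ile1.
- by move=> x Ox; rewrite indicI; apply: cvgM; [exact: cp|exact: cq].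
Qed.

Lemma trigpoly_threshold n f : trigpoly f -> trigpoly (fun x => threshold n (f x)).
Proof.
move=> tf; apply: trigpolyX; apply: trigpolyB; first exact: trigpoly_cst.
exact: trigpolyX.
Qed.

Lemma cosB_cos (s t : R) : cos t - cos s = 2 * (sin ((s + t) / 2) * sin ((s - t) / 2)).
Proof.
have -> : cos t = cos ((s + t) / 2 - (s - t) / 2) by congr cos; lra.
have -> : cos s = cos ((s + t) / 2 + (s - t) / 2) by congr cos; lra.
rewrite cosB cosD; ring.
Qed.

(** For t in ]0, 2 pi[, arc a t < 1/2 holds exactly when a < t: the cosine is
    centred at the midpoint (a + 2 pi) / 2 of ]a, 2 pi[ and compared with its
    common value at the two ends. The factor 1/4 keeps arc in [0, 1]. *)
Let arc (a t : R) : R :=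
  2^-1 - (cos (t - (a + 2 * pi) / 2) - cos (pi - a / 2)) / 4.

Let arc_ge0_le1 a t : 0 <= arc a t <= 1.
Proof.
rewrite /arc; have := cos_max (t - (a + 2 * pi) / 2); have := cos_max (pi - a / 2).
by rewrite !ler_norml => /andP[? ?] /andP[? ?]; apply/andP; split; lra.
Qed.

Let arc_lt a t : 0 <= a -> a < t < 2 * pi -> arc a t < 2^-1.
Proof.
move=> a0 /andP[at_ t2]; rewrite /arc cosB_cos.
suff : 0 < sin ((pi - a / 2 + (t - (a + 2 * pi) / 2)) / 2) *
  sin ((pi - a / 2 - (t - (a + 2 * pi) / 2)) / 2) by lra.
by rewrite mulr_gt0// sin_gt0_pi//; apply/andP; split; lra.
Qed.

Let arc_ge a t : t <= a -> 0 < t -> a < 2 * pi -> 2^-1 <= arc a t.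
Proof.
move=> ta t0 a2; rewrite /arc cosB_cos.
suff : 0 <= sin (- ((pi - a / 2 + (t - (a + 2 * pi) / 2)) / 2)) *
  sin ((pi - a / 2 - (t - (a + 2 * pi) / 2)) / 2) by rewrite sinN; lra.
by rewrite mulr_ge0// sin_ge0_pi//; apply/andP; split; lra.
Qed.

Let arcE a t : arc a t = 2^-1 - (2^-1 * (cas 1 t + cas (-1) t) * cos ((a + 2 * pi) / 2)
   + 2^-1 * (cas 1 t - cas (-1) t) * sin ((a + 2 * pi) / 2) - cos (pi - a / 2)) / 4.
Proof.
rewrite /arc cosB /cas mulrN1z mul1r mulN1r cosN sinN; set c := cos t; set s := sin t.
by field.
Qed.

(** Composing arc with threshold turns the trigonometric inequality that cuts
    out the ray into a limit of trigonometric polynomials. Outside 0 <= a < 2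
    pi the ray is trivial inside the open cell. *)
Let trig_limit_ray (pr : R * R -> R) (a : R) :
  measurable_fun [set: plane] pr ->
  (forall k, trigpoly (fun x => cas k (pr x))) ->
  (forall x, open_cell x -> 0 < pr x < 2 * pi) ->
  trig_limit [set x | a < pr x].
Proof.
move=> mpr tpr prO; split.
  rewrite (_ : [set _ | _] = setT `&` pr @^-1` `]a, +oo[%classic); last first.
    by rewrite setTI; apply/seteqP; split => x /=; rewrite in_itv/= andbT.
  exact: (mpr measurableT).
have [a0|a0] := ltP a 0.
  exists (fun _ => cst 1); split.
  - by move=> n; exact: trigpoly_cst.
  - by move=> n x; rewrite ler01 lexx.
  - move=> x /prO /andP[x0 _]; rewrite indicE mem_set; first exact: cvg_cst.
    exact: lt_trans x0.
have [a1|a1] := leP (2 * pi) a.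
  exists (fun _ => cst 0); split.
  - by move=> n; exact: trigpoly_cst.
  - by move=> n x; rewrite ler01 lexx.
  - move=> x /prO /andP[_ x0]; rewrite indicE memNset; first exact: cvg_cst.
    by rewrite /= => /lt_trans => /(_ _ x0); lra.
exists (fun n x => threshold n (arc a (pr x))); split.
- move=> n; apply: trigpoly_threshold.
  under eq_fun do rewrite arcE.
  apply: trigpolyB; first exact: trigpoly_cst.
  under eq_fun do rewrite mulrC.
  apply: trigpolyZ; apply: trigpolyB; last exact: trigpoly_cst.
  apply: trigpolyD; under eq_fun do rewrite mulrC; do 2!apply: trigpolyZ.
    exact: trigpolyD.
  exact: trigpolyB.
- by move=> n x; exact: threshold_ge0_le1.
- move=> x /prO /andP[x0 x2]; rewrite indicE.
  have [ax|xa] := ltP a (pr x).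
    rewrite mem_set//; apply: threshold_cvg1.
    by have /andP[-> _] := arc_ge0_le1 a (pr x); rewrite arc_lt// ax x2.
  rewrite memNset/=; last by rewrite ltNge xa.
  apply: threshold_cvg0.
  by have /andP[_ ->] := arc_ge0_le1 a (pr x); rewrite arc_ge.
Qed.

(** Rays in the two coordinates generate the product sigma-algebra. *)
Lemma measurable_trig_limit : @measurable _ plane `<=` <<s trig_limit >>.
Proof.
have sG : sigma_algebra setT <<s trig_limit >> by exact: smallest_sigma_algebra.
have H (pr : plane -> R) : (forall a, trig_limit [set x | a < pr x]) ->
    forall A : set (measurableTypeR R), measurable A -> <<s trig_limit >> (pr @^-1` A).
  move=> Hpr A mA.
  have : image_set_system setT pr <<s trig_limit >> A.
    have : (RGenOInfty.G (R:=R)).-sigma.-measurable A by rewrite -RGenOInfty.measurableE.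
    apply: smallest_sub; first exact: sigma_algebra_image.
    move=> _ [a ->]; rewrite /image_set_system /= setTI.
    apply: sub_sigma_algebra; rewrite (_ : _ @^-1` _ = [set x | a < pr x])//.
    by apply/seteqP; split => x /=; rewrite in_itv/= andbT.
  by rewrite /image_set_system /= setTI.
rewrite [X in X `<=` _]measurable_prod_measurableType.
apply: smallest_sub => // _ [A mA [B mB] <-].
have -> : A `*` B = (fst @^-1` A) `&` (snd @^-1` B) by [].
have [s0 sC sU] := sG.
have sCC (X : set plane) : <<s trig_limit >> X -> <<s trig_limit >> (~` X).
  by move=> /sC; rewrite setTD.
rewrite -[X in <<s _ >> X]setCK setCI; apply: (sCC _).
rewrite -bigcup2E; apply: sU => -[|[|n]] /=; last exact: s0.
- apply: (sCC _); apply: H => // a.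
  apply: trig_limit_ray; first exact: measurable_fst.
  + move=> k; rewrite (_ : (fun _ => _) = (fun x => 1 * hartley k 0 x)).
      exact: trigpoly_hartley.
    by apply/funext => x; rewrite /hartley cas0 mul1r mulr1.
  + by move=> x [].
- apply: (sCC _); apply: H => // a.
  apply: trig_limit_ray; first exact: measurable_snd.
  + move=> k; rewrite (_ : (fun _ => _) = (fun x => 1 * hartley 0 k x)).
      exact: trigpoly_hartley.
    by apply/funext => x; rewrite /hartley cas0 !mul1r.
  + by move=> x [].
Qed.

End Density.

Lemma indic_le1 (T : Type) (R : realType) (E : set T) x : `|\1_E x : R| <= 1.
Proof. by rewrite indicE; case: (_ \in _); rewrite ?normr1 ?normr0. Qed.

(** * Density of trigonometric polynomials *)

Section WeightedDensity.
Context {R : realType}.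
Notation plane := (measurableTypeR R * measurableTypeR R)%type.
Notation mu := (torus_measure (@T2 R)).
Variable w : R * R -> R.
Hypothesis w_ge0 : forall x, 0 <= w x.
Hypothesis w_int : mu.-integrable setT (EFin \o w).
Implicit Types (f g : R * R -> R).

Let w_meas : measurable_fun [set: plane] w.
Proof. by apply/measurable_EFinP; exact: measurable_int w_int. Qed.

Lemma integrable_weight f (M : R) : measurable_fun [set: plane] f ->
  (forall x, `|f x| <= M) -> mu.-integrable setT (EFin \o (fun x => w x * f x)).
Proof.
move=> mf fM.
apply: (@le_integrable _ _ _ mu setT measurableT _ (fun x => M%:E * (EFin \o w) x)%E) => //.
- by apply/measurable_EFinP; exact: measurable_funM.
- move=> x _ /=; rewrite lee_fin normrM normrM mulrC; apply: ler_wpM2r => //.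
  exact: le_trans (fM x) (ler_norm _).
- exact: integrableZl.
Qed.

Let bsqr f (M : R) : measurable_fun [set: plane] f -> (forall x, `|f x| <= M) ->
  mu.-integrable setT (EFin \o (fun x => w x * f x ^+ 2)).
Proof.
move=> mf fM; apply: (@integrable_weight _ (M ^+ 2)); first exact: measurable_funX.
move=> x; rewrite normrX lerXn2r// ?nnegrE//.
exact: le_trans (fM x).
Qed.

Lemma wsqD f g (M N : R) : measurable_fun [set: plane] f -> measurable_fun [set: plane] g ->
  (forall x, `|f x| <= M) -> (forall x, `|g x| <= N) ->
  \int[mu]_x (w x * (f x + g x) ^+ 2) <=
  2 * \int[mu]_x (w x * f x ^+ 2) + 2 * \int[mu]_x (w x * g x ^+ 2).
Proof.
move=> mf mg fM gN.
have If := bsqr mf fM; have Ig := bsqr mg gN.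
have Ifg : mu.-integrable setT (EFin \o (fun x => w x * (f x + g x) ^+ 2)).
  apply: (@bsqr (fun x => f x + g x) (M + N)); first exact: measurable_funD.
  by move=> x; apply: (le_trans (ler_normD _ _)); rewrite lerD.
have If2 : mu.-integrable setT (EFin \o (fun x => 2 * (w x * f x ^+ 2))).
  exact: (integrableZl measurableT 2 If).
have Ig2 : mu.-integrable setT (EFin \o (fun x => 2 * (w x * g x ^+ 2))).
  exact: (integrableZl measurableT 2 Ig).
rewrite -!RintegralZl// -RintegralD//; apply: le_Rintegral => //.
  exact: (integrableD measurableT If2 Ig2).
move=> x _; rewrite -subr_ge0.
rewrite (_ : _ - _ = w x * (f x - g x) ^+ 2); last by ring.
by rewrite mulr_ge0// sqr_ge0.
Qed.

Lemma wsq_cvg_le (f_ : nat -> R * R -> R) f (e : R) : 0 < e ->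
  (forall n, measurable_fun [set: plane] (f_ n)) -> measurable_fun [set: plane] f ->
  (forall n x, `|f x - f_ n x| <= 1) ->
  {ae mu, forall x, f_ n x @[n --> \oo] --> f x} ->
  exists n, \int[mu]_x (w x * (f x - f_ n x) ^+ 2) <= e.
Proof.
move=> e0 mf_ mf b1 cv.
have : \int[mu]_x (w x * (f x - f_ n x) ^+ 2) @[n --> \oo] --> \int[mu]_x cst 0 x.
  apply: (@Rintegral_dominated_cvg _ _ _ mu _ _ w) => //.
  - move=> n; apply: measurable_funM => //; apply: measurable_funX.
    exact: measurable_funB.
  - apply: (ae_imply _ cv) => x cx.
    rewrite (_ : cst 0 x = w x * (f x - f x) ^+ 2); last by rewrite subrr expr0n mulr0.
    apply: cvgM; first exact: cvg_cst.
    rewrite expr2; under eq_fun do rewrite expr2.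
    by apply: cvgM; apply: cvgB => //; exact: cvg_cst.
  - move=> n x; rewrite normrM ger0_norm// -[leRHS]mulr1; apply: ler_wpM2l => //.
    by rewrite normrX exprn_ile1.
rewrite Rintegral_cst// mul0r => /cvgrPdist_le /(_ e e0) [N _ /(_ N (leqnn N))].
rewrite /= sub0r normrN => h; exists N.
exact: le_trans (ler_norm _) h.
Qed.

(** The sets whose indicator can be approximated in the L^2 space of weight w
    form a lambda-system: differences cost a factor 2, increasing unions follow
    by dominated convergence. It contains the pi-system of trig_limit. The
    arbitrary integrable weight is what makes uniqueness in L^1 accessible. *)
Lemma weighted_density (E : set plane) (e : R) : measurable E -> 0 < e ->
  exists2 p, trigpoly p & \int[mu]_x (w x * (\1_E x - p x) ^+ 2) <= e.
Proof.
pose H := [set E : set plane | measurable E /\ forall e : R, 0 < e ->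
  exists2 p, trigpoly p & \int[mu]_x (w x * (\1_E x - p x) ^+ 2) <= e].
suff HE : @measurable _ plane `<=` H by move=> /HE [_ h]; exact: h.
have mI (A : set plane) : measurable A -> measurable_fun [set: plane] (\1_A : plane -> R).
  by move=> mA; exact: measurable_indic.
have combine f g p q (e1 e2 : R) : measurable_fun [set: plane] f -> measurable_fun [set: plane] g ->
    (forall x, `|f x| <= 1) -> (forall x, `|g x| <= 1) -> trigpoly p -> trigpoly q ->
    \int[mu]_x (w x * (f x - p x) ^+ 2) <= e1 -> \int[mu]_x (w x * (g x - q x) ^+ 2) <= e2 ->
    \int[mu]_x (w x * ((f x - p x) + (g x - q x)) ^+ 2) <= 2 * e1 + 2 * e2.
  move=> mf mg f1 g1 tp tq h1 h2.
  have [P pP] := trigpoly_bounded tp; have [Q qQ] := trigpoly_bounded tq.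
  apply: (le_trans (@wsqD _ _ (1 + P) (1 + Q) _ _ _ _)).
  - by apply: measurable_funB => //; exact: trigpoly_measurable.
  - by apply: measurable_funB => //; exact: trigpoly_measurable.
  - by move=> x; apply: (le_trans (ler_normB _ _)); rewrite lerD.
  - by move=> x; apply: (le_trans (ler_normB _ _)); rewrite lerD.
  - by rewrite lerD// ler_wpM2l.
have HL : lambda_system setT H.
  split => //.
  - split => // d d0; exists (cst 1); first exact: trigpoly_cst.
    rewrite (eq_Rintegral mu (g := cst 0)) ?Rintegral_cst ?mul0r ?ltW//.
    by move=> x _; rewrite indicT/= subrr expr0n/= mulr0.
  - move=> A B BA [mA HA] [mB HB]; split; first exact: measurableD.
    move=> d d0; have d4 : 0 < d / 4 by rewrite divr_gt0.
    have [p tp hp] := HA _ d4; have [q tq hq] := HB _ d4.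
    exists (fun x => p x - q x); first exact: trigpolyB.
    have hq' : \int[mu]_x (w x * (- \1_B x - - q x) ^+ 2) <= d / 4.
      by under eq_Rintegral do rewrite -opprD sqrrN.
    have := combine (\1_A) (fun x => - \1_B x) _ _ _ _ (mI _ mA) _ (indic_le1 R A) _ tp (trigpolyN tq) hp hq'.
    rewrite (_ : 2 * (d / 4) + 2 * (d / 4) = d); last by field.
    move=> h; rewrite (eq_Rintegral mu (g := fun x => w x * ((\1_A x - p x) + (- \1_B x - - q x)) ^+ 2)).
      apply: h; last by move=> x; rewrite normrN indic_le1.
      by apply: measurable_funN; exact: mI.
    move=> x _; congr (_ * _ ^+ 2); rewrite setDE indicI indicC /=.
    have := BA x; rewrite !indicE; case: (boolP (x \in B)) => [/set_mem Bx /(_ Bx)/mem_set -> |_ _] /=; lra.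
  - move=> F ndF HF; have mF : measurable (\bigcup_i F i) by apply: bigcup_measurable => i _; case: (HF i).
    split => // d d0; have d4 : 0 < d / 4 by rewrite divr_gt0.
    have [n hn] : exists n, \int[mu]_x (w x * (\1_(\bigcup_i F i) x - \1_(F n) x) ^+ 2) <= d / 4.
      apply: wsq_cvg_le => //.
      + by move=> n; apply: mI; case: (HF n).
      + move=> n x; rewrite !indicE; case: (x \in _); case: (x \in _);
          by rewrite ?subrr ?subr0 ?sub0r ?normrN ?normr1 ?normr0.
      + apply: nearW => x; have [[i _ Fix]|nFx] := pselect ((\bigcup_i F i) x).
          rewrite indicE mem_set; last by exists i.
          apply: cvg_near_cst; exists i => // j /= ij.
          by apply/eqP; rewrite indicE mem_set//; move/subsetPset: (ndF _ _ ij); exact.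
        rewrite indicE memNset//; apply: cvg_near_cst; apply: nearW => j.
        by rewrite indicE memNset// => Fjx; apply: nFx; exists j.
    have [_ /(_ _ d4)[p tp hp]] := HF n.
    exists p => //.
    have hn' : \int[mu]_x (w x * ((\1_(\bigcup_i F i) x - \1_(F n) x) - (cst 0 : R * R -> R) x) ^+ 2) <= d / 4.
      by under eq_Rintegral do rewrite subr0.
    have := combine (fun x => \1_(\bigcup_i F i) x - \1_(F n) x) (\1_(F n)) _ _ _ _ _ _ _ (indic_le1 R _) (trigpoly_cst 0) tp hn' hp.
    rewrite (_ : 2 * (d / 4) + 2 * (d / 4) = d); last by field.
    move=> h; rewrite (eq_Rintegral mu (g := fun x => w x *
        (((\1_(\bigcup_i F i) x - \1_(F n) x) - (cst 0 : R * R -> R) x) + (\1_(F n) x - p x)) ^+ 2)).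
      apply: h.
      + by apply: measurable_funB; [exact: mI|apply: mI; case: (HF n)].
      + by apply: mI; case: (HF n).
      + move=> x; rewrite !indicE; case: (x \in _); case: (x \in _);
          by rewrite ?subrr ?subr0 ?sub0r ?normrN ?normr1 ?normr0.
    by move=> x _; rewrite /= subr0 addrA subrK.
apply: (subset_trans (@measurable_trig_limit R)).
apply: lambda_system_subset => //; first exact: trig_limitI.
move=> U [mU [p [tp p01 cp]]]; split => // d d0.
have [n hn] : exists n, \int[mu]_x (w x * (\1_U x - p n x) ^+ 2) <= d.
  apply: wsq_cvg_le => //.
  - by move=> n; exact: trigpoly_measurable.
  - move=> n x; have /andP[h0 h1] := p01 n x; rewrite indicE ler_norml.
    by case: (_ \in _) => /=; apply/andP; split; lra.
  - by apply: (ae_imply _ (@ae_open_cell R)) => x; exact: cp.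
by exists (p n).
Qed.

End WeightedDensity.

Section TorusDensity.
Context {R : realType}.
Notation plane := (measurableTypeR R * measurableTypeR R)%type.
Notation mu := (torus_measure (@T2 R)).
Implicit Types (f g : R * R -> R).

(** Although g is only integrable, bounded functions are square integrable for
    the weight |g|. Density for this weight and Young's inequality show that
    the integral of g over every measurable set vanishes; the set where g > 0
    then gives the integral of |g|. *)
Lemma trigpoly_separates g : mu.-integrable setT (EFin \o g) ->
  (forall p, trigpoly p -> \int[mu]_x (g x * p x) = 0) ->
  {ae mu, forall x, g x = 0}.
Proof.
move=> ig g0.
have mg : measurable_fun [set: plane] g by apply/measurable_EFinP; exact: measurable_int ig.
have ag : mu.-integrable setT (EFin \o (fun x => `|g x|)).
  by have := integrable_norm ig.
pose G := \int[mu]_x `|g x|.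
have G0 : 0 <= G by apply: Rintegral_ge0.
have bI f (M : R) : measurable_fun [set: plane] f -> (forall x, `|f x| <= M) ->
    mu.-integrable setT (EFin \o (fun x => g x * f x)).
  move=> mf fM; apply: (@le_integrable _ _ _ mu setT measurableT _ (EFin \o (fun x => `|g x| * f x))) => //.
  - by apply/measurable_EFinP; exact: measurable_funM.
  - by move=> x _ /=; rewrite lee_fin !normrM normr_id.
  - exact: (integrable_weight ag mf fM).
have indic0 (E : set plane) : measurable E -> \int[mu]_x (g x * \1_E x) = 0.
  move=> mE; have mI : measurable_fun [set: plane] (\1_E : plane -> R) by exact: measurable_indic.
  apply/eqP; rewrite -normr_le0; apply/ler_addgt0Pl => d d0; rewrite addr0.
  (* Young's inequality |z| <= t/2 + z^2/(2t) is used, with t of the order of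
     the error d and an approximation of order t^2. *)
  pose t := d / (G + 1); have t0 : 0 < t by rewrite divr_gt0// ltr_wpDl.
  have [p tp hp] := weighted_density (fun x => normr_ge0 (g x)) ag mE (exprn_gt0 2 t0).
  have [P pP] := trigpoly_bounded tp.
  have mp := trigpoly_measurable tp.
  have mIp : measurable_fun [set: plane] (fun x => \1_E x - p x) by exact: measurable_funB.
  have Ip x : `|\1_E x - p x| <= 1 + P by apply: (le_trans (ler_normB _ _)); rewrite lerD ?indic_le1.
  have -> : \int[mu]_x (g x * \1_E x) = \int[mu]_x (g x * (\1_E x - p x)).
    under [RHS]eq_Rintegral do rewrite mulrBr.
    by rewrite (RintegralB measurableT (bI _ _ mI (indic_le1 R E)) (bI _ _ mp pP)) (g0 _ tp) subr0.
  apply: (le_trans (le_normr_Rintegral measurableT (bI _ _ mIp Ip))).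
  have i1 : mu.-integrable setT (EFin \o (fun x => t / 2 * `|g x|)).
    exact: (integrableZl measurableT (t / 2) ag).
  have i2' : mu.-integrable setT (EFin \o (fun x => `|g x| * (\1_E x - p x) ^+ 2)).
    apply: (@integrable_weight _ _ ag _ ((1 + P) ^+ 2)).
      exact: measurable_funX.
    move=> x; rewrite normrX lerXn2r// ?nnegrE//.
    exact: le_trans (Ip x).
  have i2 : mu.-integrable setT (EFin \o (fun x => (2 * t)^-1 * (`|g x| * (\1_E x - p x) ^+ 2))).
    exact: (integrableZl measurableT ((2 * t)^-1) i2').
  apply: (@le_trans _ _ (\int[mu]_x (t / 2 * `|g x| + (2 * t)^-1 * (`|g x| * (\1_E x - p x) ^+ 2)))).
    apply: le_Rintegral => //.
    - exact: (integrable_norm (bI _ _ mIp Ip)).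
    - exact: (integrableD measurableT i1 i2).
    move=> x _; rewrite normrM -[X in _ <= X](_ : `|g x| * (t / 2 + (2 * t)^-1 * (\1_E x - p x) ^+ 2) = _); last by ring.
    apply: ler_wpM2l => //; rewrite -(real_normK (num_real (\1_E x - p x))).
    set a := `|_|; rewrite -subr_ge0 (_ : _ - _ = (2 * t)^-1 * (t - a) ^+ 2); last by field; rewrite gt_eqF.
    by rewrite mulr_ge0 ?sqr_ge0// invr_ge0 mulr_ge0// ltW.
  rewrite RintegralD// !RintegralZl// -/G.
  have h : (2 * t)^-1 * \int[mu]_x (`|g x| * (\1_E x - p x) ^+ 2) <= t / 2.
    rewrite (_ : t / 2 = (2 * t)^-1 * t ^+ 2); last by field; rewrite gt_eqF.
    by rewrite ler_wpM2l// invr_ge0 mulr_ge0// ltW.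
  apply: (@le_trans _ _ (t / 2 * (G + 1))); first by rewrite mulrDr mulr1 lerD2l.
  rewrite /t; set D := G + 1; have D0 : 0 < D by rewrite ltr_wpDl.
  rewrite (_ : d / D / 2 * D = d / 2); last by field; rewrite gt_eqF.
  by lra.
pose E : set plane := [set x | 0 < g x].
have mE : measurable E.
  rewrite (_ : E = setT `&` g @^-1` `]0, +oo[%classic); last first.
    by rewrite setTI; apply/seteqP; split => x /=; rewrite in_itv/= andbT.
  exact: (mg measurableT).
have iabs : (\int[mu]_x `|g x|%:E = 0)%E.
  have mI : measurable_fun [set: plane] (\1_E : plane -> R) by exact: measurable_indic.
  have : \int[mu]_x `|g x| = 0.
    rewrite (eq_Rintegral mu (g := fun x => 2 * (g x * \1_E x) - g x * 1)).
      rewrite RintegralB//; first 1 last.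
      + exact: (integrableZl measurableT 2 (bI _ _ mI (indic_le1 R E))).
      + by apply: (bI (cst 1) 1) => // x; rewrite normr1.
      rewrite RintegralZl//; last exact: bI mI (indic_le1 R E).
      by rewrite indic0// g0; [lra|exact: trigpoly_cst].
    move=> x _; rewrite indicE; case: (boolP (x \in E)) => [/set_mem|/negP xE] /=.
      by rewrite /E /= => gx; rewrite gtr0_norm//; lra.
    have gx : g x <= 0 by rewrite leNgt; apply/negP => gx; apply: xE; exact/mem_set.
    by rewrite ler0_norm//; lra.
  move=> h; have := integrable_fin_num measurableT ag.
  by rewrite /Rintegral in h; move=> /fineK <-; rewrite h.
have mEg : measurable_fun [set: plane] (EFin \o g) by exact/measurable_EFinP.
have [h _] := ae_eq_integral_abs mu measurableT mEg.
by apply: (ae_imply _ (h iabs)) => x /= /(_ Logic.I) [].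
Qed.

Let L2dist f g := \int[mu]_x ((f x - g x) ^+ 2).

Lemma L2dist_triangle f g h : sqint mu f -> sqint mu g -> sqint mu h ->
  L2dist f h <= 2 * L2dist f g + 2 * L2dist g h.
Proof.
move=> sf sg sh.
have [_ i1] := sqintB sf sg; have [_ i2] := sqintB sg sh.
have [_ i3] := sqintB sf sh.
rewrite /L2dist -!RintegralZl// -RintegralD//; last 2 first.
- exact: (integrableZl measurableT 2 i1).
- exact: (integrableZl measurableT 2 i2).
apply: le_Rintegral => //.
  exact: (integrableD measurableT (integrableZl measurableT 2 i1) (integrableZl measurableT 2 i2)).
move=> x _; rewrite -subr_ge0.
rewrite (_ : _ - _ = (f x - g x - (g x - h x)) ^+ 2); last by ring.
exact: sqr_ge0.
Qed.

Let dense f := forall e : R, 0 < e -> exists2 p, trigpoly p & L2dist f p <= e.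

Let denseD f g : sqint mu f -> sqint mu g -> dense f -> dense g ->
  dense (fun x => f x + g x).
Proof.
move=> sf sg df dg e e0; have e4 : 0 < e / 4 by rewrite divr_gt0.
have [p tp hp] := df _ e4; have [q tq hq] := dg _ e4.
have sp := sqint_trigpoly tp; have sq := sqint_trigpoly tq.
exists (fun x => p x + q x); first exact: trigpolyD.
apply: (le_trans (@L2dist_triangle _ (fun x => p x + g x) _ _ _ _)); try exact: sqintD.
have -> : L2dist (fun x => f x + g x) (fun x => p x + g x) = L2dist f p.
  by apply: eq_Rintegral => x _; congr (_ ^+ 2); ring.
have -> : L2dist (fun x => p x + g x) (fun x => p x + q x) = L2dist g q.
  by apply: eq_Rintegral => x _; congr (_ ^+ 2); ring.
by lra.
Qed.

Let denseZ (a : R) f : sqint mu f -> dense f -> dense (fun x => a * f x).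
Proof.
move=> sf df e e0; have a1 : 0 < a ^+ 2 + 1 by rewrite ltr_wpDl// sqr_ge0.
have [p tp hp] := df (e / (a ^+ 2 + 1)) (divr_gt0 e0 a1).
have [_ i1] := sqintB sf (sqint_trigpoly tp).
exists (fun x => a * p x); first exact: trigpolyZ.
rewrite /L2dist (eq_Rintegral mu (g := fun x => a ^+ 2 * (f x - p x) ^+ 2)); last first.
  by move=> x _; ring.
rewrite RintegralZl//; move: hp; rewrite -/(L2dist f p) ler_pdivlMr// mulrDr mulr1 mulrC.
by apply: le_trans; rewrite lerDl; apply: Rintegral_ge0 => x _; exact: sqr_ge0.
Qed.

Let dense_cvg f (f_ : nat -> R * R -> R) : sqint mu f -> (forall n, sqint mu (f_ n)) ->
  (forall n, dense (f_ n)) -> (forall n x, `|f x - f_ n x| <= `|f x|) ->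
  (forall x, f_ n x @[n --> \oo] --> f x) -> dense f.
Proof.
move=> sf sf_ df_ ff_ cf e e0; have e4 : 0 < e / 4 by rewrite divr_gt0.
have [mf if2] := sf.
have : \int[mu]_x ((f x - f_ n x) ^+ 2) @[n --> \oo] --> \int[mu]_x cst 0 x.
  apply: (@Rintegral_dominated_cvg _ _ _ mu _ _ (fun x => f x ^+ 2)) => //.
  - by move=> n; have [m _] := sqintB sf (sf_ n); exact: measurable_funX.
  - apply: nearW => x.
    rewrite (_ : cst 0 x = (f x - f x) ^+ 2); last by rewrite subrr expr0n.
    rewrite expr2; under eq_fun do rewrite expr2.
    by apply: cvgM; apply: cvgB => //; exact: cvg_cst.
  - move=> n x; rewrite normrX -[leRHS]real_normK ?num_real// lerXn2r// ?nnegrE//.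
rewrite Rintegral_cst// mul0r => /cvgrPdist_le /(_ _ e4) [N _ /(_ N (leqnn N))].
rewrite /= sub0r normrN => h.
have {}h : L2dist f (f_ N) <= e / 4 by exact: le_trans (ler_norm _) h.
have [p tp hp] := df_ N _ e4; exists p => //.
apply: (le_trans (@L2dist_triangle _ (f_ N) _ _ _ _)) => //; first exact: sqint_trigpoly.
by lra.
Qed.

Let sqint_indic (E : set plane) : measurable E -> sqint mu (\1_E : plane -> R).
Proof.
move=> mE; by apply: (@sqint_bounded _ _ 1); [exact: measurable_indic|exact: indic_le1].
Qed.

Import HBNNSimple.

Let dense_sfun (s : {nnsfun plane >-> R}) : sqint mu s /\ dense s.
Proof.
have [r rE] : exists r : seq R, forall x, s x = \sum_(y <- r) (y * \1_(s @^-1` [set y]) x).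
  by exists (finmap.enum_fset (fset_set (range s))) => x; rewrite fimfunE fsbig_finite.
rewrite (_ : (s : plane -> R) = fun x => \sum_(y <- r) (y * \1_(s @^-1` [set y]) x)); last exact/funext.
have mS y : measurable (s @^-1` [set y]) by exact: measurable_sfunP.
have sI y := sqint_indic (mS y).
elim: r {rE} => [|y r [IH1 IH2]].
  under eq_fun do rewrite big_nil; split; first exact: sqint0.
  move=> e e0; exists (cst 0); first exact: trigpoly_cst.
  by rewrite /L2dist (eq_Rintegral mu (g := cst 0)) ?Rintegral_cst ?mul0r ?ltW// => x _; rewrite subrr expr0n.
under eq_fun do rewrite big_cons.
split; first by apply: sqintD => //; exact: sqintZ.
apply: denseD => //; first exact: sqintZ.
apply: denseZ => // e e0.
have i1 : mu.-integrable setT (EFin \o (cst 1 : R * R -> R)).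
  by apply: (@bounded_integrable _ _ 1) => // x; rewrite normr1.
have [p tp hp] := weighted_density (fun=> ler01) i1 (mS y) e0.
exists p => //; apply: le_trans hp; rewrite le_eqVlt; apply/orP; left; apply/eqP.
by apply: eq_Rintegral => x _; rewrite mul1r.
Qed.

Let dense_ge0 f : sqint mu f -> (forall x, 0 <= f x) -> dense f.
Proof.
move=> sf f0; have [mf _] := sf.
have mEf : measurable_fun [set: plane] (EFin \o f) by exact/measurable_EFinP.
pose s := nnsfun_approx measurableT mEf.
have f0E x : setT x -> (0 <= (EFin \o f) x)%E by rewrite /= lee_fin.
apply: (@dense_cvg _ (fun n => s n : plane -> R)) => //.
- by move=> n; case: (dense_sfun (s n)).
- by move=> n; case: (dense_sfun (s n)).
- move=> n x; have : ((s n x)%:E <= (f x)%:E)%E.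
    by rewrite /s nnsfun_approxE; exact: (le_approx _ f0E).
  rewrite lee_fin => h; have h0 : 0 <= s n x by [].
  by rewrite !ger0_norm ?subr_ge0// gerBl.
- move=> x; have h := cvg_nnsfun_approx measurableT mEf f0E (x := x) Logic.I.
  exact: (@fine_cvg _ _ _ _ (fun n => (s n x)%:E) (f x) h).
Qed.

(** From indicators (weight 1) to simple functions, to nonnegative functions by
    monotone approximation, and to differences. *)
Lemma trigpoly_dense f (e : R) : sqint mu f -> 0 < e ->
  exists2 p, trigpoly p & \int[mu]_x ((f x - p x) ^+ 2) <= e.
Proof.
move=> sf e0.
have mm g : sqint mu g -> sqint mu (fun x => Num.max (g x) 0).
  move=> [mg ig]; have mgm : measurable_fun [set: plane] (fun x => Num.max (g x) 0).
    by apply: measurable_maxr => //; exact: measurable_cst.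
  split => //.
  apply: (@le_integrable _ _ _ mu setT measurableT _ (EFin \o (fun x => g x ^+ 2))) => //.
    by apply/measurable_EFinP; exact: measurable_funX.
  move=> x _ /=; rewrite lee_fin !ger0_norm ?sqr_ge0// /Num.max.
  by case: ifP => _ //; rewrite expr0n/= sqr_ge0.
have s1 := mm _ sf; have s2 := mm _ (sqintN sf).
have d1 : dense (fun x => Num.max (f x) 0) by apply: dense_ge0 => // x; rewrite le_max lexx orbT.
have d2 : dense (fun x => Num.max (- f x) 0) by apply: dense_ge0 => // x; rewrite le_max lexx orbT.
have := denseD s1 (sqintZ (-1) s2) d1 (denseZ (-1) s2 d2) e0.
rewrite (_ : (fun _ => _ + _) = f)//; apply/funext => x; rewrite /Num.max.
by case: ltP => h1; case: ltP => h2; lra.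
Qed.

End TorusDensity.

Lemma Rintegral_ge0_eq0 d (T : measurableType d) (R : realType)
    (mu : {measure set T -> \bar R}) (f : T -> R) :
  mu.-integrable setT (EFin \o f) -> (forall x, 0 <= f x) ->
  \int[mu]_x f x = 0 -> {ae mu, forall x, f x = 0}.
Proof.
move=> fi f0 If; have mf := measurable_int mu fi.
have [h _] := ae_eq_integral_abs mu measurableT mf.
apply: (ae_imply _ (h _)) => [x /= /(_ Logic.I) []//|].
have -> : (\int[mu]_x `|(EFin \o f) x| = \int[mu]_x (f x)%:E)%E.
  by apply: eq_integral => x _ /=; rewrite ger0_norm.
have := integrable_fin_num measurableT fi.
by rewrite /Rintegral in If; move=> /fineK <-; rewrite If.
Qed.

(** * Fourier sums *)

Section Fourier.
Context {R : realType}.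
Notation plane := (measurableTypeR R * measurableTypeR R)%type.
Notation mu := (torus_measure (@T2 R)).
Implicit Types (f g : R * R -> R) (k l : int) (i : 'I_2).
Local Notation inner f g := (\int[mu]_x (f x * g x)).
Local Notation kappa := ((2 * pi) ^+ 2 : R).

Lemma kappa_gt0 : 0 < kappa.
Proof. by rewrite exprn_gt0// two_pi_gt0. Qed.

Lemma trigpoly_hartley1 k l : trigpoly (@hartley R k l).
Proof.
have := @trigpoly_hartley R 1 k l.
by rewrite (_ : (fun _ => _) = hartley k l)//; apply/funext => x; rewrite mul1r.
Qed.

Lemma sqint_hartley k l : sqint mu (hartley k l).
Proof. exact/sqint_trigpoly/trigpoly_hartley1. Qed.

(** By Fubini, orthogonality reduces to that of the kernels in each variable. *)
Lemma inner_hartley k l k' l' :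
  inner (hartley k l) (hartley k' l') = ((k == k') && (l == l'))%:R * kappa.
Proof.
have m j j' : measurable_fun setT (fun t : R => cas j t * cas j' t).
  by apply: measurable_funM; apply: continuous_measurable_fun; exact: continuous_cas.
have b j j' (t : R) : `|cas j t * cas j' t| <= 2 * 2.
  by rewrite normrM ler_pM// cas_le2.
have := Rintegral_torus_prod (m k k') (m l l') (b k k') (b l l').
rewrite !Rintegral_casM; under eq_Rintegral do rewrite mulrACA.
by move=> ->; case: (k == k'); case: (l == l') => /=; ring.
Qed.

Section PartialSums.
Variable N : nat.

(** The index j stands for the frequency j - N in [-N, N], so that reversing
    the index negates the frequency. *)
Definition frq (j : 'I_(N.*2.+1)) : int := j%:Z - N%:Z.
Local Notation index := ('I_(N.*2.+1) * 'I_(N.*2.+1))%type.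
Implicit Types (p q : index).

Definition hart p : R * R -> R := hartley (frq p.1) (frq p.2).
Definition coef f p : R := inner f (hart p).
(** Every Hartley function has squared norm kappa = (2 pi)^2. *)
Definition fourier_sum f : R * R -> R := fun x => \sum_p (kappa^-1 * coef f p) * hart p x.

Lemma frq_inj : injective frq.
Proof. by move=> j j' /(addIr _)/eqP; rewrite eqz_nat => /eqP/val_inj. Qed.

Lemma frq_rev j : frq (rev_ord j) = - frq j.
Proof.
rewrite /frq /= subSS opprB; have := ltn_ord j; rewrite ltnS => jN.
by move: (nat_of_ord j) jN => a aN; rewrite -subzn// -addnn PoszD; lia.
Qed.

Lemma frq_surj k : `|k| <= N%:Z -> exists j, frq j = k.
Proof.
move=> kN; have h : (`|(k + N%:Z)%R| < N.*2.+1)%N by lia.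
by exists (Ordinal h); rewrite /frq /=; lia.
Qed.

Lemma sqint_hart p : sqint mu (hart p).
Proof. exact: sqint_hartley. Qed.

Lemma trigpoly_fourier_sum f : trigpoly (fourier_sum f).
Proof. by apply: trigpoly_sum => p; exact: trigpoly_hartley. Qed.

Lemma inner_hart p q : inner (hart p) (hart q) = (p == q)%:R * kappa.
Proof.
rewrite inner_hartley !(inj_eq frq_inj).
by congr (_%:R * _); case: p q => [? ?] [? ?].
Qed.

Lemma inner_fourier_sum f g : sqint mu f -> sqint mu g ->
  inner (fourier_sum f) g = \sum_p kappa^-1 * (coef f p * coef g p).
Proof.
move=> sf sg; rewrite /fourier_sum inner_suml//; last first.
  by move=> p; apply: sqintZ; exact: sqint_hart.
apply: eq_bigr => p _; rewrite innerZl//; last exact: sqint_hart.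
by rewrite /coef (innerC mu (hart p) g) mulrA.
Qed.

Lemma coef_fourier_sum f p : sqint mu f -> coef (fourier_sum f) p = coef f p.
Proof.
move=> sf; rewrite /coef inner_fourier_sum//; last exact: sqint_hart.
rewrite (bigD1 p)//= big1 ?addr0 => [|q qp]; rewrite /coef inner_hart.
  by rewrite eqxx mul1r mulrC mulfK// gt_eqF// kappa_gt0.
by rewrite eq_sym (negbTE qp) mul0r !mulr0.
Qed.

Lemma fourier_sumB f g : sqint mu f -> sqint mu g ->
  fourier_sum (fun x => f x - g x) = fun x => fourier_sum f x - fourier_sum g x.
Proof.
move=> sf sg; apply/funext => x; rewrite /fourier_sum -sumrB; apply: eq_bigr => p _.
by rewrite /coef innerBl//; [ring|exact: sqint_hart].
Qed.

(** Expand the squared norm of f minus its partial sum. *)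
Lemma bessel f : sqint mu f -> \sum_p kappa^-1 * coef f p ^+ 2 <= inner f f.
Proof.
move=> sf; have sS := sqint_trigpoly (trigpoly_fourier_sum f).
have h := inner_ge0 mu (fun x => f x - fourier_sum f x); move: h.
rewrite innerBl//; last exact: sqintB.
rewrite !innerBr// (innerC mu f (fourier_sum f)).
rewrite (inner_fourier_sum sf sS) (inner_fourier_sum sf sf).
under [X in _ - _ - (_ - X)]eq_bigr do rewrite coef_fourier_sum//.
by rewrite subrr subr0 subr_ge0; under [X in _ -> X <= _]eq_bigr do rewrite expr2.
Qed.

Lemma fourier_sum_norm_le f : sqint mu f ->
  inner (fourier_sum f) (fourier_sum f) <= inner f f.
Proof.
move=> sf; have sS := sqint_trigpoly (trigpoly_fourier_sum f).
apply: le_trans (bessel sf); rewrite inner_fourier_sum//.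
by rewrite le_eqVlt; apply/orP; left; apply/eqP; apply: eq_bigr => p _; rewrite coef_fourier_sum.
Qed.

Lemma fourier_sum_hartley a k l : `|k| <= N%:Z -> `|l| <= N%:Z ->
  fourier_sum (fun x => a * hartley k l x) = fun x => a * hartley k l x.
Proof.
move=> /frq_surj[j <-] /frq_surj[j' <-]; apply/funext => x.
have cE q : coef (fun x => a * hartley (frq j) (frq j') x) q = a * (((j, j') == q)%:R * kappa).
  by rewrite /coef innerZl ?(inner_hart (j, j') q)//; [exact: sqint_hartley|exact: sqint_hart].
rewrite /fourier_sum (bigD1 (j, j'))//= big1 ?addr0 => [|q qp]; rewrite cE.
  congr (_ * _); rewrite eqxx.
  by rewrite (_ : kappa^-1 * (a * (1 * kappa)) = a)// mul1r mulrCA mulVf ?mulr1// gt_eqF// kappa_gt0.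
by rewrite eq_sym (negbTE qp) mul0r !mulr0 mul0r.
Qed.

Definition flipi i p : index := if i == 0 then (rev_ord p.1, p.2) else (p.1, rev_ord p.2).
Definition frqi i p : int := if i == 0 then frq p.1 else frq p.2.

Lemma flipiK i : involutive (flipi i).
Proof. by move=> [p1 p2]; rewrite /flipi; case: (i == 0); rewrite /= rev_ordK. Qed.

Lemma frqi_flipi i p : frqi i (flipi i p) = - frqi i p.
Proof. by rewrite /frqi /flipi; case: (i == 0); rewrite /= frq_rev. Qed.

Lemma partial_hart i p : partial i (hart p) = fun x => (frqi i p)%:~R * hart (flipi i p) x.
Proof.
rewrite /hart partial_hartley /freq /flip /frqi /flipi; apply/funext => x.
by case: ifP => _ /=; rewrite frq_rev.
Qed.

(** Test the weak derivative with a Hartley function. *)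
Lemma coef_wderiv i f g p : sqint mu f -> is_wderiv T2 i f g ->
  coef g p = - (frqi i p)%:~R * coef f (flipi i p).
Proof.
move=> sf fg; have tp : trigpoly (hart p) by exact: trigpoly_hartley1.
have := fg _ (trigpoly_smooth tp) (trigpoly_periodic tp).
rewrite partial_hart innerZr//; last exact: sqint_hart.
by rewrite /coef => h; rewrite mulNr h opprK.
Qed.

(** The frequencies kept by a partial sum are stable under change of sign, so
    truncation commutes with differentiation. Weak derivatives thus become
    limits of classical ones. *)
Lemma partial_fourier_sum i f g : sqint mu f -> is_wderiv T2 i f g ->
  partial i (fourier_sum f) = fourier_sum g.
Proof.
move=> sf fg.
have -> : partial i (fourier_sum f) = fun x => \sum_p (kappa^-1 * coef f p) * partial i (hart p) x.
  rewrite /fourier_sum; elim: (index_enum _) => [|p r IH].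
    under eq_fun do rewrite big_nil; apply/funext => x; rewrite big_nil.
    by rewrite /partial derive_cst.
  under eq_fun do rewrite big_cons; rewrite partialD; last 2 first.
  - exact: trigpoly_hartley.
  - by apply: trigpoly_sum => q; exact: trigpoly_hartley.
  apply/funext => x; rewrite big_cons IH; congr (_ + _).
  rewrite partialZ_hartley partial_hartley; ring.
apply/funext => x; rewrite /fourier_sum (reindex_inj (inv_inj (flipiK i))).
apply: eq_bigr => p _; rewrite partial_hart frqi_flipi flipiK (coef_wderiv p sf fg).
by rewrite mulrNz; ring.
Qed.

End PartialSums.

Lemma fourier_sum_trigpoly p : trigpoly p ->
  exists N0, forall N, (N0 <= N)%N -> fourier_sum N p = p.
Proof.
elim=> [a k l|g h tg [N1 h1] th [N2 h2]].
  exists (maxn `|k|%N `|l|%N) => N; rewrite geq_max => /andP[kN lN].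
  by apply: fourier_sum_hartley; lia.
exists (maxn N1 N2) => N; rewrite geq_max => /andP[/h1 e1 /h2 e2].
have := fourier_sumB N (sqint_trigpoly tg) (sqintN (sqint_trigpoly th)).
have eN : fourier_sum N (fun x => - h x) = fun x => - fourier_sum N h x.
  have := fourier_sumB N (sqint0 mu) (sqint_trigpoly th).
  have z : fourier_sum N (fun=> 0) = fun=> 0.
    by have := fourier_sumB N (sqint0 mu) (sqint0 mu); rewrite subrr => ->; apply/funext => x; rewrite subrr.
  by rewrite z; under eq_fun do rewrite sub0r; move=> ->; apply/funext => x; rewrite sub0r.
have eD : (fun x => g x - - h x) = (fun x => g x + h x) by apply/funext => x; rewrite opprK.
by rewrite eN e1 e2 eD => ->.
Qed.

(** A trigonometric polynomial close to f is reproduced by its own partial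
    sums, and taking partial sums is a contraction. *)
Lemma fourier_sum_cvg f (e : R) : sqint mu f -> 0 < e ->
  exists N0, forall N, (N0 <= N)%N -> \int[mu]_x ((f x - fourier_sum N f x) ^+ 2) <= e.
Proof.
move=> sf e0; have e4 : 0 < e / 4 by rewrite divr_gt0.
have [p tp hp] := trigpoly_dense sf e4; have [N0 hN] := fourier_sum_trigpoly tp.
exists N0 => N /hN eN; have sp := sqint_trigpoly tp.
have sfp := sqintB sf sp.
have sS := sqint_trigpoly (trigpoly_fourier_sum N (fun x => f x - p x)).
have -> : (fun x => (f x - fourier_sum N f x) ^+ 2) =
    (fun x => ((f x - p x) - fourier_sum N (fun x => f x - p x) x) ^+ 2).
  by apply/funext => x; rewrite fourier_sumB// eN; congr (_ ^+ 2); ring.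
have [_ i1] := sfp; have [_ i2] := sS; have [_ i3] := sqintB sfp sS.
have i1' := integrableZl measurableT 2 i1; have i2' := integrableZl measurableT 2 i2.
apply: (@le_trans _ _ (2 * \int[mu]_x ((f x - p x) ^+ 2)
   + 2 * \int[mu]_x (fourier_sum N (fun x => f x - p x) x ^+ 2))).
  rewrite -!RintegralZl// -RintegralD//.
  apply: le_Rintegral => //; first exact: (integrableD measurableT i1' i2').
  move=> x _; rewrite -subr_ge0; set a := f x - p x; set b := fourier_sum _ _ _.
  by rewrite (_ : _ - _ = (a + b) ^+ 2); [exact: sqr_ge0|ring].
have := fourier_sum_norm_le N sfp.
under eq_Rintegral do rewrite -expr2.
under [X in _ <= X -> _]eq_Rintegral do rewrite -expr2.
by move: hp; lra.
Qed.

End Fourier.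

(** * Smooth periodic functions *)

Section SmoothPeriodic.
Context {R : realType}.
Notation plane := (measurableTypeR R * measurableTypeR R)%type.
Implicit Types (f : R * R -> R).

(** An open set is a countable union of rational boxes, which are measurable
    for the product structure. *)
Lemma open_measurable_plane (U : set (R * R)) : open U -> measurable (U : set plane).
Proof.
move=> oU.
pose box (q : rat * rat * nat) : set plane :=
  `]ratr q.1.1 - q.2.+1%:R^-1, ratr q.1.1 + q.2.+1%:R^-1[ `*`
  `]ratr q.1.2 - q.2.+1%:R^-1, ratr q.1.2 + q.2.+1%:R^-1[.
pose F q := if pselect (box q `<=` U) then box q else set0.
have -> : (U : set plane) = \bigcup_q F q.
  apply/seteqP; split => [x Ux|x [q _]]; last first.
    by rewrite /F; case: pselect => [h /h|].
  have [x1 [x2 xE]] : exists x1 x2 : R, x = (x1, x2) by case: x {Ux} => a b; exists a, b.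
  rewrite {}xE in Ux *.
  have /nbhs_ballP[e /= e0 eU] : nbhs (x1, x2) U by exact: open_nbhs_nbhs.
  have [n ne] : exists n, n.+1%:R^-1 < e / 2.
    have e2 : 0 < e / 2 by rewrite divr_gt0.
    have [N _ /(_ N (leqnn N))] := (@cvgrPdist_lt _ _ _ _ _ _ _).1 (@cvg_harmonic R) _ e2.
    by rewrite /= sub0r normrN ger0_norm ?invr_ge0// => h; exists N.
  have n0 : 0 < n.+1%:R^-1 :> R by rewrite invr_gt0.
  have [r rE] : exists r : R, r = n.+1%:R^-1 by eexists.
  rewrite -rE in ne n0.
  have l1 : x1 - r < x1 + r by move: n0; lra.
  have [q1 q1P] := rat_in_itvoo l1.
  have l2 : x2 - r < x2 + r by move: n0; lra.
  have [q2 q2P] := rat_in_itvoo l2.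
  move: q1P q2P; rewrite !in_itv/= => /andP[a1 b1] /andP[a2 b2].
  exists (q1, q2, n) => //; rewrite /F; case: pselect => [sub|nb] /=.
    by split => /=; rewrite in_itv/= -rE; apply/andP; split; lra.
  exfalso; apply: nb => -[y1 y2] [] /=; rewrite !in_itv/= -rE => /andP[c1 d1] /andP[c2 d2].
  by apply: eU; split; rewrite /ball /= ltr_norml; apply/andP; split; lra.
apply: countable_bigcupT_measurable => // q; rewrite /F; case: pselect => [sub|nb] /=; last exact: measurable0.
by apply: measurableX; exact: measurable_itv.
Qed.

Lemma continuous_measurable_plane f : continuous f -> measurable_fun [set: plane] f.
Proof.
move=> /continuousP cf; apply: (measurability _ (RGenOpens.measurableE R)).
move=> _ [_ [a [b ->] <-]]; rewrite setTI; apply: open_measurable_plane.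
exact/cf/interval_open.
Qed.

Lemma periodic_int (f : R * R -> R) (T : R * R) (k : int) x :
  periodic f T -> f (x + T *~ k) = f x.
Proof.
move=> pf; case: k => n; first by rewrite -pmulrn (periodicn pf).
have := periodicn pf n.+1 (x - T *+ n.+1); rewrite subrK => ->.
by rewrite NegzE mulrNz -pmulrn.
Qed.

(** Modulo the periods, every point lies in a compact cell. *)
Lemma torus_continuous_bounded f : continuous f -> torus_fun T2 f ->
  exists M : R, forall x, `|f x| <= M.
Proof.
move=> cf [p1 p2].
have cK : compact (`[0, 2 * pi] `*` `[0, 2 * pi] : set (R * R)).
  by apply: compact_setX; exact: segment_compact.
have [M [_ hM]] := compact_bounded (continuous_compact (continuous_subspaceT cf) cK).
exists (M + 1) => -[x1 x2].
have tp := @two_pi_gt0 R.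
have red (t : R) : exists k : int, 0 <= t + (2 * pi) *~ k <= 2 * pi.
  exists (- Num.floor (t / (2 * pi))); rewrite mulrNz -mulrzr.
  have /andP[h1 h2] := floor_itv (t / (2 * pi)).
  move: h1 h2; rewrite ler_pdivlMr// ltr_pdivrMr// intrD1 => h1 h2.
  by apply/andP; split; nra.
have [k1 h1] := red x1; have [k2 h2] := red x2.
have -> : f (x1, x2) = f (x1 + (2 * pi) *~ k1, x2 + (2 * pi) *~ k2).
  rewrite -(periodic_int k1 (x1, x2) p1) -(periodic_int k2 _ p2); congr f.
  have e0 (a b : R) (n : nat) : (a, b) *+ n = (a *+ n, b *+ n).
    by elim: n => [|n IH]; rewrite ?mulr0n// !mulrS IH.
  have e1 (a b : R) (n : int) : (a, b) *~ n = (a *~ n, b *~ n).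
    by case: n => n; rewrite ?NegzE ?mulrNz -!pmulrn e0.
  by rewrite !e1 !mul0rz -[LHS]/(x1 + (2 * pi) *~ k1 + 0, x2 + 0 + (2 * pi) *~ k2) !addr0.
apply: hM; first by rewrite ltrDl.
by exists (x1 + (2 * pi) *~ k1, x2 + (2 * pi) *~ k2) => //; split; rewrite /= in_itv.
Qed.

Lemma smooth_continuous f : smooth f -> continuous f.
Proof. by move=> sf; have [] := sf [::] 0. Qed.

Lemma smooth_partial i f : smooth f -> smooth (partial i f).
Proof. by move=> sf s j; have := sf (rcons s i) j; rewrite foldr_rcons. Qed.

Lemma torus_fun_partial P i f : torus_fun P f -> torus_fun P (partial i f).
Proof.
have H (T : R * R) : periodic f T -> periodic (partial i f) T.
  move=> pf x; rewrite /partial /derive.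
  have -> : f \o shift (x + T) = f \o shift x by apply/funext => y /=; rewrite addrA pf.
  by rewrite pf.
by move=> [/H p1 /H p2].
Qed.

End SmoothPeriodic.

(** * Weak derivatives *)

Section WeakDerivatives.
Context {R : realType}.
Notation plane := (measurableTypeR R * measurableTypeR R)%type.
Notation mu := (torus_measure (@T2 R)).
Implicit Types (f g h : R * R -> R) (i : 'I_2).
Local Notation inner f g := (\int[mu]_x (f x * g x)).

Lemma Leb1P f : Leb T2 1 f <->
  [/\ measurable_fun [set: plane] f, torus_fun T2 f & mu.-integrable setT (EFin \o f)].
Proof.
split=> [[mf tf nf]|[mf tf fi]]; split => //.
  by apply/Lfun1_integrable; rewrite inE; apply/andP; split; rewrite inE.
by move/Lfun1_integrable : fi; rewrite inE => /andP[_]; rewrite inE.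
Qed.

Lemma Leb2P f : Leb T2 2%:E f <-> sqint mu f /\ torus_fun T2 f.
Proof.
split=> [[mf tf nf]|[sf tf]].
  by split => //; apply/sqint_Lfun; rewrite inE; apply/andP; split; rewrite inE.
have [mf _] := sf; split => //.
by move/sqint_Lfun : sf; rewrite inE => /andP[_]; rewrite inE.
Qed.

Lemma sqint_integrable f : sqint mu f -> mu.-integrable setT (EFin \o f).
Proof.
move=> sf; have := integrable_mulr_sqint sf (sqint_trigpoly (trigpoly_cst 1)).
by congr (mu.-integrable _ _); apply/funext => x /=; rewrite mulr1.
Qed.

Lemma Leb2_Leb1 f : Leb T2 2%:E f -> Leb T2 1 f.
Proof.
by move=> /Leb2P[sf tf]; apply/Leb1P; split => //; [case: sf|exact: sqint_integrable].
Qed.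

Lemma torus_funB P f g : torus_fun P f -> torus_fun P g -> torus_fun P (fun x => f x - g x).
Proof. by move=> [f1 f2] [g1 g2]; split => x; rewrite ?f1 ?f2 ?g1 ?g2. Qed.

Lemma Leb2B f g : Leb T2 2%:E f -> Leb T2 2%:E g -> Leb T2 2%:E (fun x => f x - g x).
Proof.
move=> /Leb2P[sf tf] /Leb2P[sg tg]; apply/Leb2P; split; first exact: sqintB.
exact: torus_funB.
Qed.

Lemma integrable_mul_bounded f g (M : R) : mu.-integrable setT (EFin \o f) ->
  measurable_fun [set: plane] g -> (forall x, `|g x| <= M) ->
  mu.-integrable setT (EFin \o (fun x => f x * g x)).
Proof. by move=> fi mg gM; exact: (integrable_weight fi mg gM). Qed.

Lemma smooth_bounded f : smooth f -> torus_fun T2 f ->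
  measurable_fun [set: plane] f /\ exists M : R, forall x, `|f x| <= M.
Proof.
move=> /smooth_continuous cf tf; split; first exact: continuous_measurable_plane.
exact: torus_continuous_bounded.
Qed.

Lemma sqint_smooth f : smooth f -> torus_fun T2 f -> sqint mu f.
Proof. by move=> sf tf; have [mf [M fM]] := smooth_bounded sf tf; exact: sqint_bounded fM. Qed.

(** The difference is orthogonal to all trigonometric polynomials. *)
Lemma is_wderiv_unique i f g h : mu.-integrable setT (EFin \o g) ->
  mu.-integrable setT (EFin \o h) -> is_wderiv T2 i f g -> is_wderiv T2 i f h ->
  {ae mu, forall x, g x = h x}.
Proof.
move=> gi hi wg wh.
have ghi : mu.-integrable setT (EFin \o (fun x => g x - h x)).
  by have := integrableB measurableT gi hi; congr (mu.-integrable _ _).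
apply: (ae_imply _ (trigpoly_separates ghi _)) => [x /eqP|p tp].
  by rewrite subr_eq0 => /eqP.
have [M pM] := trigpoly_bounded tp; have mp := trigpoly_measurable tp.
under eq_Rintegral do rewrite mulrBl.
rewrite (RintegralB measurableT (integrable_mul_bounded gi mp pM) (integrable_mul_bounded hi mp pM)).
have := wg _ (trigpoly_smooth tp) (trigpoly_periodic tp).
rewrite (wh _ (trigpoly_smooth tp) (trigpoly_periodic tp)) => /oppr_inj ->.
by rewrite subrr.
Qed.

Lemma wderiv_spec i f g : Leb T2 1 g -> is_wderiv T2 i f g ->
  Leb T2 1 (wderiv T2 i f) /\ is_wderiv T2 i f (wderiv T2 i f).
Proof.
move=> lg wg; apply: (@xgetPex _ (cst 0) [set g | Leb T2 1 g /\ is_wderiv T2 i f g]).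
by exists g.
Qed.

Lemma wderiv_ae i f g : Leb T2 1 g -> is_wderiv T2 i f g ->
  {ae mu, forall x, wderiv T2 i f x = g x}.
Proof.
move=> lg wg; have [/Leb1P[_ _ wi] ww] := wderiv_spec lg wg.
by apply: is_wderiv_unique ww wg => //; have /Leb1P[] := lg.
Qed.

Lemma sqint_ae f g : measurable_fun [set: plane] f -> sqint mu g ->
  {ae mu, forall x, f x = g x} -> sqint mu f.
Proof.
move=> mf [mg gi] fg; split => //; apply/integrableP; split.
  by apply/measurable_EFinP; exact: measurable_funX.
move/integrableP : gi => [mg2]; apply: le_lt_trans.
rewrite le_eqVlt; apply/orP; left; apply/eqP; apply: ge0_ae_eq_integral => //.
- by apply: measurableT_comp => //; apply/measurable_EFinP; exact: measurable_funX.
- by apply: measurableT_comp => //.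
- by apply: (ae_imply _ fg) => x /= -> _.
Qed.

Lemma is_wderiv_ae i f f' g : measurable_fun [set: plane] f -> measurable_fun [set: plane] f' ->
  {ae mu, forall x, f x = f' x} -> is_wderiv T2 i f' g -> is_wderiv T2 i f g.
Proof.
move=> mf mf' ff' w phi sphi tphi; rewrite -w//.
have [m _] := smooth_bounded (smooth_partial i sphi) (torus_fun_partial i tphi).
apply: ae_eq_Rintegral; [exact: measurable_funM|exact: measurable_funM|].
by apply: (ae_imply _ ff') => x ->.
Qed.

Lemma is_wderivB i f f' g g' : sqint mu f -> sqint mu f' -> sqint mu g -> sqint mu g' ->
  is_wderiv T2 i f f' -> is_wderiv T2 i g g' ->
  is_wderiv T2 i (fun x => f x - g x) (fun x => f' x - g' x).
Proof.
move=> sf sf' sg sg' wf wg phi sphi tphi.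
have s0 := sqint_smooth sphi tphi.
have s1 := sqint_smooth (smooth_partial i sphi) (torus_fun_partial i tphi).
by rewrite !innerBl// (wf _ sphi tphi) (wg _ sphi tphi) opprB opprK addrC.
Qed.

Definition H1 f := Sobolev T2 1 2%:E f.
Definition H2 f := Sobolev T2 2 2%:E f.

Lemma H1_sqint f : H1 f -> sqint mu f.
Proof. by move=> [/Leb2P[]]. Qed.

(** The chosen weak derivative, a priori only integrable, agrees almost
    everywhere with the square-integrable one of the Sobolev condition. *)
Lemma H1_wderiv i f : H1 f ->
  Leb T2 2%:E (wderiv T2 i f) /\ is_wderiv T2 i f (wderiv T2 i f).
Proof.
move=> [_ /(_ i)[g wg lg]].
have [/Leb1P[mw tw _] ww] := wderiv_spec (Leb2_Leb1 lg) wg.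
split => //; apply/Leb2P; split => //.
have /Leb2P[sg _] := lg.
exact: sqint_ae mw sg (wderiv_ae (Leb2_Leb1 lg) wg).
Qed.

Lemma H1_sqint_wderiv i f : H1 f -> sqint mu (wderiv T2 i f).
Proof. by move=> /(H1_wderiv i)[/Leb2P[]]. Qed.

Lemma H2_H1 f : H2 f -> H1 f.
Proof.
by move=> [lf wf]; split => // i; have [g wg [lg _]] := wf i; exists g.
Qed.

Lemma H2_wderiv i f : H2 f -> H1 (wderiv T2 i f).
Proof.
move=> h2; have [lw ww] := H1_wderiv i (H2_H1 h2); split => // k.
move: h2 => [_ /(_ i)[g wg [lg /(_ k)[g' wg' lg']]]].
exists g' => //; apply: is_wderiv_ae wg'.
- by have /Leb2P[[]] := lw.
- by have /Leb2P[[]] := lg.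
- exact: wderiv_ae (Leb2_Leb1 lg) wg.
Qed.

Lemma H1B f g : H1 f -> H1 g -> H1 (fun x => f x - g x).
Proof.
move=> hf hg; split; first by apply: Leb2B; [case: hf|case: hg].
move=> i; have [lf wf] := H1_wderiv i hf; have [lg wg] := H1_wderiv i hg.
exists (fun x => wderiv T2 i f x - wderiv T2 i g x); last exact: Leb2B.
by apply: is_wderivB => //; [exact: H1_sqint|exact: H1_sqint_wderiv|exact: H1_sqint|exact: H1_sqint_wderiv].
Qed.

Lemma wderivB i f g : H1 f -> H1 g ->
  {ae mu, forall x, wderiv T2 i (fun x => f x - g x) x = wderiv T2 i f x - wderiv T2 i g x}.
Proof.
move=> hf hg; have [lf wf] := H1_wderiv i hf; have [lg wg] := H1_wderiv i hg.
apply: wderiv_ae; first exact/Leb2_Leb1/Leb2B.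
by apply: is_wderivB => //; [exact: H1_sqint|exact: H1_sqint_wderiv|exact: H1_sqint|exact: H1_sqint_wderiv].
Qed.

Lemma H2B f g : H2 f -> H2 g -> H2 (fun x => f x - g x).
Proof.
move=> hf hg; split; first by apply: Leb2B; [case: hf|case: hg].
move=> i; exists (fun x => wderiv T2 i f x - wderiv T2 i g x).
  have [_ wf] := H1_wderiv i (H2_H1 hf); have [_ wg] := H1_wderiv i (H2_H1 hg).
  have sf := H1_sqint (H2_H1 hf); have sg := H1_sqint (H2_H1 hg).
  by apply: is_wderivB => //; exact/H1_sqint/H2_wderiv.
exact: H1B (H2_wderiv i hf) (H2_wderiv i hg).
Qed.

Lemma inner_cvg h g (g_ : nat -> R * R -> R) : sqint mu h -> sqint mu g ->
  (forall n, sqint mu (g_ n)) ->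
  (forall e : R, 0 < e -> exists N0, forall N, (N0 <= N)%N -> \int[mu]_x ((g x - g_ N x) ^+ 2) <= e) ->
  inner h (g_ N) @[N --> \oo] --> inner h g.
Proof.
move=> sh sg sg_ cg; apply/cvgrPdist_le => /= e e0.
have K0 : 0 < inner h h + 1 by rewrite ltr_wpDl// inner_ge0.
have [N0 hN] := cg _ (divr_gt0 (exprn_gt0 2 e0) K0).
exists N0 => // N /= /hN h1; rewrite -innerBr//.
have h2 := inner_CS sh (sqintB sg (sg_ N)).
rewrite -(ler_pXn2r (n := 2)) ?nnegrE ?normr_ge0 ?(ltW e0)// real_normK ?num_real//.
apply: (le_trans h2).
under [X in _ * X]eq_Rintegral do rewrite -expr2.
apply: (@le_trans _ _ ((inner h h + 1) * \int[mu]_x ((g x - g_ N x) ^+ 2))).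
  apply: ler_wpM2r; last by rewrite lerDl.
  by apply: Rintegral_ge0 => x _; exact: sqr_ge0.
by rewrite mulrC -ler_pdivlMr.
Qed.

Lemma inner_fourier_cvg h g : sqint mu h -> sqint mu g ->
  inner h (fourier_sum N g) @[N --> \oo] --> inner h g.
Proof.
move=> sh sg; apply: inner_cvg => // [n|e e0].
  exact/sqint_trigpoly/trigpoly_fourier_sum.
exact: fourier_sum_cvg.
Qed.

(** For a partial sum of g the identity is the definition of f'; both sides
    pass to the limit because the partial sums of g and of g' converge in L^2. *)
Lemma weak_parts i f f' g g' : sqint mu f -> sqint mu f' -> sqint mu g -> sqint mu g' ->
  is_wderiv T2 i f f' -> is_wderiv T2 i g g' -> inner f' g = - inner f g'.
Proof.
move=> sf sf' sg sg' wf wg.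
have c1 := inner_fourier_cvg sf' sg.
have c2 : (- inner f (fourier_sum N g')) @[N --> \oo] --> - inner f g'.
  by apply: cvgN; exact: inner_fourier_cvg.
apply: (norm_cvg_unique c1); apply: cvg_trans c2; apply: near_eq_cvg; apply: nearW => N /=.
have tp := trigpoly_fourier_sum N g.
by rewrite -(partial_fourier_sum N sg wg) (wf _ (trigpoly_smooth tp) (trigpoly_periodic tp)) opprK.
Qed.

End WeakDerivatives.

(** * Boundedness of functions with two weak derivatives *)

Section SobolevBounded.
Context {R : realType}.
Notation plane := (measurableTypeR R * measurableTypeR R)%type.
Notation mu := (torus_measure (@T2 R)).
Implicit Types (f g h : R * R -> R) (i : 'I_2).
Local Notation inner f g := (\int[mu]_x (f x * g x)).
Local Notation kappa := ((2 * pi) ^+ 2 : R).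

(** With the bounded increasing function G(z) = z / (1 + |z|) every integer z
    satisfies 1 / (1 + z^2) <= 4 (G(z + 1) - G(z)), and the sum telescopes. *)
Lemma sum_inv_sqr_le N : \sum_(j < N.*2.+1) (1 + (frq j)%:~R ^+ 2)^-1 <= 8 :> R.
Proof.
pose G (z : int) : R := z%:~R / (1 + `|z%:~R|).
have Gn z : `|G z| <= 1.
  have h : 0 < 1 + `|z%:~R : R| by rewrite ltr_pwDl.
  by rewrite /G normrM normfV (gtr0_norm h) ler_pdivrMr// mul1r lerDr.
have step z : (1 + z%:~R ^+ 2)^-1 <= 4 * (G (z + 1) - G z).
  rewrite /G intrD; set t : R := z%:~R.
  have h : 0 < 1 + t ^+ 2 by rewrite ltr_pwDl// sqr_ge0.
  have [z0|z0] := leP 0 z.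
    have t0 : 0 <= t by rewrite /t ler0z.
    rewrite !ger0_norm ?addr_ge0//.
    have -> : 4 * ((t + 1) / (1 + (t + 1)) - t / (1 + t)) = 4 / ((1 + t) * (2 + t)).
      by field; apply/andP; split; rewrite gt_eqF//; lra.
    rewrite ler_pdivlMr; last by rewrite mulr_gt0//; lra.
    by rewrite mulrC ler_pdivrMr//; nra.
  have t1 : t <= -1 by rewrite /t -[-1]/((-1)%:~R) ler_int; lia.
  rewrite (ler0_norm (_ : t <= 0)) ?(ler0_norm (_ : t + 1 <= 0)); [|lra|lra].
  have -> : 4 * ((t + 1) / (1 - (t + 1)) - t / (1 - t)) = 4 / ((- t) * (1 - t)).
    have n1 : t != 0 by rewrite lt_eqF//; lra.
    have n2 : 1 - t != 0 by rewrite gt_eqF//; lra.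
    have n3 : 1 - (t + 1) != 0 by rewrite gt_eqF//; lra.
    by field; rewrite ?n1 ?n2 ?n3.
  rewrite ler_pdivlMr; last by rewrite mulr_gt0//; lra.
  by rewrite mulrC ler_pdivrMr//; nra.
apply: (@le_trans _ _ (\sum_(j < N.*2.+1) 4 * (G (frq j + 1) - G (frq j)))).
  by apply: ler_sum => j _; exact: step.
rewrite -mulr_sumr.
have -> : \sum_(j < N.*2.+1) (G (frq j + 1) - G (frq j)) = G (N.*2.+1%:Z - N%:Z) - G (0 - N%:Z).
  rewrite -(big_mkord xpredT (fun j => G (j%:Z - N%:Z + 1) - G (j%:Z - N%:Z))).
  rewrite -(telescope_sumr (fun j => G (j%:Z - N%:Z)))//.
  by apply: eq_bigr => j _; congr (G _ - _); rewrite intS; ring.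
have := Gn (N.*2.+1%:Z - N%:Z); have := Gn (0 - N%:Z).
by rewrite !ler_norml => /andP[? ?] /andP[? ?]; lra.
Qed.

(** The weight (1 + k^2) (1 + l^2) only involves f, its two first derivatives
    and the mixed second one, so Bessel's inequality bounds the weighted sum of
    the squared coefficients. The inverse weights are summable over all
    frequencies: the partial sums are bounded uniformly, and so is their L^2
    limit. *)
Lemma H2_bounded f : H2 f -> exists2 M : R, 0 <= M & {ae mu, forall x, `|f x| <= M}.
Proof.
move=> h2; have hf := H2_H1 h2; have sf := H1_sqint hf.
have [_ w0] := H1_wderiv 0 hf; have [_ w1] := H1_wderiv 1 hf.
set f0 := wderiv T2 0 f in w0; set f1 := wderiv T2 1 f in w1.
have hf0 : H1 f0 by exact: H2_wderiv.
have [_ w10] := H1_wderiv 1 hf0; set f10 := wderiv T2 1 f0 in w10.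
have s0 : sqint mu f0 by exact: H1_sqint.
have s1 : sqint mu f1 by exact: H1_sqint_wderiv.
have s10 : sqint mu f10 by exact: H1_sqint_wderiv.
pose Q := inner f f + inner f0 f0 + inner f1 f1 + inner f10 f10.
(* The sum of the inverse weights is at most 8 * 8, by sum_inv_sqr_le in each
   variable. *)
pose M := 2 * (Q + kappa^-1 * 64).
have bound N x : `|fourier_sum N f x| <= M.
  have ki : 0 < kappa^-1 :> R by rewrite invr_gt0 kappa_gt0.
  pose wt (p : 'I_(N.*2.+1) * 'I_(N.*2.+1)) : R := (1 + (frq p.1)%:~R ^+ 2) * (1 + (frq p.2)%:~R ^+ 2).
  have wt0 p : 0 < wt p by rewrite mulr_gt0// ltr_pwDl// sqr_ge0.
  have Sw : \sum_p kappa^-1 * (wt p * coef f p ^+ 2) <= Q.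
    have e0 : \sum_(p : 'I_(N.*2.+1) * 'I_(N.*2.+1)) kappa^-1 * ((frq p.1)%:~R ^+ 2 * coef f p ^+ 2) <= inner f0 f0.
      apply: le_trans (bessel N s0); rewrite (reindex_inj (inv_inj (flipiK (N := N) 0))).
      rewrite le_eqVlt; apply/orP; left; apply/eqP; apply: eq_bigr => p _.
      by rewrite (coef_wderiv p sf w0) /flipi /frqi /= frq_rev mulrNz !exprMn !sqrrN.
    have e1 : \sum_(p : 'I_(N.*2.+1) * 'I_(N.*2.+1)) kappa^-1 * ((frq p.2)%:~R ^+ 2 * coef f p ^+ 2) <= inner f1 f1.
      apply: le_trans (bessel N s1); rewrite (reindex_inj (inv_inj (flipiK (N := N) 1))).
      rewrite le_eqVlt; apply/orP; left; apply/eqP; apply: eq_bigr => p _.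
      by rewrite (coef_wderiv p sf w1) /flipi /frqi /= frq_rev mulrNz !exprMn !sqrrN.
    have e10 : \sum_(p : 'I_(N.*2.+1) * 'I_(N.*2.+1)) kappa^-1 * ((frq p.1)%:~R ^+ 2 * (frq p.2)%:~R ^+ 2 * coef f p ^+ 2) <= inner f10 f10.
      apply: le_trans (bessel N s10); rewrite (reindex_inj (inv_inj (flipiK (N := N) 1))).
      rewrite (reindex_inj (inv_inj (flipiK (N := N) 0))).
      rewrite le_eqVlt; apply/orP; left; apply/eqP; apply: eq_bigr => -[p1 p2] _.
      rewrite (coef_wderiv _ s0 w10) (coef_wderiv _ sf w0) /flipi /frqi /= !frq_rev !mulrNz.
      by rewrite !exprMn !sqrrN; ring.
    have e := bessel N sf.
    apply: le_trans (lerD (lerD (lerD e e0) e1) e10).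
    rewrite -!big_split/= le_eqVlt; apply/orP; left; apply/eqP; apply: eq_bigr => p _.
    by rewrite /wt; ring.
  have Si : \sum_p (wt p)^-1 <= 64.
    have -> : \sum_p (wt p)^-1 = (\sum_(j < N.*2.+1) (1 + (frq j)%:~R ^+ 2)^-1) ^+ 2.
      rewrite expr2 big_distrlr/= pair_bigA/=.
      by apply: eq_bigr => p _; rewrite /wt invfM.
    have h := sum_inv_sqr_le N.
    have h0 : 0 <= \sum_(j < N.*2.+1) (1 + (frq j)%:~R ^+ 2)^-1 :> R.
      by apply: sumr_ge0 => j _; rewrite invr_ge0 addr_ge0// sqr_ge0.
    by nra.
  apply: (le_trans (ler_norm_sum _ _ _)).
  (* A Hartley function is at most 4, and 4 c <= 2 (w c^2 + 1/w). *)
  apply: (@le_trans _ _ (\sum_p 2 * (kappa^-1 * (wt p * coef f p ^+ 2) + kappa^-1 * (wt p)^-1))).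
    apply: ler_sum => p _; rewrite normrM normrM (gtr0_norm ki).
    have hp : `|hart p x| <= 4.
      by rewrite /hart /hartley normrM (_ : 4 = 2 * 2 :> R); [rewrite ler_pM// cas_le2|ring].
    rewrite -mulrDr mulrCA -mulrA; apply: ler_wpM2l; first exact: ltW.
    apply: (@le_trans _ _ (`|coef f p| * 4)); first by rewrite ler_wpM2l.
    rewrite -(real_normK (num_real (coef f p))); set c := `|_|.
    rewrite -subr_ge0 (_ : _ - _ = 2 * (wt p)^-1 * (wt p * c - 1) ^+ 2).
      by rewrite mulr_ge0 ?sqr_ge0// mulr_ge0// invr_ge0 ltW.
    by field; rewrite gt_eqF.
  rewrite -mulr_sumr big_split/= -[X in _ + X]mulr_sumr /M.
  have h : kappa^-1 * (\sum_p (wt p)^-1) <= kappa^-1 * 64 by rewrite ler_wpM2l// ltW.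
  by move: Sw h; lra.
have M0 : 0 <= M by apply: le_trans (bound 0%N (0, 0)).
exists M => //.
(* The excess of |f| over M is at most the distance of f to its partial sums. *)
pose g x := Num.max (`|f x| - M) 0.
have [mf _] := sf.
have mg : measurable_fun [set: plane] (fun x => g x ^+ 2).
  apply: measurable_funX; apply: measurable_maxr => //.
  by apply: measurable_funB => //; exact: measurableT_comp.
have gN N x : g x ^+ 2 <= (f x - fourier_sum N f x) ^+ 2.
  rewrite -[leRHS]real_normK ?num_real// lerXn2r// ?nnegrE//.
    by rewrite /g le_max lexx orbT.
  rewrite /g ge_max normr_ge0 andbT.
  have := bound N x; have := ler_normB (f x - fourier_sum N f x) (- fourier_sum N f x).
  by rewrite opprK subrK normrN; lra.
have [_ i0] := sqintB sf (sqint_trigpoly (trigpoly_fourier_sum 0 f)).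
have gi : mu.-integrable setT (EFin \o (fun x => g x ^+ 2)).
  apply: (@le_integrable _ _ _ mu setT measurableT _ _ _ _ i0).
    exact/measurable_EFinP.
  by move=> x _ /=; rewrite lee_fin !ger0_norm ?sqr_ge0.
have g0 : \int[mu]_x (g x ^+ 2) = 0.
  apply/eqP; rewrite eq_le; apply/andP; split; last by apply: Rintegral_ge0 => x _; exact: sqr_ge0.
  apply/ler_addgt0Pl => e e0; rewrite addr0.
  have [N0 /(_ N0 (leqnn N0)) h] := fourier_sum_cvg sf e0.
  have [_ iN] := sqintB sf (sqint_trigpoly (trigpoly_fourier_sum N0 f)).
  by apply: le_trans h; apply: le_Rintegral.
apply: (ae_imply _ (Rintegral_ge0_eq0 gi _ g0)) => [x /eqP|x]; last exact: sqr_ge0.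
rewrite sqrf_eq0 /g => /eqP h; rewrite -subr_le0 -h.
by rewrite le_max lexx.
Qed.

Lemma sqint_ae_bounded_mul (M : R) f g : measurable_fun [set: plane] f ->
  {ae mu, forall x, `|f x| <= M} -> sqint mu g -> sqint mu (fun x => f x * g x).
Proof.
move=> mf fM sg; have [mg _] := sg.
pose f' x := Num.max (- M) (Num.min (f x) M).
have mf' : measurable_fun [set: plane] f'.
  by apply: measurable_maxr => //; apply: measurable_minr.
have f'M x : `|f' x| <= `|M|.
  rewrite /f' ler_norml; have [m0|m0] := leP 0 M.
    by rewrite ger0_norm// le_max lexx/= ge_max ge_min lexx orbT andbT; lra.
  rewrite ltr0_norm// opprK le_max ge_max; apply/andP; split; first by apply/orP; left; lra.
  by rewrite lexx/= ge_min; apply/orP; right; lra.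
apply: (@sqint_ae _ _ (fun x => f' x * g x)); first exact: measurable_funM.
  exact: (sqint_bounded_mul mf' f'M sg).
apply: (ae_imply _ fM) => x; rewrite ler_norml => /andP[h1 h2]; congr (_ * _).
by rewrite /f' (min_l h2) (max_r h1).
Qed.

End SobolevBounded.

(** * The energy balance at a fixed time *)

Lemma cvg_fin_sum (R : realType) (I : finType) (a_ : nat -> I -> R) (a : I -> R) :
  (forall i, a_ n i @[n --> \oo] --> a i) ->
  \sum_i a_ n i @[n --> \oo] --> \sum_i a i.
Proof.
move=> ca; elim: (index_enum I) => [|i r IH].
  by under eq_fun do rewrite big_nil; rewrite big_nil; exact: cvg_cst.
by under eq_fun do rewrite big_cons; rewrite big_cons; exact: cvgD.
Qed.

Section Fields.
Context {R : realType}.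
Notation plane := (measurableTypeR R * measurableTypeR R)%type.
Notation mu := (torus_measure (@T2 R)).
Implicit Types (u v w e m a b p : vfield R) (i j : 'I_2).
Local Notation inner f g := (\int[mu]_x (f x * g x)).

Definition L2field u := forall i, sqint mu (u i).

Lemma spaceH_L2 u : spaceH u -> L2field u.
Proof. by move=> [lu _ _] i; have /Leb2P[] := lu i. Qed.

Lemma spaceV_L2 u : spaceV u -> L2field u.
Proof. by move=> [/spaceH_L2]. Qed.

Lemma L2fieldB u v : L2field u -> L2field v -> L2field (u - v).
Proof. by move=> su sv i; exact: sqintB. Qed.

Lemma L2fieldD u v : L2field u -> L2field v -> L2field (u + v).
Proof. by move=> su sv i; exact: sqintD. Qed.

Lemma ipC u v : ip u v = ip v u.
Proof. by apply: eq_bigr => i _; exact: innerC. Qed.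

Lemma ipDl u v w : L2field u -> L2field v -> L2field w ->
  ip (u + v) w = ip u w + ip v w.
Proof.
by move=> su sv sw; rewrite /ip -big_split/=; apply: eq_bigr => i _; rewrite -innerDl.
Qed.

Lemma ipBl u v w : L2field u -> L2field v -> L2field w ->
  ip (u - v) w = ip u w - ip v w.
Proof.
by move=> su sv sw; rewrite /ip -sumrB; apply: eq_bigr => i _; rewrite -innerBl.
Qed.

Lemma ipBr u v w : L2field u -> L2field v -> L2field w ->
  ip w (u - v) = ip w u - ip w v.
Proof. by move=> su sv sw; rewrite ipC ipBl// !(ipC w). Qed.

Lemma ipDr u v w : L2field u -> L2field v -> L2field w ->
  ip w (u + v) = ip w u + ip w v.
Proof. by move=> su sv sw; rewrite ipC ipDl// !(ipC w). Qed.

Lemma L2fieldZ (c : R) u : L2field u -> L2field (fun i x => c * u i x).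
Proof. by move=> su i; exact: sqintZ. Qed.

Lemma ipZl (c : R) u w : L2field u -> L2field w -> ip (fun i x => c * u i x) w = c * ip u w.
Proof.
by move=> su sw; rewrite /ip mulr_sumr; apply: eq_bigr => i _; rewrite innerZl.
Qed.

Lemma ip_ge0 u : 0 <= ip u u.
Proof. by apply: sumr_ge0 => i _; exact: inner_ge0. Qed.

Lemma normH_sqr u : normH u ^+ 2 = ip u u.
Proof. by rewrite /normH sqr_sqrtr// ip_ge0. Qed.

Lemma normH_ge0 u : 0 <= normH u.
Proof. exact: sqrtr_ge0. Qed.

Lemma ip_le_normH u v : L2field u -> L2field v -> `|ip u v| <= normH u * normH v.
Proof.
move=> su sv; rewrite -(ler_pXn2r (n := 2)) ?nnegrE ?mulr_ge0 ?normH_ge0//.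
rewrite exprMn !normH_sqr real_normK ?num_real//.
apply: discriminant_le => [|t]; first exact: ip_ge0.
have := ip_ge0 (u + (fun i x => t * v i x)).
have st := L2fieldZ t sv.
rewrite ipDl// ?ipDr// ?ipZl// ?(ipC _ (fun i x => t * v i x)) ?ipZl//; try exact: L2fieldD.
by rewrite (ipC v u) => h; apply: le_trans h _; rewrite le_eqVlt; apply/orP; left; apply/eqP; ring.
Qed.

Lemma ip_ae u v w : L2field u -> L2field v -> L2field w -> field_eq u v -> ip u w = ip v w.
Proof.
move=> su sv sw uv; apply: eq_bigr => i _.
have [mu_ _] := su i; have [mv _] := sv i; have [mw _] := sw i.
apply: ae_eq_Rintegral; [exact: measurable_funM|exact: measurable_funM|].
by apply: (ae_imply _ (uv i)) => x ->.
Qed.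

Lemma spaceHB u v : spaceH u -> spaceH v -> spaceH (u - v).
Proof.
move=> hu hv; have su := spaceH_L2 hu; have sv := spaceH_L2 hv.
move: hu hv => [lu mu0 du] [lv mv0 dv]; split.
- by move=> i; exact: Leb2B.
- move=> i; rewrite [LHS](RintegralB measurableT (sqint_integrable (su i)) (sqint_integrable (sv i))).
  by rewrite mu0 mv0 subrr.
- move=> phi sphi tphi.
  have s1 i := sqint_smooth (smooth_partial i sphi) (torus_fun_partial i tphi).
  transitivity (\sum_i (inner (u i) (partial i phi) - inner (v i) (partial i phi))).
    by apply: eq_bigr => i _; rewrite -innerBl.
  by rewrite sumrB (du _ sphi tphi) (dv _ sphi tphi) subrr.
Qed.

Lemma spaceVB u v : spaceV u -> spaceV v -> spaceV (u - v).
Proof.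
by move=> [hu su] [hv sv]; split => [|i]; [exact: spaceHB|exact: (H1B (su i) (sv i))].
Qed.

Lemma domA_V u : domA u -> spaceV u.
Proof. by move=> [hu su]; split => // i; exact: (H2_H1 (su i)). Qed.

(** A test field in H does not see the projection. *)
Lemma leray_ip F G w : leray F G -> spaceH w -> ip G w = ip F w.
Proof.
move=> [lF hG h] hw; apply/eqP; rewrite eq_sym -subr_eq0.
have sF : L2field F by move=> i; have /Leb2P[] := lF i.
by rewrite -ipBl ?h//; exact: spaceH_L2.
Qed.

(** The bilinear form that polarizes normV^2. *)
Definition dirichlet u w : R :=
  \sum_j \sum_i inner (wderiv T2 i (u j)) (wderiv T2 i (w j)).

Lemma dirichlet_normV u : dirichlet u u = normV u ^+ 2.
Proof.
rewrite /normV sqr_sqrtr; first by do 2![apply: eq_bigr => ? _].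
by do 2![apply: sumr_ge0 => ? _]; apply: Rintegral_ge0 => x _; exact: sqr_ge0.
Qed.

Lemma dirichletBl u v w : spaceV u -> spaceV v -> spaceV w ->
  dirichlet (u - v) w = dirichlet u w - dirichlet v w.
Proof.
move=> [_ su] [_ sv] [_ sw]; rewrite /dirichlet -sumrB; apply: eq_bigr => j _.
rewrite -sumrB; apply: eq_bigr => i _.
have h1 := H1_sqint_wderiv i (su j); have h2 := H1_sqint_wderiv i (sv j).
have h3 := H1_sqint_wderiv i (sw j); have [m3 _] := h3.
have [m4 _] := H1_sqint_wderiv i (H1B (su j) (sv j)); have [m5 _] := sqintB h1 h2.
rewrite -innerBl//; apply: ae_eq_Rintegral; [exact: measurable_funM|exact: measurable_funM|].
by apply: (ae_imply _ (wderivB i (su j) (sv j))) => x ->.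
Qed.

Lemma normV_ge0 u : 0 <= normV u.
Proof. exact: sqrtr_ge0. Qed.

(** Testing with w removes the projection, and integration by parts moves one
    derivative. *)
Lemma stokes_ip u a w : stokes u a -> spaceV w -> ip a w = dirichlet u w.
Proof.
move=> [[hu h2] la] [hw w1]; rewrite (leray_ip la hw).
have sD i j : sqint mu (wderiv T2 i (wderiv T2 i (u j))).
  by apply: H1_sqint_wderiv; exact: (H2_wderiv i (h2 j)).
apply: eq_bigr => j _; have sw := H1_sqint (w1 j).
have -> : inner ((- laplacian u) j) (w j) = - inner (laplacian u j) (w j).
  by rewrite -innerNl//; exact: sqint_sum.
rewrite /laplacian inner_suml// -sumrN; apply: eq_bigr => i _.
have hD := H2_wderiv i (h2 j).
have [_ wd] := H1_wderiv i hD; have [_ ww] := H1_wderiv i (w1 j).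
by rewrite (weak_parts (H1_sqint hD) (sD i j) sw (H1_sqint_wderiv i (w1 j)) wd ww) opprK.
Qed.

(** The form b(u, v, w) as a double sum of integrals, on which linearity and
    integration by parts act term by term. *)
Definition convect u v w : R :=
  \sum_j \sum_i inner (fun x => u i x * wderiv T2 i (v j) x) (w j).

Lemma sqint_convect u v i j : domA u -> spaceV v ->
  sqint mu (fun x => u i x * wderiv T2 i (v j) x).
Proof.
move=> [hu u2] [_ v1]; have [M _ uM] := H2_bounded (u2 i).
have [mui _] := spaceH_L2 hu i.
exact: (sqint_ae_bounded_mul mui uM (H1_sqint_wderiv i (v1 j))).
Qed.

Lemma ip_advection u v w : domA u -> spaceV v -> L2field w ->
  ip (advection u v) w = convect u v w.
Proof.
move=> du dv sw; apply: eq_bigr => j _.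
by rewrite /advection inner_suml// => i; exact: sqint_convect.
Qed.

Lemma trilinear_convect u v w : domA u -> spaceV v -> L2field w ->
  trilinear u v w = convect u v w.
Proof.
move=> du dv sw; rewrite -ip_advection// /trilinear /ip.
have sA j : sqint mu (advection u v j) by apply: sqint_sum => i; exact: sqint_convect.
by rewrite Rintegral_sum// => j; exact: integrable_mulr_sqint.
Qed.

(** Add and subtract b(v, u, v - u). *)
Lemma convectBB u v : domA u -> domA v ->
  convect v v (v - u) - convect u u (v - u) =
  convect (v - u) u (v - u) + convect v (v - u) (v - u).
Proof.
move=> du dv; have Vu := domA_V du; have Vv := domA_V dv; have Ve := spaceVB Vv Vu.
have se := spaceV_L2 Ve.
pose X a b j i : R := inner (fun x => a i x * wderiv T2 i (b j) x) ((v - u) j).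
suff H j i : X v v j i - X u u j i = X (v - u) u j i + X v (v - u) j i.
  transitivity (\sum_j \sum_i (X v v j i - X u u j i)).
    by under [RHS]eq_bigr do rewrite sumrB; rewrite sumrB.
  under eq_bigr do under eq_bigr do rewrite H.
  by under eq_bigr do rewrite big_split; rewrite big_split.
rewrite /X.
have suu := sqint_convect i j du Vu; have svv := sqint_convect i j dv Vv.
have sve := sqint_convect i j dv Ve; have svu := sqint_convect i j dv Vu.
have -> : inner (fun x => (v - u) i x * wderiv T2 i (u j) x) ((v - u) j) =
    inner (fun x => v i x * wderiv T2 i (u j) x) ((v - u) j) -
    inner (fun x => u i x * wderiv T2 i (u j) x) ((v - u) j).
  by rewrite -innerBl//; apply: eq_Rintegral => x _; rewrite -mulrBl.
have -> : inner (fun x => v i x * wderiv T2 i ((v - u) j) x) ((v - u) j) =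
    inner (fun x => v i x * wderiv T2 i (v j) x) ((v - u) j) -
    inner (fun x => v i x * wderiv T2 i (u j) x) ((v - u) j).
  rewrite -innerBl//; have [me _] := se j.
  have [m1 _] := sve; have [m2 _] := sqintB svv svu.
  apply: ae_eq_Rintegral; [exact: measurable_funM|exact: measurable_funM|].
  by apply: (ae_imply _ (wderivB i (Vv.2 j) (Vu.2 j))) => x; rewrite -mulrBr => <-.
by rewrite [RHS]addrC addrA subrK.
Qed.

(** Weak incompressibility of v is tested with the product S_M S_N of two
    partial sums of a component of e. As N and then M tend to infinity, the two
    terms of the product rule both tend to b(v, e, e), so 2 b(v, e, e) = 0. As
    v is bounded, each limit is that of an L^2 convergent sequence tested with
    a fixed L^2 function. *)
Lemma convect_antisym v e : domA v -> spaceV e -> convect v e e = 0.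
Proof.
move=> dv Ve; have [[hv v2] [_ e1]] := (dv, Ve); have se := spaceV_L2 Ve.
have sv := spaceH_L2 hv.
rewrite /convect big1// => j _.
have sd i := H1_sqint_wderiv i (e1 j).
have wd i : is_wderiv T2 i (e j) (wderiv T2 i (e j)) by have [] := H1_wderiv i (e1 j).
pose S N := fourier_sum N (e j).
have tS N : trigpoly (S N) := trigpoly_fourier_sum N (e j).
have svb i g : sqint mu g -> sqint mu (fun x => v i x * g x).
  move=> sg; have [M _ vM] := H2_bounded (v2 i); have [mv _] := sv i.
  exact: (sqint_ae_bounded_mul mv vM sg).
have svt i q : trigpoly q -> sqint mu (fun x => v i x * q x).
  by move=> tp; apply: svb; exact: sqint_trigpoly.
(* The test function is the product of two partial sums. *)
have eqMN M N : \sum_i (inner (fun x => v i x * S M x) (fourier_sum N (wderiv T2 i (e j)))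
     + inner (fun x => v i x * fourier_sum M (wderiv T2 i (e j)) x) (S N)) = 0.
  have [_ _ /(_ _ (trigpoly_smooth (trigpolyM (tS M) (tS N))) (trigpoly_periodic (trigpolyM (tS M) (tS N)))) d0] := hv.
  rewrite -[RHS]d0; apply: eq_bigr => i _.
  rewrite partialM// /S (partial_fourier_sum M (se j) (wd i)) (partial_fourier_sum N (se j) (wd i)).
  have i1 := integrable_mulr_sqint (svt i _ (tS M)) (sqint_trigpoly (trigpoly_fourier_sum N (wderiv T2 i (e j)))).
  have i2 := integrable_mulr_sqint (svt i _ (trigpoly_fourier_sum M (wderiv T2 i (e j)))) (sqint_trigpoly (tS N)).
  rewrite -(RintegralD measurableT i1 i2); apply: eq_Rintegral => x _.
  by rewrite /S; ring.
have eqM M : \sum_i (inner (fun x => v i x * wderiv T2 i (e j) x) (S M)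
     + inner (fun x => v i x * e j x) (fourier_sum M (wderiv T2 i (e j)))) = 0.
  have c : \sum_i (inner (fun x => v i x * S M x) (fourier_sum N (wderiv T2 i (e j)))
     + inner (fun x => v i x * fourier_sum M (wderiv T2 i (e j)) x) (S N)) @[N --> \oo] -->
     \sum_i (inner (fun x => v i x * wderiv T2 i (e j) x) (S M)
     + inner (fun x => v i x * e j x) (fourier_sum M (wderiv T2 i (e j)))).
    apply: cvg_fin_sum => i; apply: cvgD.
    - have -> : inner (fun x => v i x * wderiv T2 i (e j) x) (S M) =
        inner (fun x => v i x * S M x) (wderiv T2 i (e j)).
        by apply: eq_Rintegral => x _; ring.
      by apply: inner_fourier_cvg => //; exact: svt.
    - have -> : inner (fun x => v i x * e j x) (fourier_sum M (wderiv T2 i (e j))) =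
        inner (fun x => v i x * fourier_sum M (wderiv T2 i (e j)) x) (e j).
        by apply: eq_Rintegral => x _; ring.
      by apply: inner_fourier_cvg => //; apply: svt; exact: trigpoly_fourier_sum.
  apply: (norm_cvg_unique c); rewrite (_ : (fun N => _) = cst 0); first exact: cvg_cst.
  by apply/funext => N; exact: eqMN.
have c : \sum_i (inner (fun x => v i x * wderiv T2 i (e j) x) (S M)
     + inner (fun x => v i x * e j x) (fourier_sum M (wderiv T2 i (e j)))) @[M --> \oo] -->
     \sum_i (inner (fun x => v i x * wderiv T2 i (e j) x) (e j)
     + inner (fun x => v i x * wderiv T2 i (e j) x) (e j)).
  apply: cvg_fin_sum => i; apply: cvgD.
  - by apply: inner_fourier_cvg => //; exact: svb.
  - have -> : inner (fun x => v i x * wderiv T2 i (e j) x) (e j) =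
        inner (fun x => v i x * e j x) (wderiv T2 i (e j)).
      by apply: eq_Rintegral => x _; ring.
    by apply: inner_fourier_cvg => //; exact: svb.
have : \sum_i (inner (fun x => v i x * wderiv T2 i (e j) x) (e j)
     + inner (fun x => v i x * wderiv T2 i (e j) x) (e j)) = 0.
  apply: (norm_cvg_unique c); rewrite (_ : (fun M => _) = cst 0); first exact: cvg_cst.
  by apply/funext => M; exact: eqM.
by rewrite big_split/= => h; lra.
Qed.

Lemma convect_cancel u v : domA u -> domA v ->
  convect v v (v - u) - convect u u (v - u) = convect (v - u) u (v - u).
Proof.
move=> du dv; rewrite convectBB//.
by rewrite [X in _ + X](convect_antisym dv (spaceVB (domA_V dv) (domA_V du))) addr0.
Qed.

Lemma leray_L2 F G : leray F G -> L2field F /\ L2field G.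
Proof. by move=> [lF /spaceH_L2 sG _]; split => // i; have /Leb2P[] := lF i. Qed.

(** Pointwise, (e . m) m . e is the square of e . m. *)
Lemma ip_nudging m e p : spaceH e -> leray (fun j x => dot e m x * m j x) p ->
  ip p e = sqL2 (dot e m).
Proof.
move=> he lp; rewrite (leray_ip lp he); have [sF _] := leray_L2 lp.
have se := spaceH_L2 he.
rewrite /ip -Rintegral_sum; last by move=> j; exact: integrable_mulr_sqint.
apply: eq_Rintegral => x _.
have -> : dot e m x ^+ 2 = \sum_j dot e m x * (e j x * m j x) by rewrite -mulr_sumr expr2.
by apply: eq_bigr => j _; rewrite -mulrA (mulrC (m j x)).
Qed.

(** Subtract the two equations and test with v - u. In the convective terms
    b(v, v - u, v - u) vanishes, so that only b(v - u, u, v - u) is left. *)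
Lemma energy_identity (nu lam : R) f m u v ut vt au bu av bv p :
  spaceH f -> spaceH ut -> spaceH vt ->
  stokes u au -> bilinearB u u bu ->
  field_eq (fun j x => ut j x + nu * au j x + bu j x) f ->
  stokes v av -> bilinearB v v bv ->
  leray (fun j x => dot (v - u) m x * m j x) p ->
  field_eq (fun j x => vt j x + nu * av j x + bv j x) (fun j x => f j x - lam * p j x) ->
  ip (vt - ut) (v - u) =
  - nu * normV (v - u) ^+ 2 - trilinear (v - u) u (v - u) - lam * sqL2 (dot (v - u) m).
Proof.
move=> hf hut hvt Au Bu eu Av Bv lp ev.
have alg (x1 x2 x3 c1 c2 d1 d2 s : R) : x1 + nu * d1 + c1 = x3 ->
    x2 + nu * d2 + c2 = x3 - lam * s ->
    x2 - x1 = - nu * (d2 - d1) - (c2 - c1) - lam * s.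
  by move=> h1 h2; lra.
have [du lau] := Au; have [dv lav] := Av.
have Vu := domA_V du; have Vv := domA_V dv; have Ve := spaceVB Vv Vu.
have de : domA (v - u).
  split; first by case: Ve.
  move=> i; exact: (H2B (dv.2 i) (du.2 i)).
have se := spaceV_L2 Ve; have [he _] := Ve.
have [_ sau] := leray_L2 lau; have [_ sav] := leray_L2 lav.
have [_ sbu] := leray_L2 Bu; have [_ sbv] := leray_L2 Bv; have [_ sp] := leray_L2 lp.
have sut := spaceH_L2 hut; have svt := spaceH_L2 hvt; have sf := spaceH_L2 hf.
have snau := L2fieldZ nu sau; have snav := L2fieldZ nu sav; have slp := L2fieldZ lam sp.
have E1 : ip ut (v - u) + nu * dirichlet u (v - u) + convect u u (v - u) = ip f (v - u).
  have h := ip_ae (L2fieldD (L2fieldD sut snau) sbu) sf se eu.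
  rewrite -h ipDl//; last exact: L2fieldD.
  by rewrite ipDl// ipZl// (stokes_ip Au Ve) (leray_ip Bu he) ip_advection.
have E2 : ip vt (v - u) + nu * dirichlet v (v - u) + convect v v (v - u) =
    ip f (v - u) - lam * sqL2 (dot (v - u) m).
  have h := ip_ae (L2fieldD (L2fieldD svt snav) sbv) (L2fieldB sf slp) se ev.
  have h2 : ip (f - (fun i x => lam * p i x)) (v - u) = ip f (v - u) - lam * sqL2 (dot (v - u) m).
    by rewrite ipBl// ipZl// (ip_nudging he lp).
  rewrite -h2 -h ipDl//; last exact: L2fieldD.
  by rewrite ipDl// ipZl// (stokes_ip Av Ve) (leray_ip Bv he) ip_advection.
rewrite ipBl// -dirichlet_normV {1}dirichletBl// trilinear_convect//.
rewrite -(convect_cancel du dv); exact: alg E1 E2.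
Qed.

End Fields.

(** * Smooth steps on the line *)

Section FlatFunctions.
Context {R : realType}.
Implicit Types (p : {poly R}) (f g : R -> R) (x t : R).

(** Functions p(1/x) exp(-1/x) extended by 0. The whole family, indexed by p,
    is stable under differentiation, which proves smoothness by induction on
    the order. *)
Definition flat p x : R := if 0 < x then p.[x^-1] * expR (- x^-1) else 0.

(** With y = 1/x, the derivative of p(y) exp(-y) in x is y^2 (p(y) - p'(y))
    exp(-y). *)
Definition flat_deriv p : {poly R} := 'X^2 * (p - p^`()).

(** The quadratic bound makes flat p differentiable at 0 with derivative 0. *)
Lemma flat_le p : exists2 C : R, 0 <= C & forall x, 0 < x <= 1 -> `|flat p x| <= C * x ^+ 2.
Proof.
pose n := size p; pose C0 : R := \sum_(i < n) `|p`_i|.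
(* The factorial comes from exp y >= y^(n + 2) / (n + 2)! at y = 1/x. *)
exists (C0 * (n.+2)`!%:R); first by rewrite mulr_ge0// sumr_ge0.
move=> x /andP[x0 x1]; rewrite /flat x0; set y := x^-1.
have y1 : 1 <= y by rewrite /y invf_ge1.
have y0 : 0 < y by exact: lt_le_trans y1.
rewrite normrM (gtr0_norm (expR_gt0 _)).
have hp : `|p.[y]| <= C0 * y ^+ n.
  rewrite horner_coef mulr_suml; apply: (le_trans (ler_norm_sum _ _ _)).
  apply: ler_sum => i _; rewrite normrM (ger0_norm (exprn_ge0 _ (ltW y0))).
  by apply: ler_wpM2l => //; apply: ler_weXn2l => //; apply: ltnW.
have he : expR (- y) <= (n.+2)`!%:R / y ^+ n.+2.
  rewrite expRN -[leRHS]invrK lef_pV2 ?posrE ?expR_gt0//; last first.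
    by rewrite invr_gt0 divr_gt0// ?exprn_gt0// ltr0n fact_gt0.
  rewrite invf_div; apply: le_trans (expR_ge1Dxn n.+1 (ltW y0)).
  by rewrite lerDr.
apply: (@le_trans _ _ (C0 * y ^+ n * ((n.+2)`!%:R / y ^+ n.+2))).
  by apply: ler_pM => //; exact: expR_ge0.
rewrite (_ : x = y^-1); last by rewrite invrK.
rewrite le_eqVlt; apply/orP; left; apply/eqP.
have yn : y ^+ n != 0 by rewrite expf_neq0// gt_eqF.
by rewrite -[n.+2]addn2 exprD; field; rewrite yn gt_eqF.
Qed.

Lemma is_derive_flat p x : is_derive x 1 (flat p) (flat (flat_deriv p) x).
Proof.
have [x0|x0|->] := ltgtP x 0.
- apply: (@near_eq_is_derive _ _ _ (cst 0)).
    near=> y; rewrite /flat ltNge; case: ifPn => // /negP[]; apply: ltW.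
    by near: y; exact: lt_nbhsl.
  by rewrite /flat (lt_gtF x0); exact: is_derive_cst.
- apply: (@near_eq_is_derive _ _ _ (fun y : R => p.[y^-1] * expR (- y^-1))).
    near=> y; rewrite /flat ifT//.
    by near: y; exact: lt_nbhsr.
  have dV : is_derive x 1 (fun y : R => y^-1) (- x ^- 2).
    have := @is_deriveV R id x 1 1 (lt0r_neq0 x0) (is_derive_id x 1).
    by rewrite /GRing.scale /= mulr1.
  have dp : is_derive x^-1 1 (horner p) (p^`()).[x^-1].
    by split; [exact: derivable_horner|rewrite -derive1E derivE].
  have d1 := is_derive1_comp dp dV.
  have d2 := is_derive1_comp (is_derive_expR _) (is_deriveN dV).
  have := is_deriveM d1 d2; rewrite /flat x0 /flat_deriv /GRing.scale /=.
  rewrite (_ : _ + _ = ('X^2 * (p - p^`())).[x^-1] * expR (- x^-1))//.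
  rewrite hornerM hornerXn hornerD hornerN /= exprVn; ring.
- have [C C0 hC] := flat_le p.
  have C1 : 0 < C + 1 by lra.
  have c : (fun h : R => h^-1 *: ((flat p \o shift 0) (h *: (1 : R)) - flat p 0)) @ 0^' --> (0 : R).
    apply/cvgr0Pnorm_le => e e0; near=> h.
    have hC1 : `|h| < e / (C + 1) by near: h; apply: dnbhs0_lt; rewrite divr_gt0.
    have hl1 : `|h| < 1 by near: h; exact: dnbhs0_lt.
    rewrite /= addr0 {2}/flat ltxx subr0 /GRing.scale /= mulr1 normrM normfV.
    have [h0|h0] := leP h 0; first by rewrite /flat ltNge h0 normr0 mulr0 ltW.
    rewrite (gtr0_norm h0) in hC1 hl1; have h1 := ltW hl1.
    have := hC h; rewrite h0 h1 => /(_ isT) H.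
    rewrite (gtr0_norm h0) ler_pdivrMl//; apply: (le_trans H).
    rewrite expr2 mulrA mulrC; apply: ler_wpM2l; first exact: ltW.
    apply: (@le_trans _ _ ((C + 1) * h)); first by apply: ler_wpM2r; [exact: ltW|lra].
    by rewrite mulrC -ler_pdivlMr// ltW.
  rewrite {2}/flat ltxx.
  by split; [apply: cvgP c|rewrite /derive; apply: cvg_lim c].
Unshelve. all: by end_near. Qed.

Definition smooth_line f := forall l t, derivable (derive1n l f) t 1.

Lemma smooth_lineI f f' : (forall t, is_derive t 1 f (f' t)) -> smooth_line f' -> smooth_line f.
Proof.
move=> df sf' [|l] t; first by apply: ex_derive; exact: df.
rewrite derive1Sn (_ : derive1 f = f'); first exact: sf'.
by apply/funext => x; rewrite derive1E (@derive_val _ _ _ _ _ _ _ (df x)).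
Qed.

Lemma smooth_line_affine f (a b : R) : smooth_line f -> smooth_line (fun t => f (a * t + b)).
Proof.
move=> sf; have h l : derive1n l (fun t => f (a * t + b)) = (fun t => a ^+ l * derive1n l f (a * t + b)) /\
    forall t, derivable (fun t => a ^+ l * derive1n l f (a * t + b)) t 1.
  have D k t : is_derive t 1 (fun t => a ^+ k * derive1n k f (a * t + b)) (a ^+ k.+1 * derive1n k.+1 f (a * t + b)).
    have da : is_derive t 1 (fun t : R => a * t + b) a.
      have := is_deriveD (is_deriveZ a (is_derive_id t (1 : R))) (is_derive_cst b t (1 : R)).
      by rewrite addr0 /GRing.scale /= mulr1.
    have dg : is_derive (a * t + b) 1 (derive1n k f) (derive1n k.+1 f (a * t + b)).
      by split; [exact: sf|rewrite derive1nS derive1E].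
    have := is_deriveZ (a ^+ k) (is_derive1_comp (g := fun t => a * t + b) dg da).
    have E (X : R) : a ^+ k *: (X * a) = a ^+ k.+1 * X.
      by rewrite exprSr /GRing.scale /=; ring.
    by rewrite E.
  split; last by move=> t; apply: ex_derive; exact: D.
  elim: l => [|l IH]; first by apply/funext => t; rewrite expr0 mul1r.
  rewrite derive1nS IH; apply/funext => t.
  by rewrite derive1E (@derive_val _ _ _ _ _ _ _ (D l t)).
by move=> l t; have [-> H] := h l; exact: H.
Qed.

Lemma smooth_lineB f g : smooth_line f -> smooth_line g -> smooth_line (fun t => f t - g t).
Proof.
move=> sf sg; have h l : derive1n l (fun t => f t - g t) = fun t => derive1n l f t - derive1n l g t.
  elim: l => // l IH; rewrite !derive1nS IH; apply/funext => t.
  by rewrite !derive1E deriveB.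
by move=> l t; rewrite h; apply: derivableB; [exact: sf|exact: sg].
Qed.

(** A family containing the bump below and stable under differentiation. *)
Inductive bump_class : (R -> R) -> Prop :=
| bump_prod (a : R) p q : bump_class (fun t => a * (flat p t * flat q (1 - t)))
| bump_add f g : bump_class f -> bump_class g -> bump_class (fun t => f t + g t).

Lemma bump_class_derive f : bump_class f ->
  exists2 f', bump_class f' & forall t, is_derive t 1 f (f' t).
Proof.
elim=> [a p q|g h _ [g' bg dg] _ [h' bh dh]]; last first.
  exists (fun t => g' t + h' t); first exact: bump_add.
  by move=> t; exact: is_deriveD.
exists (fun t => a * (flat (flat_deriv p) t * flat q (1 - t))
  + (- a) * (flat p t * flat (flat_deriv q) (1 - t))).
  by apply: bump_add; exact: bump_prod.
move=> t; have d1 := is_derive_flat p t.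
have da : is_derive t 1 (fun t : R => 1 - t) (-1).
  have := is_deriveB (is_derive_cst (1 : R) t (1 : R)) (is_derive_id t (1 : R)).
  by rewrite sub0r.
have d2 := is_derive1_comp (g := fun t => 1 - t) (is_derive_flat q (1 - t)) da.
have := is_deriveZ a (is_deriveM d1 d2); rewrite /GRing.scale /= mulrN1.
have E : a * (flat p t * - flat (flat_deriv q) (1 - t) + flat q (1 - t) * flat (flat_deriv p) t) =
    a * (flat (flat_deriv p) t * flat q (1 - t)) + - a * (flat p t * flat (flat_deriv q) (1 - t)) by ring.
by rewrite E.
Qed.

Lemma bump_class_smooth f : bump_class f -> smooth_line f.
Proof.
move=> bf l; elim: l f bf => [|l IH] f /bump_class_derive[f' bf' df] t.
  by apply: ex_derive; exact: df.
rewrite derive1Sn (_ : derive1 f = f'); first exact: IH.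
by apply/funext => x; rewrite derive1E (@derive_val _ _ _ _ _ _ _ (df x)).
Qed.

(** The factor 1 puts the bump in bump_class as it stands. *)
Definition smooth_bump : R -> R := fun t => 1 * (flat 1 t * flat 1 (1 - t)).

Lemma bump_class_smooth_bump : bump_class smooth_bump.
Proof. exact: bump_prod. Qed.

Lemma derivable_continuous f f' : (forall t, is_derive t 1 f (f' t)) -> continuous f.
Proof.
move=> df t; apply/differentiable_continuous/derivable1_diffP.
by apply: ex_derive; exact: df.
Qed.

Lemma continuous_smooth_bump : continuous smooth_bump.
Proof. by have [f' _ df] := bump_class_derive bump_class_smooth_bump; exact: derivable_continuous df. Qed.

Lemma flat1_ge0 t : 0 <= flat 1 t.
Proof. by rewrite /flat; case: ifP => // _; rewrite hornerC mul1r expR_ge0. Qed.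

Lemma bump_ge0 t : 0 <= smooth_bump t.
Proof. by rewrite /smooth_bump mul1r mulr_ge0// flat1_ge0. Qed.

Lemma bump_gt0 t : 0 < t < 1 -> 0 < smooth_bump t.
Proof.
move=> /andP[t0 t1]; rewrite /smooth_bump mul1r /flat t0 subr_gt0 t1 !hornerC !mul1r.
by rewrite mulr_gt0// expR_gt0.
Qed.

Lemma bump_le0 t : t <= 0 -> smooth_bump t = 0.
Proof. by move=> t0; rewrite /smooth_bump /flat ltNge t0 mul0r mulr0. Qed.

Lemma bump_ge1 t : 1 <= t -> smooth_bump t = 0.
Proof. by move=> t1; rewrite /smooth_bump [flat 1 (1 - t)]/flat subr_gt0 ltNge t1 !mulr0. Qed.

Notation lam := (@lebesgue_measure R).

Lemma integrable_smooth_bump (D : set (measurableTypeR R)) : measurable D -> lam.-integrable D (EFin \o smooth_bump).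
Proof.
move=> mD; apply: (@integrableS _ _ _ _ setT) => //.
have -> : EFin \o smooth_bump = (EFin \o smooth_bump) \_ `[0, 1].
  apply/funext => t; rewrite patchE; case: ifPn => // /negP.
  rewrite inE /= in_itv/= => h; congr EFin.
  have [t0|t0] := leP t 0; first exact: bump_le0.
  have [t1|t1] := leP 1 t; first exact: bump_ge1.
  by exfalso; apply: h; rewrite (ltW t0) (ltW t1).
rewrite -integrable_mkcond//; apply: continuous_compact_integrable; first exact: segment_compact.
by apply: continuous_subspaceT; exact: continuous_smooth_bump.
Qed.

Definition bump_primitive (t : R) : R := \int[lam]_(s in `]-oo, t]) smooth_bump s.

Lemma is_derive_bump_primitive t : is_derive t 1 bump_primitive (smooth_bump t).
Proof.
have tu : t < t + 1 by lra.
have mD : measurable (`]-oo, t + 1] : set (measurableTypeR R)) by exact: measurable_itv.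
have H := continuous_FTC1 tu (integrable_smooth_bump mD).
have [d e] := H (ltNyr t) (@continuous_smooth_bump t).
by split => //; rewrite -derive1E.
Qed.

Lemma mvt_bump_primitive (a b : R) : a < b -> exists2 c, a < c < b &
  bump_primitive b - bump_primitive a = smooth_bump c * (b - a).
Proof.
move=> ab; have [] := @MVT R bump_primitive smooth_bump a b ab.
- by move=> x _; exact: is_derive_bump_primitive.
- by apply: continuous_subspaceT; apply: derivable_continuous => t; exact: is_derive_bump_primitive.
by move=> c; rewrite in_itv /= => cab e; exists c.
Qed.

Lemma bump_primitive_nd (a b : R) : a <= b -> bump_primitive a <= bump_primitive b.
Proof.
rewrite le_eqVlt => /predU1P[->//|ab]; have [c _ e] := mvt_bump_primitive ab.
by rewrite -subr_ge0 e mulr_ge0 ?bump_ge0// subr_ge0 ltW.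
Qed.

Lemma bump_primitive_le0 t : t <= 0 -> bump_primitive t = 0.
Proof.
move=> t0; rewrite /bump_primitive (@eq_Rintegral _ _ _ lam _ (cst 0)).
  by rewrite Rintegral_cst ?mul0r//; exact: measurable_itv.
move=> s; rewrite inE /= in_itv /= => st; apply: bump_le0; exact: le_trans st t0.
Qed.

Lemma bump_primitive_ge1 t : 1 <= t -> bump_primitive t = bump_primitive 1.
Proof.
rewrite le_eqVlt => /predU1P[->//|t1]; have [c /andP[c1 _] e] := mvt_bump_primitive t1.
by apply/eqP; rewrite -subr_eq0 e bump_ge1 ?mul0r// ltW.
Qed.

Lemma bump_primitive1_gt0 : 0 < bump_primitive 1.
Proof.
have [c /andP[c0 c1] e] := mvt_bump_primitive (@ltr01 R).
move: e; rewrite (bump_primitive_le0 (lexx 0)) !subr0 mulr1 => ->.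
by rewrite bump_gt0// c0.
Qed.

Definition smooth_step (t : R) : R := (bump_primitive 1)^-1 * bump_primitive t.

Lemma smooth_step_ge0_le1 t : 0 <= smooth_step t <= 1.
Proof.
have c0 := bump_primitive1_gt0; rewrite /smooth_step; apply/andP; split.
  rewrite mulr_ge0 ?invr_ge0 ?(ltW c0)//.
  have [t0|t0] := leP t 0; first by rewrite bump_primitive_le0.
  by rewrite -(bump_primitive_le0 (lexx 0)) bump_primitive_nd// ltW.
rewrite mulrC ler_pdivrMr// mul1r.
have [t1|t1] := leP 1 t; first by rewrite bump_primitive_ge1.
by rewrite bump_primitive_nd// ltW.
Qed.

Lemma smooth_step_le0 t : t <= 0 -> smooth_step t = 0.
Proof. by move=> t0; rewrite /smooth_step (bump_primitive_le0 t0) mulr0. Qed.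

Lemma smooth_step_ge1 t : 1 <= t -> smooth_step t = 1.
Proof.
by move=> t0; rewrite /smooth_step bump_primitive_ge1// mulVf// gt_eqF// bump_primitive1_gt0.
Qed.

Lemma is_derive_smooth_step t : is_derive t 1 smooth_step ((bump_primitive 1)^-1 * smooth_bump t).
Proof. by have := is_deriveZ ((bump_primitive 1)^-1) (is_derive_bump_primitive t). Qed.

Lemma smooth_line_step : smooth_line smooth_step.
Proof.
apply: (smooth_lineI is_derive_smooth_step); apply: bump_class_smooth.
rewrite (_ : (fun t => _) = (fun t => (bump_primitive 1)^-1 * (flat 1 t * flat 1 (1 - t)))).
  exact: bump_prod.
by apply/funext => t; rewrite /smooth_bump mul1r.
Qed.

End FlatFunctions.

(** * Distributional derivatives in time *)

Section WeakFTC.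
Context {R : realType}.
Implicit Types (g k : R -> R) (s r t T : R).
Local Notation lam := (@lebesgue_measure R).

Lemma within_integrable g (a b c d : R) : a <= c -> d <= b ->
  {within `[a, b], continuous g} -> lam.-integrable `]c, d[ (EFin \o g).
Proof.
move=> ac db cg; apply: (@integrableS _ _ _ lam `[a, b]); [exact: measurable_itv|exact: measurable_itv| |].
  by move=> t /=; rewrite !in_itv /= => /andP[? ?]; apply/andP; split; lra.
by apply: continuous_compact_integrable => //; exact: segment_compact.
Qed.

(** The derivative of smooth_step (n.+1 (t - s)): a unit mass on ]s, s + 1/(n +
    1)[. *)
Definition mollifier (n : nat) s t : R :=
  n.+1%:R * ((bump_primitive 1)^-1 * smooth_bump (n.+1%:R * (t - s))).

Lemma is_derive_step_affine n s t :
  is_derive t 1 (fun t => smooth_step (n.+1%:R * (t - s))) (mollifier n s t).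
Proof.
have da : is_derive t 1 (fun t : R => n.+1%:R * (t - s)) n.+1%:R.
  have := is_deriveZ n.+1%:R (is_deriveB (is_derive_id t (1 : R)) (is_derive_cst s t (1 : R))).
  by rewrite subr0 /GRing.scale /= mulr1.
have := is_derive1_comp (g := fun t => n.+1%:R * (t - s)) (is_derive_smooth_step _) da.
by rewrite [_ * n.+1%:R]mulrC.
Qed.

Lemma mollifier_ge0 n s t : 0 <= mollifier n s t.
Proof.
by rewrite /mollifier mulr_ge0// mulr_ge0 ?bump_ge0// invr_ge0 ltW// bump_primitive1_gt0.
Qed.

Lemma mollifier_eq0 n s t : ~~ (s < t < s + n.+1%:R^-1) -> mollifier n s t = 0.
Proof.
have n0 : (0 : R) < n.+1%:R by rewrite ltr0n.
rewrite negb_and -!leNgt => /orP[h|h]; rewrite /mollifier.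
  by rewrite bump_le0 ?mulr0// pmulr_rle0// subr_le0.
rewrite bump_ge1 ?mulr0//.
by rewrite mulrC -ler_pdivrMr// mul1r lerBrDl.
Qed.

Lemma continuous_mollifier n s : continuous (mollifier n s).
Proof.
move=> t; apply: cvgM; first exact: cvg_cst.
apply: cvgM; first exact: cvg_cst.
apply: (@continuous_comp _ _ _ (fun x : R => n.+1%:R * (x - s)) smooth_bump); last exact: continuous_smooth_bump.
by apply: cvgM; [exact: cvg_cst|apply: cvgB; [exact: cvg_id|exact: cvg_cst]].
Qed.

Lemma within_mollifier n s g T : {within `[0, T], continuous g} ->
  {within `[0, T], continuous (fun t => mollifier n s t * g t)}.
Proof.
move=> cg t; apply: cvgM; last exact: cg.
by apply: (@continuous_subspaceT _ _ `[0, T]%classic); exact: continuous_mollifier.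
Qed.

Lemma mollifier_int1 n s T : 0 < s -> s + n.+1%:R^-1 <= T ->
  \int[lam]_(t in `]0, T[) mollifier n s t = 1.
Proof.
move=> s0 sT; have n0 : (0 : R) < n.+1%:R by rewrite ltr0n.
have nV : (0 : R) < n.+1%:R^-1 by rewrite invr_gt0.
have T0 : 0 < T by rewrite (lt_le_trans _ sT)// addr_gt0.
have cm : {within `[0, T], continuous (mollifier n s)}.
  by apply: continuous_subspaceT; exact: continuous_mollifier.
have im : lam.-integrable `[0, T] (EFin \o mollifier n s).
  by apply: continuous_compact_integrable => //; exact: segment_compact.
have ds := is_derive_step_affine n s.
have cs : continuous (fun t => smooth_step (n.+1%:R * (t - s))) by exact: derivable_continuous ds.
have E := @continuous_FTC2 R (mollifier n s) (fun t => smooth_step (n.+1%:R * (t - s))) 0 T T0 cm.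
rewrite Rintegral_itv_obnd_cbnd; last exact: (within_integrable (lexx 0) (lexx T)).
rewrite Rintegral_itv_bndo_bndc; last first.
  apply: integrableS im; [exact: measurable_itv|exact: measurable_itv|].
  by move=> t /=; rewrite !in_itv /= => /andP[-> /ltW].
rewrite /Rintegral E /=; last 2 first.
- split; first by move=> x _; apply: ex_derive; exact: ds.
    by apply: cvg_at_right_filter; exact: cs.
  by apply: cvg_at_left_filter; exact: cs.
- by move=> x _; rewrite derive1E (@derive_val _ _ _ _ _ _ _ (ds x)).
rewrite smooth_step_ge1; last first.
  by rewrite mulrC -ler_pdivrMr// mul1r lerBrDl.
by rewrite smooth_step_le0 ?subr0// pmulr_rle0// sub0r oppr_le0 ltW.
Qed.

(** The mollifiers are nonnegative, have unit mass and concentrate at s, where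
    g is continuous. *)
Lemma mollifier_cvg g s T : 0 < s < T -> {within `[0, T], continuous g} ->
  \int[lam]_(t in `]0, T[) (mollifier n s t * g t) @[n --> \oo] --> g s.
Proof.
move=> /andP[s0 sT] cg; apply/cvgrPdist_le => e e0.
have mD : measurable (`]0, T[ : set (measurableTypeR R)) by exact: measurable_itv.
have gs : {for s, continuous g}.
  by apply: (within_continuous_continuous (lt_trans s0 sT) cg); rewrite in_itv /= s0.
have [d d0 hd] : exists2 d : R, 0 < d & forall t, `|s - t| < d -> `|g s - g t| <= e.
  have /cvgrPdist_le/(_ e e0) := gs; rewrite near_nbhs => -[d /= d0 hd].
  by exists d => // t ht; exact: hd.
near=> n.
have n0 : (0 : R) < n.+1%:R^-1 by rewrite invr_gt0 ltr0n.
have nd : n.+1%:R^-1 < Num.min d (T - s).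
  by near: n; apply: near_infty_natSinv_lt (PosNum _); rewrite lt_min d0 subr_gt0.
move: nd; rewrite lt_min => /andP[nd nT].
have cm : {within `[0, T], continuous (mollifier n s)}.
  by apply: continuous_subspaceT; exact: continuous_mollifier.
have im := within_integrable (lexx 0) (lexx T) cm.
have img := within_integrable (lexx 0) (lexx T) (@within_mollifier n s _ _ cg).
have imc (c : R) : lam.-integrable `]0, T[ (EFin \o (fun t => mollifier n s t * c)).
  apply: (within_integrable (lexx 0) (lexx T)); apply: within_mollifier.
  by apply: continuous_subspaceT => t; exact: cvg_cst.
have I1 : \int[lam]_(t in `]0, T[) mollifier n s t = 1 by apply: mollifier_int1 => //; rewrite -lerBrDl ltW.
have Ic c : \int[lam]_(t in `]0, T[) (mollifier n s t * c) = c.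
  have := RintegralZl c mD im; rewrite I1 mulr1 => {2}<-.
  by apply: eq_Rintegral => t _; rewrite mulrC.
rewrite -{1}(Ic (g s)) -RintegralB//.
apply: (le_trans (le_normr_Rintegral _ _)) => //.
  by have := integrableB mD (imc (g s)) img.
rewrite -[leRHS]Ic; apply: le_Rintegral => //.
  by have := integrable_norm (integrableB mD (imc (g s)) img).
move=> t _; rewrite -mulrBr normrM (ger0_norm (mollifier_ge0 _ _ _)).
have [h|h] := boolP (s < t < s + n.+1%:R^-1); last by rewrite mollifier_eq0// !mul0r.
apply: ler_wpM2l; first exact: mollifier_ge0.
move/andP: h => [h1 h2]; apply: hd; rewrite distrC ger0_norm ?subr_ge0 ?ltW//.
by rewrite ltrBlDl (lt_trans h2)// ltrD2l.
Unshelve. all: by end_near. Qed.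

(** Approximates the indicator of ]s, r] and is a test function for large n;
    its derivative is a difference of two mollifiers. *)
Definition plateau n s r t : R :=
  smooth_step (n.+1%:R * (t - s)) - smooth_step (n.+1%:R * (t - r)).

Lemma plateau_time_test n s r T : 0 < s < r -> r + n.+1%:R^-1 < T ->
  time_test T (plateau n s r).
Proof.
move=> /andP[s0 sr] rT; have n0 : (0 : R) < n.+1%:R by rewrite ltr0n.
have nV : (0 : R) < n.+1%:R^-1 by rewrite invr_gt0.
split.
  have H a : smooth_line (fun t => smooth_step (n.+1%:R * (t - a))).
    have := @smooth_line_affine R _ n.+1%:R (- (n.+1%:R * a)) (@smooth_line_step R).
    by under eq_fun do rewrite -mulrBr.
  exact: (smooth_lineB (H s) (H r)).
exists s, (r + n.+1%:R^-1); split => // t [ts|ts]; rewrite /plateau.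
  by rewrite !smooth_step_le0 ?subrr// pmulr_rle0//; lra.
have G a : n.+1%:R^-1 <= t - a -> smooth_step (n.+1%:R * (t - a)) = 1.
  by move=> h; rewrite smooth_step_ge1// mulrC -ler_pdivrMr// mul1r.
have h1 : n.+1%:R^-1 <= t - r by rewrite lerBrDl ltW.
by rewrite !G ?subrr// (le_trans h1)// lerD2l lerN2 ltW.
Qed.

Lemma plateau_cvg s r t : s < r -> plateau n s r t @[n --> \oo] --> (\1_(`]s, r]) t : R).
Proof.
have S a : smooth_step (n.+1%:R * (t - a)) @[n --> \oo] --> ((a < t)%R%:R : R).
  have [at_|ta] := ltP a t; last first.
    rewrite (_ : (fun n => _) = cst 0); first exact: cvg_cst.
    by apply/funext => n; rewrite smooth_step_le0// pmulr_rle0 ?ltr0n// subr_le0.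
  apply: cvg_near_cst; near=> n; apply/eqP.
  rewrite smooth_step_ge1// mulrC -ler_pdivrMr ?ltr0n// mul1r ltW//.
  by near: n; apply: near_infty_natSinv_lt (PosNum _); rewrite subr_gt0.
move=> sr; have := cvgB (S s) (S r).
rewrite (_ : (s < t)%R%:R - (r < t)%R%:R = \1_(`]s, r]) t :> R); first by apply.
rewrite indicE mem_setE in_itv /=.
have [st|ts] := ltP s t; have [rt|tr] := ltP r t; rewrite /= ?subrr ?subr0//.
by move: (lt_trans sr rt); rewrite ltNge ts.
Unshelve. all: by end_near. Qed.

Lemma plateau_le1 n s r t : `|plateau n s r t| <= 1.
Proof.
have /andP[a b] := smooth_step_ge0_le1 (n.+1%:R * (t - s)).
have /andP[c d] := smooth_step_ge0_le1 (n.+1%:R * (t - r)).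
by rewrite /plateau ler_norml; apply/andP; split; lra.
Qed.

Lemma continuous_plateau n s r : continuous (plateau n s r).
Proof.
apply: (@derivable_continuous _ _ (fun t => mollifier n s t - mollifier n r t)) => t.
by apply: is_deriveB; exact: is_derive_step_affine.
Qed.

(** Test with plateaus: on the derivative side the mollifiers select g s - g r,
    and on the other side dominated convergence gives the integral over ]s, r]. *)
Lemma weak_FTC g k s r T : {within `[0, T], continuous g} ->
  lam.-integrable `]0, T[ (EFin \o k) ->
  (forall phi, time_test T phi -> \int[lam]_(t in `]0, T[) (derive1 phi t * g t) =
    - \int[lam]_(t in `]0, T[) (phi t * k t)) ->
  0 < s < r -> r < T -> g r - g s = \int[lam]_(t in `]s, r]) k t.
Proof.
move=> cg ik H /andP[s0 sr] rT.
have mD : measurable (`]0, T[ : set (measurableTypeR R)) by exact: measurable_itv.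
have s0T : 0 < s < T by rewrite s0 (lt_trans sr rT).
have r0T : 0 < r < T by rewrite rT (lt_trans s0 sr).
have L := cvgB (mollifier_cvg s0T cg) (mollifier_cvg r0T cg).
pose kD := k \_ (`]0, T[%classic : set R).
have ikD : lam.-integrable setT (EFin \o kD).
  by rewrite /kD -restrict_EFin -integrable_mkcond.
have mkD : measurable_fun setT kD by apply/measurable_EFinP; have [] := integrableP _ _ _ ikD.
have Rr : \int[lam]_t (plateau n s r t * kD t) @[n --> \oo] -->
    \int[lam]_t (\1_(`]s, r]) t * kD t).
  apply: (@Rintegral_dominated_cvg _ _ R lam _ _ (fun t => `|kD t|)).
  - move=> n; apply: measurable_funM => //; apply: continuous_measurable_fun.
    exact: continuous_plateau.
  - by apply: measurable_funM => //; apply: measurable_indic; exact: measurable_itv.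
  - by apply: aeW => t; apply: cvgM; [exact: plateau_cvg|exact: cvg_cst].
  - by have := integrable_norm ikD.
  - by move=> n t; rewrite normrM ler_piMl// plateau_le1.
have E : (- \int[lam]_t (plateau n s r t * kD t)) @[n --> \oo] --> g s - g r.
  apply: cvg_trans (L _); apply: near_eq_cvg; near=> n.
  rewrite /GRing.add /GRing.opp /=.
  have rn : r + n.+1%:R^-1 < T.
    rewrite -ltrBrDl; near: n; apply: near_infty_natSinv_lt (PosNum _).
    by rewrite subr_gt0.
  have := H _ (plateau_time_test (s := s) (r := r) _ rn); rewrite s0 sr => /(_ isT) Hn.
  have i1 := within_integrable (lexx 0) (lexx T) (@within_mollifier n s _ _ cg).
  have i2 := within_integrable (lexx 0) (lexx T) (@within_mollifier n r _ _ cg).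
  rewrite -RintegralB//; apply/esym; transitivity (- \int[lam]_(t in `]0, T[) (plateau n s r t * k t)).
    rewrite Rintegral_mkcond; congr (- _); apply: eq_Rintegral => t _.
    by rewrite /kD !patchE; case: ifP; rewrite ?mulr0.
  rewrite -Hn; apply: eq_Rintegral => t _; rewrite -mulrBl; congr (_ * _).
  rewrite derive1E; apply: derive_val; apply: is_deriveB; exact: is_derive_step_affine.
have := norm_cvg_unique E (cvgN Rr) => /(_ _ _)/(congr1 -%R).
rewrite opprB opprK => ->.
rewrite [RHS]Rintegral_mkcond; apply: eq_Rintegral => t _.
rewrite /kD !patchE indicE; case: ifPn => h1; case: ifPn => h2; rewrite ?mul1r ?mul0r//.
move: h1 h2; rewrite !mem_setE !in_itv /= => /negP h /andP[st tr]; case: h.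
by rewrite (lt_trans s0 st) (le_lt_trans tr rT).
Unshelve. all: by end_near. Qed.

End WeakFTC.

(** * Integrals up to null sets and Bochner functions *)

Section AlmostEverywhere.
Context d (T : measurableType d) (R : realType) (mu : {measure set T -> \bar R}).
Import HBNNSimple.

(** A simple function below f, cut to 0 on the null set where f and g differ,
    lies below g and has the same integral. *)
Let lower_sums_le (f g : T -> \bar R) : {ae mu, forall x, f x = g x} ->
  (forall x, 0 <= g x)%E ->
  (ereal_sup [set sintegral mu h | h in [set h : {nnsfun T >-> R} | forall x, ((h x)%:E <= f x)%E]] <=
   ereal_sup [set sintegral mu h | h in [set h : {nnsfun T >-> R} | forall x, ((h x)%:E <= g x)%E]])%E.
Proof.
move=> [N [mN N0 sub]] g0; apply/ge_ereal_sup => _ /= [h hf <-].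
have mC := measurableC mN.
apply: ereal_sup_ubound; exists (proj_nnsfun h mC).
  move=> x; rewrite /= mindicE; have [xN|xN] := pselect (N x).
    by rewrite memNset ?mulr0//= => /(_ xN).
  rewrite mem_set// mulr1 -(_ : f x = g x) ?hf//.
  by apply: contrapT => fg; apply: xN; exact: sub.
rewrite -!integralT_nnsfun; apply: ae_eq_integral => //.
- by apply/measurable_EFinP; exact: measurable_funP.
- by apply/measurable_EFinP; exact: measurable_funP.
exists N; split => // x /=; apply: contra_notP => xN _.
by rewrite /= mindicE mem_set// mulr1.
Qed.

(** The integral is a difference of two suprema of lower sums, and these do not
    see null sets. This covers functions that are not Borel measurable, such as
    the scalar products of a path that is only almost everywhere a limit of
    simple paths. *)
Lemma ae_eq_integral_nonmeasurable (D : set T) (f g : T -> \bar R) :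
  {ae mu, forall x, D x -> f x = g x} ->
  (\int[mu]_(x in D) f x = \int[mu]_(x in D) g x)%E.
Proof.
move=> fg; have E : {ae mu, forall x, (f \_ D) x = (g \_ D) x}.
  apply: (ae_imply _ fg) => x h; rewrite !patchE; case: ifPn => //.
  by rewrite inE => /h.
rewrite /integral; congr (_ - _)%E; apply/eqP; rewrite eq_le; apply/andP; split;
  apply: lower_sums_le => //; apply: (ae_imply _ E) => x h.
- by rewrite !funeposE h.
- by rewrite !funeposE h.
- by rewrite !funenegE h.
- by rewrite !funenegE h.
Qed.

Lemma ae_eq_Rintegral_nonmeasurable (D : set T) (f g : T -> R) :
  {ae mu, forall x, D x -> f x = g x} ->
  \int[mu]_(x in D) f x = \int[mu]_(x in D) g x.
Proof.
move=> fg; congr fine; apply: ae_eq_integral_nonmeasurable.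
by apply: (ae_imply _ fg) => x h /h ->.
Qed.

End AlmostEverywhere.

Section Bochner.
Context {R : realType}.
Notation mu := (torus_measure (@T2 R)).
Local Notation lam := (@lebesgue_measure R).
Implicit Types (u v h : vfield R) (g : R -> vfield R).

Lemma spaceH0 : spaceH (fun _ _ => 0 : R).
Proof.
split.
- move=> i; apply/Leb2P; split; [exact: sqint0|by split].
- by move=> i; rewrite Rintegral_cst ?mul0r.
- move=> phi _ _; rewrite big1// => i _; under eq_Rintegral do rewrite mul0r.
  by rewrite Rintegral_cst ?mul0r.
Qed.

Lemma normH0 : normH (fun _ _ => 0 : R) = 0.
Proof.
rewrite /normH /ip big1 ?sqrtr0// => i _; under eq_Rintegral do rewrite mul0r.
by rewrite Rintegral_cst ?mul0r.
Qed.

Lemma ip0l h : ip (fun _ _ => 0 : R) h = 0.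
Proof.
rewrite /ip big1 // => i _; under eq_Rintegral do rewrite mul0r.
by rewrite Rintegral_cst ?mul0r.
Qed.

Lemma normHD u v : L2field u -> L2field v -> normH (u + v) <= normH u + normH v.
Proof.
move=> su sv; rewrite -(ler_pXn2r (n := 2)) ?nnegrE ?addr_ge0 ?normH_ge0//.
have suv := L2fieldD su sv.
rewrite normH_sqr ipDl// !ipDr// sqrrD !normH_sqr (ipC v u).
have := ip_le_normH su sv; rewrite ler_norml => /andP[_ h].
rewrite -mulr_natr; lra.
Qed.

Lemma normHB u v : L2field u -> L2field v -> normH (u - v) <= normH u + normH v.
Proof.
move=> su sv; rewrite -(ler_pXn2r (n := 2)) ?nnegrE ?addr_ge0 ?normH_ge0//.
have suv := L2fieldB su sv.
rewrite normH_sqr ipBl// !ipBr// sqrrD !normH_sqr (ipC v u).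
have := ip_le_normH su sv; rewrite ler_norml => /andP[h _].
rewrite -mulr_natr; lra.
Qed.

Lemma normHBC u v : normH (u - v) = normH (v - u).
Proof.
rewrite /normH /ip; congr Num.sqrt; apply: eq_bigr => i _; apply: eq_Rintegral => x _.
by rewrite -[RHS]mulrNN !fctE /= !opprB.
Qed.

Lemma normH_dist u v : L2field u -> L2field v -> `|normH u - normH v| <= normH (u - v).
Proof.
move=> su sv; have H (a b : vfield R) : L2field a -> L2field b -> normH a <= normH b + normH (a - b).
  by move=> sa sb; have := normHD sb (L2fieldB sa sb); rewrite addrC subrK addrC.
have := H _ _ su sv; have := H _ _ sv su; rewrite (normHBC v) => h1 h2.
by rewrite ler_norml; apply/andP; split; lra.
Qed.

Lemma simple_path_measurable s : simple_path spaceH s ->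
  [/\ forall t, L2field (s t),
      forall h, L2field h -> measurable_fun setT (fun t : R => ip (s t) h)
    & measurable_fun setT (fun t : R => normH (s t))].
Proof.
move=> [l [E [c [hc ->]]]].
have sc a : L2field (c a) by have [_ /spaceH_L2] := hc a.
have sE t : L2field (fun i x => \sum_a \1_(E a) t * c a i x).
  by move=> i; apply: sqint_sum => a; apply: sqintZ; exact: sc.
have ipE t h : L2field h -> ip (fun i x => \sum_a \1_(E a) t * c a i x) h =
    \sum_a \1_(E a) t * ip (c a) h.
  move=> sh; rewrite /ip; under [RHS]eq_bigr do rewrite mulr_sumr.
  rewrite exchange_big; apply: eq_bigr => i _ /=.
  rewrite inner_suml//; last by move=> a; apply: sqintZ; exact: sc.
  by apply: eq_bigr => a _; rewrite innerZl//; exact: sc.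
have mE a : measurable_fun setT (\1_(E a) : R -> R).
  by apply: measurable_indic; have [] := hc a.
have mip h : L2field h ->
    measurable_fun setT (fun t : R => ip (fun i x => \sum_a \1_(E a) t * c a i x) h).
  move=> sh; under eq_fun do rewrite ipE//.
  by apply: measurable_sum => a; apply: measurable_funM.
split => //; rewrite /normH.
apply: (@measurableT_comp _ _ _ _ _ _ (@Num.sqrt R)).
  by apply: continuous_measurable_fun; exact: sqrt_continuous.
under eq_fun do rewrite ipE//.
apply: measurable_sum => a; apply: measurable_funM => //.
by under eq_fun do rewrite ipC; exact: mip.
Qed.

(** Off a null set the path is a limit of simple paths, so its norm and its
    scalar products are limits of measurable functions. Setting it to 0 on that
    null set makes them measurable everywhere and keeps the path in H. *)
Lemma bochner_representative (T : R) g : bochner_L2 spaceH normH T g ->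
  exists g', [/\ forall t, spaceH (g' t),
    {ae lam, forall t, 0 < t < T -> g t = g' t},
    forall h, L2field h -> measurable_fun setT (fun t : R => ip (g' t) h)
  & lam.-integrable `]0, T[ (EFin \o (fun t => normH (g' t)))].
Proof.
move=> [gH [s [ss gs]] gfin].
have mI : measurable (`]0, T[ : set (measurableTypeR R)) by exact: measurable_itv.
have [N [mN N0 sub]] := ae_and gH gs.
pose D : set (measurableTypeR R) := `]0, T[ `\` N.
have mD : measurable D by exact: measurableD.
have hD t : D t -> 0 < t < T by case; rewrite /= in_itv.
have good t : D t -> spaceH (g t) /\ normH (g t - s l t) @[l --> \oo] --> (0 : R).
  move=> Dt; have [t0T tN] : 0 < t < T /\ ~ N t by case: Dt; rewrite /= in_itv.
  have /= [h1 h2] := contrapT (fun ht => tN (sub t ht)).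
  by split; [exact: h1|exact: h2].
pose g' t : vfield R := if t \in D then g t else fun _ _ => 0.
have g'H t : spaceH (g' t).
  by rewrite /g'; case: ifPn => [|_]; [rewrite inE => /good[]|exact: spaceH0].
have gg' : {ae lam, forall t, 0 < t < T -> g t = g' t}.
  exists N; split => // t /=; apply: contra_notP => Nt t0T.
  by rewrite /g' mem_set//; split => //=; rewrite in_itv.
have mL (F : R -> R) (G : nat -> R -> R) : (forall l, measurable_fun setT (G l)) ->
    (forall t, D t -> G l t @[l --> \oo] --> F t) -> (forall t, ~ D t -> F t = 0) ->
    measurable_fun setT F.
  move=> mG cG F0; apply: (@measurable_fun_cvg _ _ _ _ (fun l t => \1_D t * G l t)).
    by move=> l; apply: measurable_funM; [exact: measurable_indic|exact: mG].
  move=> t _; rewrite indicE; have [Dt|Dt] := pselect (D t).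
    by rewrite mem_set//; under eq_fun do rewrite mul1r; exact: cG.
  by rewrite memNset// F0//; under eq_fun do rewrite mul0r; exact: cvg_cst.
have cN (B : R) (a : R) (b : nat -> R) t : D t -> 0 <= B ->
    (forall l, `|a - b l| <= B * normH (g t - s l t)) -> b l @[l --> \oo] --> a.
  move=> Dt B0 ab; have [_ c] := good t Dt.
  have c0 : B * normH (g t - s l t) @[l --> \oo] --> (0 : R).
    by rewrite -[0](mulr0 B); apply: cvgM; [exact: cvg_cst|exact: c].
  apply/cvgrPdist_le => e e0; near=> l; apply: (le_trans (ab l)).
  have : `|0 - B * normH (g t - s l t)| <= e.
    by near: l; move/cvgrPdist_le : c0; apply.
  by rewrite sub0r normrN ger0_norm// mulr_ge0// normH_ge0.
have mip h : L2field h -> measurable_fun setT (fun t : R => ip (g' t) h).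
  move=> sh; apply: (mL _ (fun l t => ip (s l t) h)).
  - by move=> l; have [_ m _] := simple_path_measurable (ss l); exact: m.
  - move=> t Dt; have [/spaceH_L2 gt _] := good t Dt.
    rewrite /g' mem_set//; apply: (cN (normH h)) Dt (normH_ge0 h) _ => l.
    have [sl _ _] := simple_path_measurable (ss l).
    by rewrite -ipBl// mulrC; apply: ip_le_normH => //; exact: L2fieldB.
  - by move=> t Dt; rewrite /g' memNset// ip0l.
have mnorm : measurable_fun setT (fun t : R => normH (g' t)).
  apply: (mL _ (fun l t => normH (s l t))).
  - by move=> l; have [] := simple_path_measurable (ss l).
  - move=> t Dt; have [/spaceH_L2 gt _] := good t Dt.
    rewrite /g' mem_set//; apply: (cN 1) Dt ler01 _ => l; rewrite mul1r.
    by have [sl _ _] := simple_path_measurable (ss l); apply: normH_dist.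
  - by move=> t Dt; rewrite /g' memNset// normH0.
exists g'; split => //.
have fin' : (\int[lam]_(t in `]0%R, T[) ((normH (g' t)) ^+ 2)%:E < +oo)%E.
  have E : {ae lam, forall t, `]0, T[%classic t ->
      ((normH (g t)) ^+ 2)%:E = ((normH (g' t)) ^+ 2)%:E}.
    by apply: (ae_imply _ gg') => t h; rewrite /= in_itv => /h ->.
  by move: gfin; rewrite (ae_eq_integral_nonmeasurable E).
have i2 : lam.-integrable `]0, T[ (EFin \o (fun t => normH (g' t) ^+ 2)).
  apply/integrableP; split.
    apply/measurable_EFinP/measurable_funX; exact: measurable_funTS.
  by under eq_integral => t _ do rewrite /= (ger0_norm (sqr_ge0 _)).
have i1 : lam.-integrable `]0, T[ (EFin \o (fun t => (1 : R))).
  apply: (within_integrable (lexx 0) (lexx T)).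
  by apply: continuous_subspaceT => t; exact: cvg_cst.
apply: (le_integrable mI _ _ (integrableD mI i2 i1)).
  by apply/measurable_EFinP; exact: measurable_funTS.
move=> t _; rewrite lee_fin ger0_norm ?normH_ge0// ger0_norm; last first.
  by rewrite addr_ge0// sqr_ge0.
have := sqr_ge0 (normH (g' t) - 1); have := normH_ge0 (g' t).
move: (normH (g' t)) => a a0; rewrite sqrrB expr1n mulr1; nra.
Unshelve. all: by end_near. Qed.

End Bochner.

(** * Decay of the energy *)

Section RealLemmas.
Context {R : realType}.
Local Notation lam := (@lebesgue_measure R).
Implicit Types (F y : R -> R) (a b k s r T : R).

(** Walk back from r in steps of length d / 2. *)
Lemma nonincreasing_of_local F a b (d : R) : 0 < d ->
  (forall s r, a < s -> s <= r -> r < b -> r - s < d -> F r <= F s) ->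
  forall s r, a < s -> s <= r -> r < b -> F r <= F s.
Proof.
move=> d0 H; have P n : forall s r, a < s -> s <= r -> r < b -> r - s < n.+1%:R * (d / 2) -> F r <= F s.
  elim: n => [|n IH] s r sa sr rb h; first by apply: H => //; lra.
  have [h1|h1] := ltP (r - s) d; first exact: H.
  apply: (@le_trans _ _ (F (r - d / 2))); first by apply: H => //; lra.
  by apply: IH => //; [lra|lra|move: h; rewrite -[n.+2]addn1 natrD mulrDl; lra].
move=> s r sa sr rb; have [n hn] : exists n, r - s < n.+1%:R * (d / 2).
  have d2 : 0 < d / 2 by lra.
  exists (Num.truncn ((r - s) / (d / 2))).
  by rewrite -ltr_pdivrMr// truncnS_gt// .
exact: (P n).
Qed.

Lemma ae_le_Rintegral (D : set (measurableTypeR R)) (f g : R -> R) : measurable D ->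
  lam.-integrable D (EFin \o f) -> lam.-integrable D (EFin \o g) ->
  {ae lam, forall t, D t -> f t <= g t} ->
  \int[lam]_(t in D) f t <= \int[lam]_(t in D) g t.
Proof.
move=> mD jf jg fg; rewrite -subr_ge0 -RintegralB//.
rewrite (@ae_eq_Rintegral_nonmeasurable _ _ _ lam D _ (fun t => `|g t - f t|)).
  by apply: Rintegral_ge0 => t _.
by apply: (ae_imply _ fg) => t h /h ?; rewrite ger0_norm// subr_ge0.
Qed.

(** Take inverses in 1 + z <= exp z at z = - x / (1 + x). *)
Lemma expR_le_onePx (x : R) : 0 <= x -> expR (x / (1 + x)) <= 1 + x.
Proof.
move=> x0; have x1 : 0 < 1 + x by lra.
rewrite -[leRHS]invrK -[leLHS]invrK lef_pV2 ?posrE ?invr_gt0 ?expR_gt0// -expRN.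
apply: le_trans (expR_ge1Dx _); rewrite le_eqVlt; apply/orP; left; apply/eqP.
by field; rewrite gt_eqF.
Qed.

(** The hypothesis is an implicit Euler step. With n steps of length h one gets
    y r (1 + k h)^n <= y s, where (1 + k h)^n >= exp (k (r - s) / (1 + k h)),
    and the exponent tends to k (r - s). *)
Lemma gronwall_implicit y a T k : 0 <= k ->
  (forall s r, a < s -> s <= r -> r < T -> y r * (1 + k * (r - s)) <= y s) ->
  (forall s, 0 <= y s) ->
  forall s r, a < s -> s <= r -> r < T -> y r * expR (k * (r - s)) <= y s.
Proof.
move=> k0 H y0 s r sa sr rT.
pose x := k * (r - s); have x0 : 0 <= x by rewrite mulr_ge0// subr_ge0.
have step n : y r * expR (x / (1 + x / n.+1%:R)) <= y s.
  pose h := (r - s) / n.+1%:R; have h0 : 0 <= h by rewrite divr_ge0// subr_ge0.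
  have E : n.+1%:R * h = r - s by rewrite /h mulrC divfK.
  have kh : 0 <= k * h by rewrite mulr_ge0.
  have P (i : nat) : (i <= n.+1)%N -> y (s + i%:R * h) * (1 + k * h) ^+ i <= y s.
    elim: i => [|i IH] ilt; first by rewrite mul0r addr0 expr0 mulr1.
    have ih : i.+1%:R * h = i%:R * h + h by rewrite -natr1 mulrDl mul1r.
    have ihn : i.+1%:R * h <= r - s by rewrite -E ler_wpM2r// ler_nat.
    have ih0 : 0 <= i%:R * h by rewrite mulr_ge0.
    apply: le_trans (IH (ltnW ilt)); rewrite exprS mulrA ler_wpM2r ?exprn_ge0 ?addr_ge0//.
    have := H (s + i%:R * h) (s + i.+1%:R * h).
    rewrite (_ : s + i.+1%:R * h - (s + i%:R * h) = h); last by rewrite ih; ring.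
    apply; move: ihn; rewrite ih; move: (i%:R * h) ih0 => z z0 zh; lra.
  have := P n.+1 (leqnn _); rewrite E addrC subrK; apply: le_trans.
  rewrite ler_wpM2l//; apply: le_trans (_ : expR (k * h / (1 + k * h)) ^+ n.+1 <= _).
    rewrite -expRM_natl (_ : _ * (_ / _) = x / (1 + x / n.+1%:R))//.
    rewrite (_ : x / n.+1%:R = k * h); last by rewrite /x /h mulrA.
    by rewrite /x -E mulrA; congr (_ / _); rewrite mulrCA.
  by rewrite ler_pXn2r ?nnegrE ?expR_ge0 ?addr_ge0// expR_le_onePx.
have c : y r * expR (x / (1 + x / n.+1%:R)) @[n --> \oo] --> y r * expR x.
  apply: cvgM; first exact: cvg_cst.
  apply: continuous_cvg; first exact: continuous_expR.
  have E : x = x / (1 + x * 0) by rewrite mulr0 addr0 divr1.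
  rewrite [X in _ --> X]E.
  apply: cvgM; first exact: cvg_cst.
  apply: cvgV; first by rewrite mulr0 addr0 oner_eq0.
  apply: cvgD; first exact: cvg_cst.
  by apply: cvgM; [exact: cvg_cst|exact: cvg_harmonic].
by apply: (cvgr_to_le c); apply: nearW.
Qed.

End RealLemmas.

Section EnergyDecay.
Context {R : realType}.
Local Notation lam := (@lebesgue_measure R).
Implicit Types (h : vfield R).
Variables (T : R) (e : R -> vfield R).
Hypothesis eL2 : forall t, 0 <= t <= T -> spaceH (e t).
Hypothesis econt : forall t, 0 <= t <= T ->
  normH (e s - e t) @[s --> within `[0, T] (nbhs t)] --> (0 : R).

Lemma path_near t (eps : R) : 0 <= t <= T -> 0 < eps ->
  exists2 d : R, 0 < d & forall s, 0 <= s <= T -> `|t - s| < d -> normH (e s - e t) <= eps.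
Proof.
move=> tT e0; have /cvgrPdist_le/(_ _ e0) := econt tT.
rewrite near_withinE near_nbhs => -[d /= d0 hd]; exists d => // s sT st.
have := hd s st; rewrite /= in_itv /= => /(_ sT).
by rewrite sub0r normrN ger0_norm// normH_ge0.
Qed.

Lemma path_uniformly_continuous (eps : R) : 0 < eps ->
  exists2 d : R, 0 < d & forall s r, 0 <= s <= T -> 0 <= r <= T -> `|r - s| < d ->
    normH (e r - e s) <= eps.
Proof.
move=> e0; have e20 : 0 < eps / 2 by lra.
(* Compactness of [0, T] turns the modulus of continuity at each point into a
   uniform one. *)
pose P (d s : R) := 0 <= s <= T -> forall r, 0 <= r <= T -> `|r - s| < d -> normH (e r - e s) <= eps.
have cov : near_covering (`[0, T]%classic : set R).
  by apply/compact_near_coveringP; exact: segment_compact.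
have [|d /= d0 hd] := cov R 0^'+ P _ _.
  move=> x; rewrite /= in_itv /= => xT; have [d d0 hd] := path_near xT e20.
  near=> s d' => sT r rT rs.
  have sd : `|x - s| < d / 2 by near: s; apply: nbhsx_ballx; lra.
  have d'd : d' <= d / 2 by near: d'; apply: nbhs_right_le; lra.
  have rd : `|x - r| < d.
    have := ler_distD s x r; rewrite (distrC s r) => h.
    by apply: (le_lt_trans h); move: rs => /=; lra.
  have sd' : `|x - s| < d by lra.
  have := hd r rT rd; have := hd s sT sd'.
  have [/spaceH_L2 sr /spaceH_L2 ss /spaceH_L2 sx] := And3 (eL2 rT) (eL2 sT) (eL2 xT).
  rewrite (normHBC (e s)) => h1 h2.
  have := normHD (L2fieldB sr sx) (L2fieldB sx ss); rewrite addrA subrK => h3; lra.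
exists (d / 2); first lra.
move=> s r sT rT rs; apply: (hd (d / 2) _ _ _ _ sT) => //=; last lra.
  by rewrite sub0r normrN gtr0_norm; lra.
Unshelve. all: by end_near. Qed.

Lemma within_ip h : L2field h -> {within `[0, T], continuous (fun t => ip (e t) h)}.
Proof.
move=> sh; apply/subspace_continuousP => t; rewrite /= in_itv /= => tT.
apply/cvgrPdist_le => eps eps0.
have c0 : 0 < normH h + 1 by have := normH_ge0 h; lra.
have [d d0 hd] := path_near tT (divr_gt0 eps0 c0).
rewrite near_withinE near_nbhs; exists d => // s /= st; rewrite in_itv /= => sT.
have [/spaceH_L2 ss /spaceH_L2 sx] := (eL2 sT, eL2 tT).
rewrite distrC -ipBl//; apply: (le_trans (ip_le_normH (L2fieldB ss sx) sh)).
apply: (@le_trans _ _ (eps / (normH h + 1) * (normH h + 1))); last by rewrite divfK// gt_eqF.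
by apply: ler_pM; rewrite ?normH_ge0//; [exact: hd|lra].
Qed.

Lemma within_normH : {within `[0, T], continuous (fun t => normH (e t))}.
Proof.
apply/subspace_continuousP => t; rewrite /= in_itv /= => tT.
apply/cvgrPdist_le => eps eps0.
have [d d0 hd] := path_near tT eps0.
rewrite near_withinE near_nbhs; exists d => // s /= st; rewrite in_itv /= => sT.
have [/spaceH_L2 ss /spaceH_L2 sx] := (eL2 sT, eL2 tT).
by rewrite distrC; apply: (le_trans (normH_dist ss sx)); exact: hd.
Qed.

Lemma within_sqr : {within `[0, T], continuous (fun t => normH (e t) ^+ 2)}.
Proof. by move=> t; apply: cvgM; exact: within_normH. Qed.

Variables (et : R -> vfield R) (G : R -> R) (a k : R).
Hypothesis etH : forall t, L2field (et t).
Hypothesis mip : forall h, L2field h -> measurable_fun setT (fun t : R => ip (et t) h).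
Hypothesis iG : lam.-integrable `]0, T[ (EFin \o G).
Hypothesis etG : forall t, normH (et t) <= G t.
Hypothesis tde : time_derivative T e et.
Hypothesis a0 : 0 <= a.
Hypothesis k0 : 0 <= k.
Hypothesis dissip : {ae lam, forall t, a < t < T -> 2 * ip (et t) (e t) <= - k * normH (e t) ^+ 2}.

Let y t := normH (e t) ^+ 2.

Lemma integrable_ip_derivative h : L2field h -> lam.-integrable `]0, T[ (EFin \o (fun t => ip (et t) h)).
Proof.
move=> sh; have mI : measurable (`]0, T[ : set (measurableTypeR R)) by exact: measurable_itv.
apply: (le_integrable mI _ _ (integrableZr mI (normH h) iG)).
  by apply/measurable_EFinP; exact: measurable_funTS (mip sh).
move=> t _; rewrite lee_fin; apply: (le_trans (ip_le_normH (etH t) sh)).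
apply: (@le_trans _ _ (G t * normH h)); last exact: ler_norm.
by apply: ler_wpM2r => //; exact: normH_ge0.
Qed.

(** On a short interval |e r|^2 - |e s|^2 = (e r - e s, h) for the fixed field
    h = e r + e s, so weak_FTC applies to t |-> (e t, h). Uniform continuity of
    e replaces h by 2 e t under the integral, at the cost of 2 eps |et|. The
    local inequalities add up over any interval, and eps tends to 0. *)
Lemma energy_inequality s r : a < s -> s <= r -> r < T ->
  y r - y s + k * \int[lam]_(t in `]s, r]) y t <= 0.
Proof.
move=> sa sr rT.
have mI (u w : R) : measurable (`]u, w] : set (measurableTypeR R)) by exact: measurable_itv.
have iS (f : R -> R) u w : lam.-integrable `]0, T[ (EFin \o f) -> 0 <= u -> w < T ->
    lam.-integrable `]u, w] (EFin \o f).
  move=> jf u0 wT; apply: integrableS jf; [exact: measurable_itv|exact: measurable_itv|].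
  move=> t /=; rewrite !in_itv /= => /andP[h1 h2].
  by rewrite (le_lt_trans u0 h1) (le_lt_trans h2 wT).
have iy : lam.-integrable `]0, T[ (EFin \o y) by exact: (within_integrable (lexx 0) (lexx T) within_sqr).
pose J f t := \int[lam]_(x in `]a, t]) (f x : R).
have JB f u w : lam.-integrable `]0, T[ (EFin \o f) -> a <= u -> u <= w -> w < T ->
    J f w - J f u = \int[lam]_(t in `]u, w]) f t.
  by move=> jf au uw wT; apply: Rintegral_itvB; [exact: iS|rewrite bnd_simp|rewrite bnd_simp].
have main (eps : R) : 0 < eps -> y r - y s + k * \int[lam]_(t in `]s, r]) y t <= 2 * eps * \int[lam]_(t in `]s, r]) G t.
  move=> eps0; have [d d0 hd] := path_uniformly_continuous eps0.
  (* It is enough that F is nonincreasing, which can be checked on short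
     intervals. *)
  pose F t := y t + k * J y t - 2 * eps * J G t.
  suff : F r <= F s.
    have e1 := JB _ s r iy (ltW sa) sr rT; have e2 := JB _ s r iG (ltW sa) sr rT.
    rewrite -e1 -e2 /F !mulrBr; lra.
  apply: (nonincreasing_of_local (F := F) d0) sa sr rT => {}s {}r sa sr rT rsd.
  have e1 := JB _ s r iy (ltW sa) sr rT; have e2 := JB _ s r iG (ltW sa) sr rT.
  suff : y r - y s + k * \int[lam]_(t in `]s, r]) y t <= 2 * eps * \int[lam]_(t in `]s, r]) G t.
    rewrite -e1 -e2 /F !mulrBr; lra.
  have [->|nsr] := eqVneq s r.
    by rewrite set_itv_ge ?bnd_simp ?ltxx// !Rintegral_set0 subrr !mulr0 addr0.
  have {nsr}sr' : s < r by rewrite lt_neqAle nsr.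
  have s0 : 0 < s by exact: le_lt_trans sa.
  have r0 : 0 < r by exact: lt_trans sr'.
  have bT t : s <= t -> t <= r -> 0 <= t <= T.
    by move=> st tr; rewrite (ltW (lt_le_trans s0 st)) (ltW (le_lt_trans tr rT)).
  have [hs hr] := (eL2 (bT s (lexx _) sr), eL2 (bT r sr (lexx _))).
  have [/[dup] ss /spaceH_L2 ls /[dup] sr'' /spaceH_L2 lr] := (hs, hr).
  pose h := e r + e s.
  have lh : L2field h by exact: L2fieldD.
  have Hh : spaceH h.
    have -> : h = e r - ((fun _ _ => 0) - e s) by rewrite /h opprB addrA subr0.
    by apply: spaceHB => //; apply: spaceHB => //; exact: spaceH0.
  have ik := integrable_ip_derivative lh.
  have s0r : 0 < s < r by rewrite s0.
  have E := weak_FTC (within_ip lh) ik (tde Hh) s0r rT.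
  have -> : y r - y s = \int[lam]_(t in `]s, r]) ip (et t) h.
    rewrite -E /y /h !normH_sqr !ipDr// (ipC (e s) (e r)); ring.
  rewrite -!RintegralZl//; try exact: iS (ltW s0) rT.
  rewrite -RintegralD//; last 2 first.
  - exact: iS (ltW s0) rT.
  - by have := integrableZl (mI s r) k (iS _ _ _ iy (ltW s0) rT).
  apply: ae_le_Rintegral => //.
  - have := integrableD (mI s r) (iS _ _ _ ik (ltW s0) rT) (integrableZl (mI s r) k (iS _ _ _ iy (ltW s0) rT)).
    by [].
  - by have := integrableZl (mI s r) (2 * eps) (iS _ _ _ iG (ltW s0) rT).
  apply: (ae_imply _ dissip) => t ht; rewrite /= in_itv /= => /andP[st tr].
  have tT := bT t (ltW st) tr; have lt := spaceH_L2 (eL2 tT).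
  have h1 : 2 * ip (et t) (e t) <= - k * y t.
    by apply: ht; rewrite (lt_trans sa st) (le_lt_trans tr rT).
  have h2 u : 0 <= u <= T -> `|u - t| < d -> ip (et t) (e u) - ip (et t) (e t) <= G t * eps.
    move=> uT ut; have lu := spaceH_L2 (eL2 uT); rewrite -ipBr//.
    apply: (le_trans (ler_norm _)); apply: (le_trans (ip_le_normH (etH t) (L2fieldB lu lt))).
    by apply: ler_pM; rewrite ?normH_ge0 ?etG//; exact: hd.
  have h3 := h2 r (bT r sr (lexx _)); have h4 := h2 s (bT s (lexx _) sr).
  rewrite ipDr//.
  have h5 : `|r - t| < d by rewrite ger0_norm ?subr_ge0//; lra.
  have h6 : `|s - t| < d by rewrite distrC gtr0_norm ?subr_gt0//; lra.
  move: (h3 h5) (h4 h6) h1; move: (ip _ _) (ip _ _) (ip _ _) (y t) (G t) => A B C D g; nra.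
apply/ler_addgt0Pr => eps eps0; rewrite add0r.
have c0 : 0 <= \int[lam]_(t in `]s, r]) G t.
  by apply: Rintegral_ge0 => t _; apply: le_trans (etG t); exact: normH_ge0.
have c1 : 0 < 2 * (\int[lam]_(t in `]s, r]) G t + 1) by lra.
apply: (le_trans (main _ (divr_gt0 eps0 c1))).
move: (\int[lam]_(t in `]s, r]) G t) c0 c1 => c c0 c1.
rewrite mulrAC mulrA -ler_pdivlMr; last by rewrite invr_gt0.
by rewrite invrK; nra.
Qed.

(** The energy is nonincreasing, so its integral over ]s, r] is at least (r -
    s) y r, which is the hypothesis of gronwall_implicit. The initial time a,
    which may be 0, is reached by continuity from the right. *)
Lemma energy_decay t : a <= t -> t < T -> y t <= expR (- k * (t - a)) * y a.
Proof.
rewrite le_eqVlt => /predU1P[<- _|at_ tT]; first by rewrite subrr mulr0 expR0 mul1r.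
have y0 s : 0 <= y s by exact: sqr_ge0.
have mono s r : a < s -> s <= r -> r < T -> y r <= y s.
  move=> sa sr rT; have := energy_inequality sa sr rT.
  have : 0 <= k * \int[lam]_(x in `]s, r]) y x by rewrite mulr_ge0// Rintegral_ge0.
  lra.
have step s r : a < s -> s <= r -> r < T -> y r * (1 + k * (r - s)) <= y s.
  move=> sa sr rT; have := energy_inequality sa sr rT.
  have mI : measurable (`]s, r] : set (measurableTypeR R)) by exact: measurable_itv.
  have sub : `]s, r]%classic `<=` (`]0, T[%classic : set R).
    move=> x /=; rewrite !in_itv /= => /andP[h1 h2].
    by rewrite (le_lt_trans a0 (lt_trans sa h1)) (le_lt_trans h2 rT).
  have iy : lam.-integrable `]s, r] (EFin \o y).
    exact: integrableS (within_integrable (lexx 0) (lexx T) within_sqr).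
  have : (r - s) * y r <= \int[lam]_(x in `]s, r]) y x.
    have i1 : lam.-integrable `]s, r] (EFin \o (fun=> y r)).
      apply: (@integrableS _ _ _ lam `]0, T[) => //.
      apply: (within_integrable (lexx 0) (lexx T)).
      by apply: continuous_subspaceT => x; exact: cvg_cst.
    have := le_Rintegral mI i1 iy; rewrite Rintegral_cst//= lebesgue_measure_itv /= lte_fin.
    have [sr'|rs] := ltP s r; last first.
      have rs' : r - s = 0 by lra.
      by rewrite rs' mul0r => _; rewrite Rintegral_ge0// => x _; exact: y0.
    move=> H; rewrite [leLHS]mulrC; apply: (H _) => x; rewrite inE /= => /andP[sx xr].
    by apply: mono => //; exact: lt_trans sx.
  move: (\int[lam]_(x in _) _) => I hI; have := ler_wpM2l k0 hI.
  move: (y r) (y s) => p q; rewrite mulrDr mulr1; nra.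
have G1 := gronwall_implicit k0 step y0.
have ca : y s @[s --> a^'+] --> y a.
  have sub : `[a, t]%classic `<=` (`[0, T]%classic : set R).
    by move=> x /=; rewrite !in_itv /= => /andP[h1 h2]; rewrite (le_trans a0 h1) (le_trans h2 (ltW tT)).
  by have [] := (continuous_within_itvP _ at_).1 (continuous_subspaceW sub within_sqr).
have ce : y t * expR (k * (t - s)) @[s --> a^'+] --> y t * expR (k * (t - a)).
  apply: cvg_at_right_filter; apply: cvgM; first exact: cvg_cst.
  apply: continuous_cvg; first exact: continuous_expR.
  by apply: cvgM; [exact: cvg_cst|apply: cvgB; [exact: cvg_cst|exact: cvg_id]].
have H : y t * expR (k * (t - a)) <= y a.
  apply: (ler_cvg_to ce ca); near=> s; apply: G1 => //.
  by apply: ltW; near: s; exact: nbhs_right_lt.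
rewrite mulNr expRN mulrC ler_pdivlMr ?expR_gt0//.
Unshelve. all: by end_near. Qed.

End EnergyDecay.

(** * Differences of paths *)

Section Difference.
Context {R : realType}.
Local Notation lam := (@lebesgue_measure R).
Implicit Types (u v ut vt : R -> vfield R) (T : R).

(** Poincare's inequality bounds the norm of H by that of V. *)
Lemma continuous_path_H (c T : R) u : poincare_constant c ->
  continuous_path spaceV normV T u -> continuous_path spaceH normH T u.
Proof.
move=> [c0 hc] cu t tT; have [Vt ct] := cu t tT; split; first by have [] := Vt.
have P w : spaceV w -> normH w <= (Num.sqrt c)^-1 * normV w.
  move=> Vw; rewrite mulrC ler_pdivlMr ?sqrtr_gt0// -(ler_pXn2r (n := 2)) ?nnegrE ?mulr_ge0 ?normH_ge0 ?normV_ge0//.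
  by rewrite exprMn (sqr_sqrtr (ltW c0)) mulrC; exact: hc.
have c1 : (Num.sqrt c)^-1 * normV (u s - u t) @[s --> within `[0, T] (nbhs t)] --> (Num.sqrt c)^-1 * 0.
  by apply: cvgM; [exact: cvg_cst|exact: ct].
rewrite mulr0 in c1.
apply/cvgrPdist_le => eps e0; move/cvgrPdist_le/(_ _ e0) : c1.
rewrite !near_withinE; apply: filterS => s hs; rewrite /= in_itv /= => sT.
have [Vs _] := cu s sT.
have := hs; rewrite /= in_itv /= => /(_ sT).
have := P _ (spaceVB Vs Vt); rewrite !sub0r !normrN => h.
rewrite (ger0_norm (normH_ge0 _)) ger0_norm; first exact: le_trans.
by apply: le_trans h; exact: normH_ge0.
Qed.

Lemma continuous_pathB T u v : continuous_path spaceH normH T u ->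
  continuous_path spaceH normH T v -> continuous_path spaceH normH T (fun t => v t - u t).
Proof.
move=> cu cv t tT; have [Ht ct] := cu t tT; have [Gt dt] := cv t tT.
split; first exact: spaceHB.
have c1 : normH (v s - v t) + normH (u s - u t) @[s --> within `[0, T] (nbhs t)] --> (0 : R) + 0.
  exact: cvgD.
rewrite addr0 in c1.
apply/cvgrPdist_le => eps e0; move/cvgrPdist_le/(_ _ e0) : c1.
rewrite !near_withinE; apply: filterS => s hs; rewrite /= in_itv /= => sT.
have := hs; rewrite /= in_itv /= => /(_ sT).
have [/spaceH_L2 us _] := cu s sT; have [/spaceH_L2 vs _] := cv s sT.
move/spaceH_L2 : Ht => ut_; move/spaceH_L2 : Gt => vt_.
rewrite !sub0r !normrN ger0_norm ?addr_ge0 ?normH_ge0// ger0_norm ?normH_ge0//.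
apply: le_trans; rewrite (normHBC (u s)).
have -> : v s - u s - (v t - u t) = (v s - v t) + (u t - u s).
  by apply/funext => i; apply/funext => x; rewrite !fctE; ring.
by apply: normHD; exact: L2fieldB.
Qed.

Lemma time_derivative_ae T u ut vt : {ae lam, forall t, 0 < t < T -> ut t = vt t} ->
  time_derivative T u ut -> time_derivative T u vt.
Proof.
move=> uv tu h Hh phi tphi; rewrite (tu h Hh phi tphi); congr (- _).
apply: ae_eq_Rintegral_nonmeasurable; apply: (ae_imply _ uv) => t e.
by rewrite /= in_itv => /e ->.
Qed.

Lemma smooth_line_continuous (f : R -> R) : smooth_line f ->
  continuous f /\ continuous (derive1 f).
Proof.
move=> sf; split => t; apply/differentiable_continuous/derivable1_diffP.
  exact: (sf 0%N t).
exact: (sf 1%N t).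
Qed.

Lemma continuous_mul_integrable T (f k : R -> R) : continuous f ->
  lam.-integrable `]0, T[ (EFin \o k) -> lam.-integrable `]0, T[ (EFin \o (fun t => f t * k t)).
Proof.
move=> cf ik; have mI : measurable (`]0, T[ : set (measurableTypeR R)) by exact: measurable_itv.
have cK : compact (f @` `[0, T]%classic).
  by apply: continuous_compact; [exact: continuous_subspaceT|exact: segment_compact].
have [M [_ hM]] := compact_bounded cK.
apply: (le_integrable mI _ _ (integrableZl mI (`|M| + 1) ik)).
  apply/measurable_EFinP; apply: measurable_funM.
    by apply: measurable_funTS; exact: continuous_measurable_fun.
  by apply/measurable_EFinP; have [] := integrableP _ _ _ ik.
move=> t /=; rewrite in_itv /= => /andP[t0 tT]; rewrite lee_fin !normrM.
apply: ler_wpM2r => //; rewrite [leRHS]ger0_norm ?addr_ge0//.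
apply: hM; first by have := ler_norm M; lra.
by exists t => //=; rewrite in_itv /= !ltW.
Qed.

Lemma time_derivativeB T u v ut vt :
  continuous_path spaceH normH T u -> continuous_path spaceH normH T v ->
  (forall t, L2field (ut t)) -> (forall t, L2field (vt t)) ->
  (forall h, L2field h -> lam.-integrable `]0, T[ (EFin \o (fun t => ip (ut t) h))) ->
  (forall h, L2field h -> lam.-integrable `]0, T[ (EFin \o (fun t => ip (vt t) h))) ->
  time_derivative T u ut -> time_derivative T v vt ->
  time_derivative T (fun t => v t - u t) (fun t => vt t - ut t).
Proof.
move=> cu cv lut lvt iut ivt du dv h Hh phi tphi; have lh := spaceH_L2 Hh.
have mI : measurable (`]0, T[ : set (measurableTypeR R)) by exact: measurable_itv.
have [c0 c1] := smooth_line_continuous tphi.1.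
have i1 w : continuous_path spaceH normH T w ->
    lam.-integrable `]0, T[ (EFin \o (fun t => derive1 phi t * ip (w t) h)).
  move=> cw; apply: continuous_mul_integrable => //.
  apply: (within_integrable (lexx 0) (lexx T)); apply: within_ip => //.
    by move=> t tT; have [] := cw t tT.
  by move=> t tT; have [] := cw t tT.
transitivity (\int[lam]_(t in `]0, T[) (derive1 phi t * ip (v t) h) -
              \int[lam]_(t in `]0, T[) (derive1 phi t * ip (u t) h)).
  rewrite -RintegralB//; [|exact: i1|exact: i1].
  apply: eq_Rintegral => t; rewrite inE /= in_itv /= => /andP[t0 tT].
  have tT' : 0 <= t <= T by rewrite !ltW.
  have [/spaceH_L2 lu _] := cu t tT'; have [/spaceH_L2 lv _] := cv t tT'.
  by rewrite ipBl// mulrBr.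
rewrite (du h Hh phi tphi) (dv h Hh phi tphi) -opprD; congr (- _).
rewrite -RintegralB//; try exact: continuous_mul_integrable (ivt _ lh).
  by apply: eq_Rintegral => t _; rewrite ipBl// mulrBr.
exact: continuous_mul_integrable (iut _ lh).
Qed.

End Difference.

(** * Absorption of the logarithm *)

Section PointwiseEstimate.
Context {R : realType}.
Notation mu := (torus_measure (@T2 R)).
Implicit Types (u e m : vfield R) (r : R * R -> R).

(** The logarithm is below its tangent at 1 + z for z = 2 C A / nu. The excess
    A S (C E / S) / (1 + z) = A C E / (1 + z) is at most nu E / 2 because A C =
    nu z / 2. *)
Lemma ln_tangent_bound (C A nu E S : R) : 0 <= C -> 0 <= A -> 0 < nu -> 0 <= E -> 0 < S ->
  A * S * ln (1 + C * E / S) <= nu / 2 * E + A * S * ln (1 + 2 * C * A / nu).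
Proof.
move=> C0 A0 nu0 E0 S0; set x := C * E / S; set z := 2 * C * A / nu.
have x0 : 0 <= x by rewrite !mulr_ge0// invr_ge0 ltW.
have z0 : 0 <= z by rewrite !mulr_ge0// invr_ge0 ltW.
have z1 : 0 < 1 + z by lra.
have x1 : 0 < 1 + x by lra.
have AS0 : 0 <= A * S by rewrite mulr_ge0// ltW.
have L : ln (1 + x) <= ln (1 + z) + x / (1 + z).
  rewrite -lerBlDl -ln_div ?posrE//.
  have H0 : -1 < (1 + x) / (1 + z) - 1.
    by rewrite -subr_gt0 opprK addrNK divr_gt0.
  have := le_ln1Dx H0; rewrite [1 + (_ - 1)]addrC addrNK => H; apply: (le_trans H).
  by rewrite lerBlDr ler_pdivrMr// mulrDl divfK ?gt_eqF//; lra.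
apply: (le_trans (ler_wpM2l AS0 L)); rewrite mulrDr addrC lerD2r.
rewrite mulrA ler_pdivrMr// (_ : A * S * x = A * C * E); last first.
  by rewrite /x; field; rewrite gt_eqF.
rewrite mulrDr mulr1 (_ : nu / 2 * E * z = A * C * E); last first.
  by rewrite /z; field; rewrite gt_eqF.
by rewrite lerDr mulr_ge0// divr_ge0// ltW.
Qed.

Lemma sqL2_ge0 r : 0 <= sqL2 r.
Proof. by apply: Rintegral_ge0 => x _; exact: sqr_ge0. Qed.

Lemma sqH1_ge0 r : 0 <= sqH1 r.
Proof. by rewrite /sqH1 addr_ge0 ?sqL2_ge0// sumr_ge0// => i _; exact: sqL2_ge0. Qed.

Lemma logfactor_bound (C A nu E : R) r : 0 <= C -> 0 <= A -> 0 < nu -> 0 <= E ->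
  sqH1 r <= C * E ->
  A * logfactor r * sqL2 r <= nu / 2 * E + A * (1 + ln (1 + 2 * C * A / nu)) * sqL2 r.
Proof.
move=> C0 A0 nu0 E0 hr.
have [S0|S0] := eqVneq (sqL2 r) 0.
  by rewrite S0 !mulr0 addr0 mulr_ge0// divr_ge0// ltW.
have {}S0 : 0 < sqL2 r by rewrite lt_neqAle eq_sym S0 sqL2_ge0.
have x0 : 0 <= sqH1 r / sqL2 r by rewrite divr_ge0 ?sqH1_ge0 ?sqL2_ge0.
have y0 : sqH1 r / sqL2 r <= C * E / sqL2 r by rewrite ler_wpM2r// invr_ge0 ltW.
have L : logfactor r <= 1 + ln (1 + C * E / sqL2 r).
  rewrite /logfactor; case: ifP => _; first by rewrite lerDl ln_ge0//; lra.
  by rewrite lerD2l ler_ln ?posrE//; lra.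
have AS : 0 <= A * sqL2 r by rewrite mulr_ge0// ltW.
have := ln_tangent_bound C0 A0 nu0 E0 S0; have := ler_wpM2l AS L.
rewrite mulrDr mulr1 mulrAC => h1 h2; apply: (le_trans h1).
have -> : A * (1 + ln (1 + 2 * C * A / nu)) * sqL2 r =
  A * sqL2 r + A * sqL2 r * ln (1 + 2 * C * A / nu) by ring.
by move: h2; move: (A * _ * ln _) (A * _ * ln _) => a b h2; lra.
Qed.

Lemma normLinf_ge0 m : 0 <= normLinf m.
Proof. by apply: fine_ge0; exact: Lnorm_ge0. Qed.

Lemma dissipation_arith (nu E S lam B A K V L l n t : R) :
  B / 2 * S <= lam * S -> A * L * S <= nu / 2 * E + B * S ->
  K * V * L * S <= A / 2 * L * S -> - (nu / 2 * E + K * V * L * S) <= t ->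
  nu * (l * n) <= nu * E ->
  2 * (- nu * E - t - lam * S) <= - (nu * l / 2) * n.
Proof. lra. Qed.

(** The trilinear estimate takes nu/2 of the viscous term and the logarithm a
    further nu/4, plus B/2 times the nudged square, which the feedback
    compensates. The last quarter gives the decay rate through Poincare's
    inequality. *)
Lemma nudged_dissipation (lam1 nu Km Cfr U0 U1 lam : R) m u e :
  poincare_constant lam1 -> 0 < nu -> trilinear_constant lam1 m Km ->
  0 <= Cfr -> frame_constant m Cfr ->
  Km * (Num.sqrt lam1)^-1 * U0 * normLinf (shear_defect m) <= nu / 4 ->
  let A := 2 * Km / nu * U1 ^+ 2 in
  A * (1 + ln (1 + 2 * Cfr * A / nu)) / 2 <= lam ->
  spaceV u -> spaceV e -> normH u <= U0 -> normV u <= U1 ->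
  2 * (- nu * normV e ^+ 2 - trilinear e u e - lam * sqL2 (dot e m)) <=
  - (nu * lam1 / 2) * normH e ^+ 2.
Proof.
move=> [l0 hl] nu0 [K0 hK] C0 hC hshear A hlam Vu Ve hu0 hu1.
have E0 : 0 <= normV e ^+ 2 by exact: sqr_ge0.
have [S0 SH] := (sqL2_ge0 (dot e m), hC e Ve).
have sh : Km * (Num.sqrt lam1)^-1 * normH u * normLinf (shear_defect m) <= nu / 4.
  apply: le_trans hshear; apply: ler_wpM2r; first exact: normLinf_ge0.
  by apply: ler_wpM2l => //; rewrite mulr_ge0 ?invr_ge0 ?sqrtr_ge0// ltW.
have T := hK nu u e nu0 Vu Ve sh.
have U1n : normV u ^+ 2 <= U1 ^+ 2 by rewrite ler_pXn2r ?nnegrE ?normV_ge0// (le_trans (normV_ge0 u)).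
have A0 : 0 <= A by rewrite /A mulr_ge0 ?sqr_ge0// divr_ge0 ?(ltW nu0)// mulr_ge0// ltW.
have L1 : 0 <= logfactor (dot e m).
  rewrite /logfactor; case: ifP => // _; rewrite addr_ge0// ln_ge0// lerDl.
  by rewrite divr_ge0 ?sqH1_ge0 ?sqL2_ge0.
have LB := logfactor_bound C0 A0 nu0 E0 SH.
have KL : Km / nu * normV u ^+ 2 * logfactor (dot e m) * sqL2 (dot e m) <=
    A / 2 * logfactor (dot e m) * sqL2 (dot e m).
  apply: ler_wpM2r => //; apply: ler_wpM2r => //.
  have -> : A / 2 = Km / nu * U1 ^+ 2 by rewrite /A; field; rewrite gt_eqF.
  by apply: ler_wpM2l => //; rewrite divr_ge0// ltW.
have hlS := ler_wpM2r S0 hlam; have P := hl e Ve.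
have nP := ler_wpM2l (ltW nu0) P.
move: T; rewrite ler_norml => /andP[T _].
exact: dissipation_arith hlS LB KL T nP.
Qed.

End PointwiseEstimate.

(** * Synchronization *)

Section Synchronization.
Context {R : realType}.
Local Notation lam := (@lebesgue_measure R).

Lemma ess_sup_from_ae (t0 U : R) (h : R -> R) : ess_sup_from t0 h = U%:E ->
  {ae lam, forall t, t0 <= t -> h t <= U}.
Proof.
move=> hU; have := @ess_sup_ge _ _ R (mrestr lam (measurable_itv `[t0, +oo[)) (EFin \o h).
rewrite -/(ess_sup_from t0 h) hU => -[N [mN N0 sub]].
exists (N `&` `[t0, +oo[%classic); split => //.
  by apply: measurableI => //; exact: measurable_itv.
move=> t /= /not_implyP[t0t ht]; split; last by rewrite /= in_itv /= t0t.
by apply: sub => /=; rewrite lee_fin.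
Qed.

End Synchronization.

Theorem theorem5p2 (R : realType)
  (lam1 : R) (hlam1 : poincare_constant lam1)
  (nu : R) (hnu : 0 < nu)
  (f : vfield R) (hf : spaceH f)
  (u0 : vfield R) (hu0 : spaceV u0)
  (u : R -> vfield R) (hu : NS_solution nu f u0 u)
  (t0 : R) (ht0 : 0 <= t0)
  (U0 U1 : R)
  (hU0 : ess_sup_from t0 (fun t => normH (u t)) = U0%:E)
  (hU1 : ess_sup_from t0 (fun t => normV (u t)) = U1%:E)
  (m : vfield R) (hm : unit_field_W2inf m)
  (hcov : controlled_adapted_covering m)
  (Km : R) (hKm : trilinear_constant lam1 m Km)
  (Cfr : R) (hCfr : frame_constant m Cfr)
  (hshear : Km * (Num.sqrt lam1)^-1 * U0 * normLinf (shear_defect m) <= nu / 4) :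
  let A := 2 * Km / nu * U1 ^+ 2 in
  let B := A * (1 + ln (1 + 2 * Cfr * A / nu)) in
  forall mu : R, 0 < mu -> B / 2 <= mu ->
  forall (v0 : vfield R) (v : R -> vfield R), spaceV v0 ->
  nudged_solution nu mu f m u v0 v ->
  (forall t, t0 <= t ->
     normH (v t - u t) ^+ 2 <=
     expR (- (nu * lam1 / 2) * (t - t0)) * normH (v t0 - u t0) ^+ 2) /\
  exponential_synchronization t0 u v.
Proof.
move=> A B mu mu0 hB v0 v Vv0 hv.
have [l0 _] := hlam1.
have decay : forall t, t0 <= t -> normH (v t - u t) ^+ 2 <=
    expR (- (nu * lam1 / 2) * (t - t0)) * normH (v t0 - u t0) ^+ 2; last first.
  split => //; exists (normH (v t0 - u t0)), (nu * lam1 / 4); split.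
    by rewrite divr_gt0// mulr_gt0.
  move=> t tt0; rewrite -(ler_pXn2r (n := 2)) ?nnegrE ?mulr_ge0 ?normH_ge0 ?expR_ge0//.
  rewrite exprMn -expRM_natl mulrC (_ : 2%:R * _ = - (nu * lam1 / 2) * (t - t0)); last by field.
  exact: decay.
move: hu hv => [ut [pu equ _]] [vt [pv eqv _]].
move=> t t0t; pose T := t + 1.
have T0 : 0 < T by rewrite /T ltr_wpDl// (le_trans ht0).
have tT : t < T by rewrite /T ltrDl.
have [cu _ bu du] := pu T T0; have [cv _ bv dv] := pv T T0.
have Vd s : 0 <= s <= T -> spaceV (v s - u s).
  by move=> sT; have [Vu _] := cu s sT; have [Vv _] := cv s sT; exact: spaceVB.
(* A negative Cfr forces the gradient of every field of V to vanish, and then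
   the field itself by Poincare's inequality. *)
have [C0|C0] := ltP Cfr 0.
  have tT' : 0 <= t <= T by rewrite (le_trans ht0 t0t) ltW.
  have E0 : normV (v t - u t) ^+ 2 = 0.
    apply/eqP; rewrite eq_le sqr_ge0 andbT.
    have := hCfr _ (Vd t tT'); have := sqH1_ge0 (dot (v t - u t) m).
    by move: (sqH1 _) => x x0 xC; rewrite -(nmulr_rge0 _ C0) (le_trans x0).
  have := hlam1.2 _ (Vd t tT'); rewrite E0 pmulr_rle0// => h.
  by apply: (le_trans h); rewrite mulr_ge0 ?expR_ge0 ?sqr_ge0.
(* The time derivatives are exchanged for representatives with measurable
   scalar products; the equations hold for the original ones, almost
   everywhere. *)
have [gu [Hgu aeu mgu igu]] := bochner_representative bu.
have [gv [Hgv aev mgv igv]] := bochner_representative bv.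
have cuH := continuous_path_H hlam1 cu; have cvH := continuous_path_H hlam1 cv.
have lgu s := spaceH_L2 (Hgu s); have lgv s := spaceH_L2 (Hgv s).
have mI : measurable (`]0, T[ : set (measurableTypeR R)) by exact: measurable_itv.
have tde : time_derivative T (fun s => v s - u s) (fun s => gv s - gu s).
  apply: (time_derivativeB cuH cvH lgu lgv).
  - by move=> h lh; apply: integrable_ip_derivative igu _ _ lh => // s.
  - by move=> h lh; apply: integrable_ip_derivative igv _ _ lh => // s.
  - exact: time_derivative_ae aeu du.
  - exact: time_derivative_ae aev dv.
have dissip : {ae lebesgue_measure, forall s : R, t0 < s < T ->
    2 * ip (gv s - gu s) (v s - u s) <= - (nu * lam1 / 2) * normH (v s - u s) ^+ 2}.
  have [Hu _ _] := bu; have [Hv _ _] := bv.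
  have all_ae := ae_and (ae_and (ae_and equ eqv) (ae_and aeu aev))
    (ae_and (ae_and Hu Hv) (ae_and (ess_sup_from_ae hU0) (ess_sup_from_ae hU1))).
  apply: (ae_imply _ all_ae) => s [[[eu ev] [au av]] [[hus hvs] [b0 b1]]] /andP[t0s sT].
  have s0 : 0 < s by exact: le_lt_trans t0s.
  have sT' : 0 < s < T by rewrite s0.
  have sT2 : 0 <= s <= T by rewrite !ltW.
  have [Vu _] := cu s sT2.
  rewrite -au// -av//.
  have [au_ [bu_ [g [su bbu -> fu]]]] := eu s0.
  have [av_ [bv_ [g' [sv bbv [p lp ->] fv]]]] := ev s0.
  rewrite (energy_identity hf (hus sT') (hvs sT') su bbu fu sv bbv lp fv).
  apply: (nudged_dissipation hlam1 hnu hKm C0 hCfr hshear hB Vu (Vd s sT2)).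
    exact: b0 (ltW t0s).
  exact: b1 (ltW t0s).
have ced := continuous_pathB cuH cvH.
have k0 : 0 <= nu * lam1 / 2 by rewrite divr_ge0// mulr_ge0// ltW.
apply: (@energy_decay R T (fun s => v s - u s) _ _ (fun s => gv s - gu s)
  (fun s => normH (gv s) + normH (gu s)) t0 (nu * lam1 / 2)) => //.
- by move=> s sT; have [] := ced s sT.
- by move=> s sT; have [] := ced s sT.
- by move=> s; exact: L2fieldB.
- move=> h lh; under eq_fun do rewrite ipBl//.
  by apply: measurable_funB; [exact: mgv|exact: mgu].
- by have := integrableD mI igv igu.
- by move=> s; exact: normHB.
Qed.
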